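(* Suppose that a univariate specialization of Appell's $F_4(a;b;c_1,c_2;x,y)$ function is not onto the singular locus $xy=0$ or $x^2+y^2+1=2xy+2x+2y$, and satisfies a second order ordinary differential equation fully implied by the system $$x(1-x)F_{xx}-y^2F_{yy}-2xyF_{xy}+(c_1-(a+b+1)x)F_x-(a+b+1)yF_y-abF=0,$$ $$y(1-y)F_{yy}-x^2F_{xx}-2xyF_{xy}+(c_2-(a+b+1)y)F_y-(a+b+1)xF_x-abF=0 .$$ Then the specialization is represented by the general expression $$F_4\big(a;b;\,c,\,a+b-c+1;\;s\,t,\;(1-s)(1-t)\big),$$ where $s$ is a constant. The general second order equation (with respect to $t$) is satisfied by ${}_2F_1(a,b;c;t)$.
   Context: $(\alpha)_n=\alpha(\alpha+1)\cdots(\alpha+n-1)$. Appell's function is (the analytic continuation of) $$F_4(a;b;c_1,c_2;x,y)=\sum_{n,m\ge 0}\frac{(a)_{n+m}(b)_{n+m}}{(c_1)_n(c_2)_m\,n!\,m!}x^ny^m ,$$ a solution of the displayed system, which has rank 4. ${}_2F_1(A,B;C;z)=\sum_n \frac{(A)_n(B)_n}{(C)_n n!}z^n$ satisfies Euler's equation $z(1-z)y''+(C-(A+B+1)z)y'-ABy=0$. Univariate specialization: for a (nonconstant) holomorphic map $\Phi:t\mapsto(x(t),y(t))$ from an open subset of $\mathbf C$ to $\mathbf C^2$, $F(x(t),y(t))=F\circ\Phi$; two specializations differing by a change of the variable $t$ are regarded as the same. The partial differential form under $\Phi$ of an ODE $E$ in $t$ is obtained by replacing $t$-derivatives by partial derivatives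 via the chain rule ($\frac{dF}{dt}=\dot xF_x+\dot yF_y$, $\frac{d^2F}{dt^2}=\dot x^2F_{xx}+2\dot x\dot yF_{xy}+\dot y^2F_{yy}+\ddot xF_x+\ddot yF_y$, etc.). The specialized form under $\Phi$ of a linear PDE is obtained by substituting $x=x(t),y=y(t)$ into the coefficients of the partial derivatives. $E$ follows fully from (is fully implied by) a PDE system $H$ under $\Phi$ if its partial differential form coincides with the specialized form of some PDE that follows from $H$ by algebraic and partial differentiation operations.
   Formalization: The open subset of C on which the specialization is defined is assumed connected (a domain); on a disconnected open set different components may lie on lines with different values of s, so no single constant s would exist. *)

(* Defs.v *)
From Stdlib Require Import Reals Factorial.
From Coquelicot Require Import Coquelicot.

Open Scope C_scope.

Definition C_open (U : C -> Prop) : Prop := @open C_UniformSpace U.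

Definition C_connected (U : C -> Prop) : Prop :=
  forall A B : C -> Prop, C_open A -> C_open B ->
    (forall z, U z -> A z \/ B z) ->
    (exists z, U z /\ A z) -> (exists z, U z /\ B z) ->
    exists z, U z /\ A z /\ B z.

Definition C_domain (U : C -> Prop) : Prop :=
  C_open U /\ C_connected U /\ exists z, U z.

Definition holomorphic_on (U : C -> Prop) (f : C -> C) : Prop :=
  forall z, U z -> @ex_derive C_AbsRing C_NormedModule f z.

Definition not_identically_zero (U : C -> Prop) (f : C -> C) : Prop :=
  exists z, U z /\ f z <> 0.

(* [mkODE e2 e1 e0] is the equation e2 f'' + e1 f' + e0 f = 0. *)
Record ode := mkODE { ode2 : C -> C; ode1 : C -> C; ode0 : C -> C }.

Definition second_order_ode (U : C -> Prop) (E : ode) : Prop :=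
  holomorphic_on U (ode2 E) /\ holomorphic_on U (ode1 E) /\
  holomorphic_on U (ode0 E) /\ not_identically_zero U (ode2 E).

Definition ode_satisfied_at (E : ode) (f : C -> C) (t : C) : Prop :=
  ode2 E t * C_derive (C_derive f) t + ode1 E t * C_derive f t + ode0 E t * f t
  = 0.

(* Linear equations are the same when their coefficients are proportional over
   the field of meromorphic functions on the domain [U]. *)
Definition same_ode (U : C -> Prop) (E E' : ode) : Prop :=
  exists u v : C -> C,
    holomorphic_on U u /\ holomorphic_on U v /\
    not_identically_zero U u /\ not_identically_zero U v /\
    forall t, U t ->
      u t * ode2 E t = v t * ode2 E' t /\
      u t * ode1 E t = v t * ode1 E' t /\
      u t * ode0 E t = v t * ode0 E' t.

(* The equation [L] for g(z), rewritten for f(t) = g(tau(t)) by means of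
   g' = f'/tau' and g'' = f''/tau'^2 - tau'' f'/tau'^3, and multiplied by
   tau'^3 to clear denominators. *)
Definition ode_change_var (tau : C -> C) (L : ode) : ode :=
  let d1 := C_derive tau in
  let d2 := C_derive (C_derive tau) in
  mkODE
    (fun t => ode2 L (tau t) * d1 t)
    (fun t => ode1 L (tau t) * (d1 t * d1 t) - ode2 L (tau t) * d2 t)
    (fun t => ode0 L (tau t) * (d1 t * d1 t * d1 t)).

Definition C2_open (Omega : C * C -> Prop) : Prop :=
  @open (prod_UniformSpace C_UniformSpace C_UniformSpace) Omega.

Definition C2_differentiable (f : C * C -> C) (p : C * C) : Prop :=
  @ex_filterdiff C_AbsRing
    (prod_NormedModule C_AbsRing C_NormedModule C_NormedModule) C_NormedModule
    f (locally p).

Definition Dx (f : C * C -> C) : C * C -> C :=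
  fun p => C_derive (fun u => f (u, snd p)) (fst p).

Definition Dy (f : C * C -> C) : C * C -> C :=
  fun p => C_derive (fun v => f (fst p, v)) (snd p).

Fixpoint iterated_partial (w : list bool) (f : C * C -> C) : C * C -> C :=
  match w with
  | nil => f
  | cons true w' => Dx (iterated_partial w' f)
  | cons false w' => Dy (iterated_partial w' f)
  end.

(* For functions holomorphic on an open set the condition on the iterated
   partial derivatives is automatic; it is spelled out because equations may be
   differentiated any number of times. *)
Definition holomorphic2_on (Omega : C * C -> Prop) (f : C * C -> C) : Prop :=
  forall (w : list bool) (p : C * C),
    Omega p -> C2_differentiable (iterated_partial w f) p.

(* [P i j] is the coefficient of d^(i+j) F / dx^i dy^j in the equation P F = 0. *)
Definition pde := nat -> nat -> C * C -> C.

Definition pde_add (P Q : pde) : pde := fun i j p => P i j p + Q i j p.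

Definition pde_mul (f : C * C -> C) (P : pde) : pde := fun i j p => f p * P i j p.

(* Leibniz rule: d/dx (g F_(i,j)) = g_x F_(i,j) + g F_(i+1,j). *)
Definition pde_dx (P : pde) : pde := fun i j p =>
  Dx (P i j) p + match i with O => 0 | S i' => P i' j p end.

Definition pde_dy (P : pde) : pde := fun i j p =>
  Dy (P i j) p + match j with O => 0 | S j' => P i j' p end.

(* The equations that follow from the system [H] over the open set [Omega] by
   algebraic operations (addition, multiplication by a function, division by a
   function that vanishes on no nonempty open set) and partial differentiation. *)
Inductive follows (Omega : C * C -> Prop) (H : pde -> Prop) : pde -> Prop :=
| follows_system P : H P -> follows Omega H P
| follows_add P Q :
    follows Omega H P -> follows Omega H Q -> follows Omega H (pde_add P Q)
| follows_mul f P :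
    holomorphic2_on Omega f -> follows Omega H P -> follows Omega H (pde_mul f P)
| follows_div f P :
    holomorphic2_on Omega f ->
    (forall i j, holomorphic2_on Omega (P i j)) ->
    (forall W, C2_open W -> (forall p, W p -> Omega p) -> (exists p, W p) ->
       exists p, W p /\ f p <> 0) ->
    follows Omega H (pde_mul f P) -> follows Omega H P
| follows_dx P : follows Omega H P -> follows Omega H (pde_dx P)
| follows_dy P : follows Omega H P -> follows Omega H (pde_dy P)
| follows_ext P Q :
    (forall i j p, Omega p -> P i j p = Q i j p) ->
    follows Omega H P -> follows Omega H Q.

Definition specialized_form (x y : C -> C) (P : pde) (i j : nat) (t : C) : C :=
  P i j (x t, y t).

Definition partial_form (x y : C -> C) (E : ode) (i j : nat) (t : C) : C :=
  let x1 := C_derive x t in let x2 := C_derive (C_derive x) t in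
  let y1 := C_derive y t in let y2 := C_derive (C_derive y) t in
  match i, j with
  | 2%nat, 0%nat => ode2 E t * (x1 * x1)
  | 1%nat, 1%nat => ode2 E t * (2 * x1 * y1)
  | 0%nat, 2%nat => ode2 E t * (y1 * y1)
  | 1%nat, 0%nat => ode2 E t * x2 + ode1 E t * x1
  | 0%nat, 1%nat => ode2 E t * y2 + ode1 E t * y1
  | 0%nat, 0%nat => ode0 E t
  | _, _ => 0
  end.

(* The coefficients of the implied equation are only asked to be defined near a
   part Phi(V) of the curve; this allows poles of these coefficients elsewhere
   on the curve. *)
Definition fully_implied (U : C -> Prop) (x y : C -> C) (H : pde -> Prop)
    (E : ode) : Prop :=
  exists (V : C -> Prop) (Omega : C * C -> Prop) (P : pde),
    C_open V /\ (exists t, V t) /\ (forall t, V t -> U t) /\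
    C2_open Omega /\ (forall t, V t -> Omega (x t, y t)) /\
    follows Omega H P /\
    forall t, V t -> forall i j,
      partial_form x y E i j t = specialized_form x y P i j t.

(* A disconnected [U] would carry unrelated specializations on its components. *)
Definition univariate_specialization (U : C -> Prop) (x y : C -> C) : Prop :=
  C_domain U /\ holomorphic_on U x /\ holomorphic_on U y /\
  exists t1 t2, U t1 /\ U t2 /\ (x t1, y t1) <> (x t2, y t2).

Definition F4_eq1 (a b c1 : C) : pde := fun i j p =>
  let x := fst p in let y := snd p in
  match i, j with
  | 2%nat, 0%nat => x * (1 - x)
  | 0%nat, 2%nat => - (y * y)
  | 1%nat, 1%nat => - (2 * x * y)
  | 1%nat, 0%nat => c1 - (a + b + 1) * x
  | 0%nat, 1%nat => - ((a + b + 1) * y)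
  | 0%nat, 0%nat => - (a * b)
  | _, _ => 0
  end.

Definition F4_eq2 (a b c2 : C) : pde := fun i j p =>
  let x := fst p in let y := snd p in
  match i, j with
  | 0%nat, 2%nat => y * (1 - y)
  | 2%nat, 0%nat => - (x * x)
  | 1%nat, 1%nat => - (2 * x * y)
  | 0%nat, 1%nat => c2 - (a + b + 1) * y
  | 1%nat, 0%nat => - ((a + b + 1) * x)
  | 0%nat, 0%nat => - (a * b)
  | _, _ => 0
  end.

Definition F4_system (a b c1 c2 : C) (P : pde) : Prop :=
  P = F4_eq1 a b c1 \/ P = F4_eq2 a b c2.

Definition euler_ode (A B C0 : C) : ode :=
  mkODE (fun z => z * (1 - z))
        (fun z => C0 - (A + B + 1) * z)
        (fun _ => - (A * B)).

Fixpoint pochhammer (alpha : C) (n : nat) : C :=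
  match n with
  | O => 1
  | S m => pochhammer alpha m * (alpha + RtoC (INR m))
  end.

Definition hyp2F1_coef (A B C0 : C) (n : nat) : C :=
  pochhammer A n * pochhammer B n / (pochhammer C0 n * RtoC (INR (fact n))).

(* [hyp2F1_branch A B C0 W G]: on the domain [W], [G] is a branch of the function
   obtained by analytic continuation of the hypergeometric series. *)
Inductive hyp2F1_branch (A B C0 : C) : (C -> Prop) -> (C -> C) -> Prop :=
| hyp2F1_series (G : C -> C) :
    (forall z, Cmod z < 1 ->
       @is_pseries C_AbsRing C_NormedModule (hyp2F1_coef A B C0) z (G z))%R ->
    hyp2F1_branch A B C0 (fun z => Cmod z < 1)%R G
| hyp2F1_continuation W G W' G' :
    hyp2F1_branch A B C0 W G ->
    C_domain W' -> holomorphic_on W' G' ->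
    (exists V, C_open V /\ (exists z, V z) /\
       forall z, V z -> W z /\ W' z /\ G z = G' z) ->
    hyp2F1_branch A B C0 W' G'.

(* Main.v *)
From Stdlib Require Import Reals Lra Lia Classical List.
From Coquelicot Require Import Coquelicot.
Require Import Defs.

(** Away from the singular locus xy Delta = 0 the F4 system is an integrable connection of rank 4
    in the basis (F, F_x, F_y, F_xx).  Sending an operator to its normal form in this basis kills
    everything that follows from the system, so an implied equation whose restriction to the curve
    has order 2 restricts to a combination of the two given equations.  The part of order 2 of this
    condition is y x'^2 + (1 - x - y) x' y' + x y'^2 = 0, a Clairaut equation whose singular
    solution is Delta = 0 and whose general solutions are the lines x = s t, y = (1 - s)(1 - t).
    On such a line the remaining conditions give c1 + c2 = a + b + 1 and Euler's equation.

    Everything is known only on an open part of the curve; it propagates to the whole domain by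
    the identity theorem for holomorphic functions, which rests on Goursat's lemma and a Cauchy
    formula in which the winding number is only needed to be nonzero. *)

Open Scope C_scope.

(** * Complex differentiability *)

(** An implied equation may be derived through equations of arbitrarily high order and by division
    by functions with zeros on the curve. So normal forms are set up for derivatives of every order,
    which is where integrability enters, and their vanishing is stated as an identity of continuous
    functions on the regular part of [Omega]: such an identity survives division by a function that
    vanishes on no open set. The argument is about operators throughout, so no space of solutions
    has to be constructed.

    At a point of the curve the four coordinates of the normal form give four equations: F_xx gives
    Clairaut's equation, F gives the coefficient of order 0, and F_x and F_y give the coefficient of
    order 1 twice. The agreement of these two values is what forces the relation between the
    parameters.

    [holomorphic_on] asks for a single complex derivative, but Clairaut's equation is differentiated
    along the curve and Euler's expression is continued analytically. Both need derivatives of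
    holomorphic functions to be holomorphic; hence the function theory. *)

Definition near (z : C) (P : C -> Prop) : Prop :=
  exists d : R, (0 < d)%R /\ forall w, (Cmod (w - z) < d)%R -> P w.

(** Derivatives refer to the discs of the absolute value, openness to the squares of the product
    structure on pairs of reals. Both neighbourhood filters are reduced to [near]. *)
Lemma near_absring (z : C) (P : C -> Prop) :
  @locally (AbsRing_UniformSpace C_AbsRing) z P <-> near z P.
Proof.
  split.
  - intros [d Hd]. exists d. split; [apply cond_pos|]. intros w Hw. apply Hd, Hw.
  - intros [d [Hd H]]. exists (mkposreal d Hd). intros w Hw. apply H, Hw.
Qed.

Lemma Rabs_re_le (z : C) : (Rabs (fst z) <= Cmod z)%R.
Proof. generalize (Rmax_Cmod z). generalize (Rmax_l (Rabs (fst z)) (Rabs (snd z))). lra. Qed.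

Lemma Rabs_im_le (z : C) : (Rabs (snd z) <= Cmod z)%R.
Proof. generalize (Rmax_Cmod z). generalize (Rmax_r (Rabs (fst z)) (Rabs (snd z))). lra. Qed.

Lemma Cmod_le_abs (z : C) : (Cmod z <= Rabs (fst z) + Rabs (snd z))%R.
Proof.
  destruct z as [u v]. simpl.
  replace ((u, v) : C) with (RtoC u + RtoC v * Ci)
    by (apply injective_projections; simpl; ring).
  eapply Rle_trans; [apply Cmod_triangle|].
  rewrite Cmod_mult, !Cmod_R, Cmod_Ci. lra.
Qed.

Lemma near_locally (z : C) (P : C -> Prop) :
  @locally C_UniformSpace z P <-> near z P.
Proof.
  split.
  - intros [d Hd]. exists d. split; [apply cond_pos|]. intros w Hw. apply Hd.
    split.
    + apply Rle_lt_trans with (2 := Hw). apply (Rabs_re_le (w - z)).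
    + apply Rle_lt_trans with (2 := Hw). apply (Rabs_im_le (w - z)).
  - intros [d [Hd H]]. assert (Hd2 : (0 < d / 2)%R) by lra.
    exists (mkposreal _ Hd2). intros w [H1 H2]. apply H.
    change (Rabs (fst ((w : C) - z)%C) < d / 2)%R in H1.
    change (Rabs (snd ((w : C) - z)%C) < d / 2)%R in H2.
    generalize (Cmod_le_abs (w - z)). lra.
Qed.

Lemma near_imp (z : C) (P Q : C -> Prop) :
  (forall w, P w -> Q w) -> near z P -> near z Q.
Proof. intros H [d [Hd HP]]. exists d. auto. Qed.

Lemma near_and (z : C) (P Q : C -> Prop) :
  near z P -> near z Q -> near z (fun w => P w /\ Q w).
Proof.
  intros [d [Hd HP]] [e [He HQ]]. exists (Rmin d e).
  split; [now apply Rmin_pos|]. intros w Hw.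
  generalize (Rmin_l d e) (Rmin_r d e). intros.
  split; [apply HP|apply HQ]; lra.
Qed.

Lemma near_at (z : C) (P : C -> Prop) : near z P -> P z.
Proof.
  intros [d [Hd H]]. apply H. replace (z - z) with (RtoC 0) by ring.
  now rewrite Cmod_0.
Qed.

Lemma near_open (U : C -> Prop) (z : C) : C_open U -> U z -> near z U.
Proof. intros HU Hz. apply near_locally. now apply HU. Qed.

Lemma open_near (U : C -> Prop) : (forall z, U z -> near z U) -> C_open U.
Proof. intros H z Hz. apply near_locally. now apply H. Qed.

Lemma near_ball (z0 z : C) (r : R) :
  (Cmod (z - z0) < r)%R -> near z (fun w => (Cmod (w - z0) < r)%R).
Proof.
  intros Hz. exists (r - Cmod (z - z0))%R. split; [lra|]. intros w Hw.
  replace (w - z0) with ((w - z) + (z - z0)) by ring.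
  generalize (Cmod_triangle (w - z) (z - z0)). lra.
Qed.

Lemma near_near (z : C) (P : C -> Prop) : near z P -> near z (fun w => near w P).
Proof.
  intros [d [Hd H]]. exists d. split; auto. intros w Hw.
  apply (near_imp w (fun v => (Cmod (v - z) < d)%R)); auto. now apply near_ball.
Qed.

Definition cder (f : C -> C) (z l : C) : Prop :=
  @is_derive C_AbsRing C_NormedModule f z l.
Definition excder (f : C -> C) (z : C) : Prop := exists l : C, cder f z l.

(** The general target covers both module structures on [C]: through [cder_absring] the product and
    chain rules, stated for the ring as a module over itself, apply to [cder]. *)
Lemma filterdiff_C_eps (V : NormedModule C_AbsRing) (f : C -> V) (z : C) (l : V) :
  @is_derive C_AbsRing V f z l <->
  forall eps : R, (0 < eps)%R ->
    near z (fun w => (norm (minus (minus (f w) (f z)) (scal (w - z : C) l))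
                      <= eps * Cmod (w - z))%R).
Proof.
  split.
  - intros [_ H] eps Heps.
    specialize (H z (fun P HP => HP) (mkposreal eps Heps)).
    apply near_absring in H. revert H. apply near_imp. intros w Hw. exact Hw.
  - intros H. split; [apply is_linear_scal_l|].
    intros x Hx.
    assert (Hxz : z = x).
    { apply (@is_filter_lim_locally_unique C_AbsRing (AbsRing_NormedModule C_AbsRing)).
      exact Hx. }
    subst x. intros eps. specialize (H eps (cond_pos eps)).
    apply near_absring. revert H. apply near_imp. intros w Hw. exact Hw.
Qed.

Lemma cder_eps (f : C -> C) (z l : C) :
  cder f z l <->
  forall eps : R, (0 < eps)%R ->
    near z (fun w => (Cmod (f w - f z - l * (w - z)) <= eps * Cmod (w - z))%R).
Proof.
  unfold cder. rewrite filterdiff_C_eps.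
  split; intros H eps Heps; generalize (H eps Heps); apply near_imp; intros w Hw.
  - rewrite (Cmult_comm l). exact Hw.
  - rewrite (Cmult_comm l) in Hw. exact Hw.
Qed.

Lemma cder_absring (f : C -> C) (z l : C) :
  cder f z l <-> @is_derive C_AbsRing (AbsRing_NormedModule C_AbsRing) f z l.
Proof. unfold cder. rewrite !filterdiff_C_eps. reflexivity. Qed.

Definition ccont (f : C -> C) (z : C) : Prop :=
  forall eps : R, (0 < eps)%R -> near z (fun w => (Cmod (f w - f z) < eps)%R).

Lemma ccont_continuous (f : C -> C) (z : C) :
  ccont f z <-> @continuous C_UniformSpace C_UniformSpace f z.
Proof.
  split.
  - intros H P HP. apply near_locally in HP. destruct HP as [e [He HP]].
    apply near_locally. specialize (H e He). revert H. apply near_imp. auto.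
  - intros H eps Heps. 
    specialize (H (fun w => (Cmod (w - f z) < eps)%R)).
    apply near_locally. apply H. apply near_locally. exists eps. auto.
Qed.

Lemma cder_cont (f : C -> C) (z : C) : excder f z -> ccont f z.
Proof.
  intros [l H]. rewrite cder_eps in H. intros eps Heps.
  specialize (H 1%R Rlt_0_1). destruct H as [d [Hd H]].
  set (K := (Cmod l + 2)%R). assert (HK : (0 < K)%R) by (generalize (Cmod_ge_0 l); unfold K; lra).
  exists (Rmin d (eps / K)). split.
  - apply Rmin_pos; auto. now apply Rdiv_lt_0_compat.
  - intros w Hw. generalize (Rmin_l d (eps/K)) (Rmin_r d (eps/K)). intros M1 M2.
    assert (Hw1 : (Cmod (w - z) < d)%R) by lra.
    assert (Hw2 : (Cmod (w - z) < eps / K)%R) by lra.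
    specialize (H w Hw1).
    replace (f w - f z) with ((f w - f z - l * (w - z)) + l * (w - z)) by ring.
    eapply Rle_lt_trans; [apply Cmod_triangle|]. rewrite Cmod_mult.
    assert ((Cmod (w - z) * K < eps)%R).
    { apply Rmult_lt_reg_r with (/ K)%R; [now apply Rinv_0_lt_compat|].
      rewrite Rmult_assoc, Rinv_r, Rmult_1_r; [exact Hw2|lra]. }
    unfold K in *. generalize (Cmod_ge_0 (w - z)). nra.
Qed.

Lemma cder_unique (f : C -> C) (z l : C) : cder f z l -> C_derive f z = l.
Proof. exact (is_C_derive_unique f z l). Qed.

Lemma excder_C_derive (f : C -> C) (z : C) : excder f z -> cder f z (C_derive f z).
Proof. intros H. exact (C_derive_correct f z z H). Qed.

Lemma cder_val (f : C -> C) (z l l' : C) : cder f z l -> l = l' -> cder f z l'.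
Proof. intros H <-. exact H. Qed.

Lemma cder_ext_near (f g : C -> C) (z l : C) :
  near z (fun w => f w = g w) -> cder f z l -> cder g z l.
Proof.
  intros H. apply (@is_derive_ext_loc C_AbsRing C_NormedModule). now apply near_absring.
Qed.

(** [C_derive] is total, a limit taken along the horizontal line through [z]; so it depends on the
    germ alone, for functions without a derivative as well. *)
Lemma C_derive_ext_near (f g : C -> C) (z : C) :
  near z (fun w => f w = g w) -> C_derive f z = C_derive g z.
Proof.
  intros H. unfold C_derive, C_lim.
  destruct H as [d [Hd H]].
  assert (Hz : f z = g z) by (apply H; replace (z - z) with (RtoC 0) by ring; now rewrite Cmod_0).
  assert (HL : Rbar_locally' (fst z) (fun x : R => f (x, snd z) = g (x, snd z))).
  { exists (mkposreal d Hd). intros y Hy _. apply H.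
    apply Rle_lt_trans with (Rabs (y - fst z)); [apply Req_le|exact Hy].
    rewrite <- (Cmod_R (y - fst z)). f_equal.
    apply injective_projections; simpl; ring. }
  f_equal; f_equal; apply Lim_ext_loc; revert HL; apply filter_imp;
    intros u Hu; now rewrite Hu, Hz.
Qed.

Lemma cder_const (k z : C) : cder (fun _ => k) z 0.
Proof. exact (@is_derive_const C_AbsRing C_NormedModule k z). Qed.

Lemma cder_id (z : C) : cder (fun w => w) z 1.
Proof. apply cder_absring. exact (@is_derive_id C_AbsRing z). Qed.

Lemma cder_plus (f g : C -> C) (z l m : C) :
  cder f z l -> cder g z m -> cder (fun w => f w + g w) z (l + m).
Proof. exact (@is_derive_plus C_AbsRing C_NormedModule f g z l m). Qed.

Lemma cder_minus (f g : C -> C) (z l m : C) :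
  cder f z l -> cder g z m -> cder (fun w => f w - g w) z (l - m).
Proof. exact (@is_derive_minus C_AbsRing C_NormedModule f g z l m). Qed.

Lemma cder_mult (f g : C -> C) (z l m : C) :
  cder f z l -> cder g z m -> cder (fun w => f w * g w) z (l * g z + f z * m).
Proof. rewrite !cder_absring. intros Hf Hg.
  exact (@is_derive_mult C_AbsRing f g z l m Hf Hg Cmult_comm). Qed.

Lemma cder_comp (f g : C -> C) (z l m : C) :
  cder f (g z) l -> cder g z m -> cder (fun w => f (g w)) z (l * m).
Proof.
  rewrite (cder_absring g). intros Hf Hg. rewrite Cmult_comm.
  exact (@is_derive_comp C_AbsRing C_NormedModule f g z l m Hf Hg).
Qed.

Lemma Cminus_eq_0 (u v : C) : u - v = 0 -> u = v.
Proof. intros E. replace u with ((u - v) + v) by ring. rewrite E. ring. Qed.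

Lemma Cminus_neq_0 (u v : C) : u <> v -> u - v <> 0.
Proof. intros H E. now apply H, Cminus_eq_0. Qed.

Lemma Cmod_reverse (u v : C) : (Cmod u - Cmod v <= Cmod (u - v))%R.
Proof.
  replace (Cmod u) with (Cmod ((u - v) + v)) by (f_equal; ring).
  generalize (Cmod_triangle (u - v) v). lra.
Qed.

Lemma cder_inv (z : C) : z <> 0 -> cder Cinv z (- / (z * z)).
Proof.
  intros Hz. apply cder_eps. intros eps Heps.
  assert (Hm : (0 < Cmod z)%R) by now apply Cmod_gt_0.
  (* The remainder is (w - z)^2 / (z^2 w), and the first bound keeps Cmod w above Cmod z / 2, so the
     second one makes the quotient at most [eps]. *)
  exists (Rmin (Cmod z / 2) (eps * (Cmod z * Cmod z * Cmod z) / 2)). split.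
  { apply Rmin_pos; [lra|]. apply Rdiv_lt_0_compat; [|lra].
    repeat apply Rmult_lt_0_compat; auto. }
  intros w Hw.
  generalize (Rmin_l (Cmod z / 2) (eps * (Cmod z * Cmod z * Cmod z) / 2))
             (Rmin_r (Cmod z / 2) (eps * (Cmod z * Cmod z * Cmod z) / 2)). intros M1 M2.
  assert (Hwm : (Cmod z / 2 <= Cmod w)%R).
  { generalize (Cmod_reverse z w). replace (z - w) with (- (w - z)) by ring.
    rewrite Cmod_opp. lra. }
  assert (Hw0 : w <> 0) by (intros E; rewrite E, Cmod_0 in Hwm; lra).
  replace (/ w - / z - - / (z * z) * (w - z)) with ((w - z) * ((w - z) / (z * z * w)))
    by (field; auto).
  rewrite Cmod_mult, Rmult_comm. apply Rmult_le_compat_r; [apply Cmod_ge_0|].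
  assert (Hzz : z * z * w <> 0) by (repeat apply Cmult_neq_0; auto).
  rewrite Cmod_div by auto. rewrite !Cmod_mult.
  assert (Hp : (0 < Cmod z * Cmod z * Cmod w)%R)
    by (repeat apply Rmult_lt_0_compat; lra).
  apply Rmult_le_reg_r with (1 := Hp).
  unfold Rdiv. rewrite Rmult_assoc, Rinv_l by lra. rewrite Rmult_1_r.
  apply Rle_trans with (eps * (Cmod z * Cmod z * Cmod z) / 2)%R; [lra|].
  assert (0 < eps * Cmod z * Cmod z)%R by (repeat apply Rmult_lt_0_compat; auto). nra.
Qed.

Lemma cder_inv_fct (f : C -> C) (z l : C) :
  f z <> 0 -> cder f z l -> cder (fun w => / f w) z (- l / (f z * f z)).
Proof.
  intros Hz Hf. eapply cder_val; [apply (cder_comp Cinv f); [now apply cder_inv|exact Hf]|].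
  field. auto.
Qed.

Lemma cder_div (f g : C -> C) (z l m : C) :
  g z <> 0 -> cder f z l -> cder g z m ->
  cder (fun w => f w / g w) z ((l * g z - f z * m) / (g z * g z)).
Proof.
  intros Hz Hf Hg. eapply cder_val.
  - apply (cder_mult f (fun w => / g w)); [exact Hf|apply cder_inv_fct; eauto].
  - field. auto.
Qed.

Lemma ccont_neq0 (f : C -> C) (z : C) : ccont f z -> f z <> 0 -> near z (fun w => f w <> 0).
Proof.
  intros Hf Hz. specialize (Hf (Cmod (f z)) (proj1 (Cmod_gt_0 _) Hz)).
  revert Hf. apply near_imp. intros w Hw E. rewrite E in Hw.
  replace (0 - f z) with (- f z) in Hw by ring. rewrite Cmod_opp in Hw. lra.
Qed.

(** * Integrals along segments *)

Notation CRint := (@RInt C_R_CompleteNormedModule).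
Notation pcont := (@continuous R_UniformSpace C_UniformSpace).
Definition pder (g : R -> C) (t : R) (v : C) : Prop :=
  @is_derive R_AbsRing C_R_NormedModule g t v.

Lemma norm_Cmod (z : C) : @norm R_AbsRing C_R_NormedModule z = Cmod z.
Proof.
  destruct z as [u v]. change (sqrt (Rabs u ^ 2 + Rabs v ^ 2) = sqrt (u ^ 2 + v ^ 2))%R.
  now rewrite !pow2_abs.
Qed.

Lemma C_scal (t : R) (z : C) : @scal R_AbsRing C_R_NormedModule t z = RtoC t * z.
Proof.
  apply injective_projections; simpl; unfold scal; simpl; unfold mult; simpl; ring.
Qed.

Lemma pder_eps (g : R -> C) (t : R) (v : C) :
  pder g t v <->
  forall eps : R, (0 < eps)%R ->
    exists d : R, (0 < d)%R /\ forall s : R, (Rabs (s - t) < d)%R ->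
      (Cmod (g s - g t - RtoC (s - t) * v) <= eps * Rabs (s - t))%R.
Proof.
  split.
  - intros [_ H] eps Heps.
    destruct (H t (fun P HP => HP) (mkposreal eps Heps)) as [d Hd].
    exists d. split; [apply cond_pos|]. intros s Hs. specialize (Hd s Hs).
    rewrite norm_Cmod, C_scal in Hd. exact Hd.
  - intros H. split; [apply is_linear_scal_l|].
    intros x Hx.
    assert (Hxz : t = x).
    { apply (@is_filter_lim_locally_unique R_AbsRing R_NormedModule). exact Hx. }
    subst x. intros eps. destruct (H eps (cond_pos eps)) as [d [Hd H']].
    exists (mkposreal d Hd). intros s Hs. specialize (H' s Hs).
    rewrite norm_Cmod, C_scal. exact H'.
Qed.

Lemma pder_cont (g : R -> C) (t : R) (v : C) : pder g t v -> pcont g t.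
Proof.
  intros H. apply (@ex_derive_continuous R_AbsRing C_R_NormedModule). now exists v.
Qed.

Lemma pder_affine (a v : C) (t : R) : pder (fun s => a + RtoC s * v) t v.
Proof.
  apply pder_eps. intros eps Heps. exists 1%R. split; [lra|]. intros s _.
  replace (a + RtoC s * v - (a + RtoC t * v) - RtoC (s - t) * v) with (RtoC 0)
    by (rewrite RtoC_minus; ring).
  rewrite Cmod_0. generalize (Rabs_pos (s - t)). nra.
Qed.

Lemma pder_comp (G : C -> C) (g : R -> C) (t : R) (l v : C) :
  cder G (g t) l -> pder g t v -> pder (fun s => G (g s)) t (l * v).
Proof.
  rewrite cder_eps, !pder_eps. intros HG Hg eps Heps.
  set (e1 := (eps / (2 * (Cmod v + 1)))%R).
  (* The cap 1 keeps Cmod (g s - g t) below (Cmod v + 1) * Rabs (s - t), whatever [eps] is. *)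
  set (e2 := Rmin 1 (eps / (2 * (Cmod l + 1)))%R).
  generalize (Cmod_ge_0 v) (Cmod_ge_0 l). intros Hv Hl.
  assert (He1 : (0 < e1)%R) by (apply Rdiv_lt_0_compat; lra).
  assert (He2 : (0 < e2)%R) by (apply Rmin_pos; [lra|apply Rdiv_lt_0_compat; lra]).
  destruct (HG e1 He1) as [d1 [Hd1 H1]].
  destruct (Hg e2 He2) as [d2 [Hd2 H2]].
  exists (Rmin d2 (d1 / (Cmod v + 1))). split.
  { apply Rmin_pos; auto. apply Rdiv_lt_0_compat; lra. }
  intros s Hs.
  generalize (Rmin_l d2 (d1 / (Cmod v + 1))) (Rmin_r d2 (d1 / (Cmod v + 1))).
  intros M1 M2. specialize (H2 s ltac:(lra)).
  assert (E2 : (e2 <= 1)%R) by apply Rmin_l.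
  assert (E2' : (e2 * (Cmod l + 1) <= eps / 2)%R).
  { apply Rle_trans with (eps / (2 * (Cmod l + 1)) * (Cmod l + 1))%R.
    - apply Rmult_le_compat_r; [lra|apply Rmin_r].
    - apply Req_le. field. lra. }
  assert (E1' : (e1 * (Cmod v + 1) = eps / 2)%R) by (unfold e1; field; lra).
  assert (Hd : (Cmod (g s - g t) <= (Cmod v + 1) * Rabs (s - t))%R).
  { replace (g s - g t) with ((g s - g t - RtoC (s - t) * v) + RtoC (s - t) * v) by ring.
    eapply Rle_trans; [apply Cmod_triangle|]. rewrite Cmod_mult, Cmod_R.
    generalize (Rabs_pos (s - t)). nra. }
  assert (Hlt : (Cmod (g s - g t) < d1)%R).
  { apply Rle_lt_trans with (1 := Hd).
    replace d1 with ((Cmod v + 1) * (d1 / (Cmod v + 1)))%R by (field; lra).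
    apply Rmult_lt_compat_l; lra. }
  specialize (H1 (g s) Hlt).
  replace (G (g s) - G (g t) - RtoC (s - t) * (l * v)) with
    ((G (g s) - G (g t) - l * (g s - g t)) + l * (g s - g t - RtoC (s - t) * v)) by ring.
  eapply Rle_trans; [apply Cmod_triangle|]. rewrite Cmod_mult.
  generalize (Rabs_pos (s - t)). intros Hp.
  assert (e1 * Cmod (g s - g t) <= e1 * ((Cmod v + 1) * Rabs (s - t)))%R
    by (apply Rmult_le_compat_l; lra).
  assert (Cmod l * Cmod (g s - g t - RtoC (s - t) * v) <= Cmod l * (e2 * Rabs (s - t)))%R
    by (apply Rmult_le_compat_l; lra).
  assert (e1 * ((Cmod v + 1) * Rabs (s - t)) = eps / 2 * Rabs (s - t))%R
    by (rewrite <- E1'; ring).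
  assert (Cmod l * (e2 * Rabs (s - t)) <= eps / 2 * Rabs (s - t))%R.
  { replace (Cmod l * (e2 * Rabs (s - t)))%R with ((e2 * Cmod l) * Rabs (s - t))%R by ring.
    apply Rmult_le_compat_r; nra. }
  lra.
Qed.

Lemma pcont_comp (f : C -> C) (g : R -> C) (t : R) :
  ccont f (g t) -> pcont g t -> pcont (fun s => f (g s)) t.
Proof.
  intros Hf Hg. apply (continuous_comp g f); auto. now apply ccont_continuous.
Qed.

Lemma pcont_mult (f g : R -> C) (t : R) :
  pcont f t -> pcont g t -> pcont (fun s => f s * g s) t.
Proof.
  intros Hf Hg.
  assert (H1 : forall h : R -> C, pcont h t -> continuous (fun s => fst (h s)) t)
    by (intros h Hh; apply (continuous_comp h fst); [exact Hh|apply continuous_fst]).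
  assert (H2 : forall h : R -> C, pcont h t -> continuous (fun s => snd (h s)) t)
    by (intros h Hh; apply (continuous_comp h snd); [exact Hh|apply continuous_snd]).
  apply (continuous_comp_2 (fun s => fst (f s) * fst (g s) - snd (f s) * snd (g s))%R
           (fun s => fst (f s) * snd (g s) + snd (f s) * fst (g s))%R (fun u v => (u, v))).
  - apply (@continuous_minus R_UniformSpace R_AbsRing R_NormedModule);
      apply (@continuous_mult R_UniformSpace R_AbsRing); auto.
  - apply (@continuous_plus R_UniformSpace R_AbsRing R_NormedModule);
      apply (@continuous_mult R_UniformSpace R_AbsRing); auto.
  - apply continuous_ext with (fun u : R * R => u); [now intros []|apply continuous_id].
Qed.

Lemma pcont_const (k : C) (t : R) : pcont (fun _ => k) t.
Proof. apply continuous_const. Qed.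

Definition cint_on (f : R -> C) (a b : R) : Prop :=
  forall t : R, (a <= t <= b)%R -> pcont f t.

Lemma cint_ex (f : R -> C) (a b : R) : (a <= b)%R -> cint_on f a b ->
  @ex_RInt C_R_NormedModule f a b.
Proof.
  intros Hab H. apply (@ex_RInt_continuous C_R_CompleteNormedModule).
  rewrite Rmin_left, Rmax_right by lra. exact H.
Qed.

(** The integral is taken in a real module, so a complex factor is treated through the real and
    imaginary parts. *)
Lemma cint_mult (k : C) (f : R -> C) (a b : R) : (a <= b)%R -> cint_on f a b ->
  CRint (fun t => k * f t) a b = k * CRint f a b.
Proof.
  intros Hab H.
  assert (H1 := @RInt_correct C_R_CompleteNormedModule f a b (cint_ex f a b Hab H)).
  apply (@is_RInt_unique C_R_CompleteNormedModule).
  assert (Hf := is_RInt_fct_extend_fst f a b _ H1).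
  assert (Hs := is_RInt_fct_extend_snd f a b _ H1).
  apply (is_RInt_fct_extend_pair (fun t => k * f t)); simpl.
  - apply (@is_RInt_minus R_NormedModule);
      apply (@is_RInt_scal R_NormedModule); assumption.
  - apply (@is_RInt_plus R_NormedModule);
      apply (@is_RInt_scal R_NormedModule); assumption.
Qed.

Lemma cint_minus (f g : R -> C) (a b : R) : (a <= b)%R -> cint_on f a b -> cint_on g a b ->
  CRint (fun t => f t - g t) a b = CRint f a b - CRint g a b.
Proof.
  intros Hab Hf Hg.
  apply (@RInt_minus C_R_CompleteNormedModule); now apply cint_ex.
Qed.

Lemma cint_bound (f : R -> C) (h : R -> R) (a b : R) (H : R) : (a <= b)%R -> cint_on f a b ->
  (forall t, (a <= t <= b)%R -> (Cmod (f t) <= h t)%R) -> is_RInt h a b H ->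
  (Cmod (CRint f a b) <= H)%R.
Proof.
  intros Hab Hf Hb Hh. rewrite <- norm_Cmod.
  apply (@norm_RInt_le C_R_NormedModule f h a b); auto.
  - intros t Ht. rewrite norm_Cmod. now apply Hb.
  - apply (@RInt_correct C_R_CompleteNormedModule). now apply cint_ex.
Qed.

Lemma cint_bound_const (f : R -> C) (a b M : R) : (a <= b)%R -> cint_on f a b ->
  (forall t, (a <= t <= b)%R -> (Cmod (f t) <= M)%R) ->
  (Cmod (CRint f a b) <= (b - a) * M)%R.
Proof.
  intros Hab Hf Hb. apply cint_bound with (fun _ => M); auto.
  apply (@is_RInt_const R_NormedModule).
Qed.

Lemma cint_ext (f g : R -> C) (a b : R) : (a <= b)%R ->
  (forall t, (a <= t <= b)%R -> f t = g t) -> CRint f a b = CRint g a b.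
Proof.
  intros Hab H. apply (@RInt_ext C_R_CompleteNormedModule).
  rewrite Rmin_left, Rmax_right by lra. intros t Ht. apply H. lra.
Qed.

Lemma cint_ftc (f df : R -> C) (a b : R) : (a <= b)%R ->
  (forall t, (a <= t <= b)%R -> pder f t (df t)) -> cint_on df a b ->
  CRint df a b = f b - f a.
Proof.
  intros Hab Hd Hc. apply (@is_RInt_unique C_R_CompleteNormedModule).
  apply (@is_RInt_derive C_R_CompleteNormedModule);
    rewrite Rmin_left, Rmax_right by lra; auto.
Qed.

Definition pt (a b : C) (t : R) : C := a + RtoC t * (b - a).
Definition seg (f : C -> C) (a b : C) : C :=
  (b - a) * CRint (fun t => f (pt a b t)) 0 1.
Definition cont_seg (f : C -> C) (a b : C) : Prop :=
  forall t, (0 <= t <= 1)%R -> ccont f (pt a b t).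

Lemma pt_cont (a b : C) (t : R) : pcont (pt a b) t.
Proof. eapply pder_cont. apply pder_affine. Qed.

Lemma cont_seg_cint (f : C -> C) (a b : C) : cont_seg f a b ->
  cint_on (fun t => f (pt a b t)) 0 1.
Proof. intros H t Ht. apply pcont_comp; [now apply H|apply pt_cont]. Qed.

Lemma seg_minus_bound (f g : C -> C) (a b : C) (M : R) :
  cont_seg f a b -> cont_seg g a b ->
  (forall t, (0 <= t <= 1)%R -> (Cmod (f (pt a b t) - g (pt a b t)) <= M)%R) ->
  (Cmod (seg f a b - seg g a b) <= M * Cmod (b - a))%R.
Proof.
  intros Hf Hg HM. unfold seg.
  assert (H01 : (0 <= 1)%R) by lra.
  replace ((b - a) * CRint (fun t => f (pt a b t)) 0 1 -
           (b - a) * CRint (fun t => g (pt a b t)) 0 1)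
    with ((b - a) * (CRint (fun t => f (pt a b t)) 0 1 -
           CRint (fun t => g (pt a b t)) 0 1)) by ring.
  rewrite <- cint_minus by (auto; now apply cont_seg_cint).
  rewrite Cmod_mult, Rmult_comm. apply Rmult_le_compat_r; [apply Cmod_ge_0|].
  replace M with ((1 - 0) * M)%R by ring. apply cint_bound_const; auto.
  intros t Ht. apply (@continuous_minus R_UniformSpace R_AbsRing C_R_NormedModule);
    now apply cont_seg_cint.
Qed.

Lemma seg_ftc (F f : C -> C) (a b : C) :
  (forall t, (0 <= t <= 1)%R -> cder F (pt a b t) (f (pt a b t))) ->
  cont_seg f a b -> seg f a b = F b - F a.
Proof.
  intros HF Hc. unfold seg. assert (H01 : (0 <= 1)%R) by lra.
  rewrite <- cint_mult by (auto; now apply cont_seg_cint).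
  rewrite (cint_ftc (fun t => F (pt a b t))); auto.
  - unfold pt. f_equal; f_equal; [|f_equal]; ring.
  - intros t Ht. rewrite Cmult_comm. apply pder_comp; auto. apply pder_affine.
  - intros t Ht. apply pcont_mult; [apply pcont_const|now apply cont_seg_cint].
Qed.

Lemma seg_swap (f : C -> C) (a b : C) : cont_seg f a b -> seg f b a = - seg f a b.
Proof.
  intros Hc. unfold seg. assert (H01 : (0 <= 1)%R) by lra.
  assert (Hm1 : RtoC (-1) = - RtoC 1) by (apply injective_projections; simpl; ring).
  assert (E : CRint (fun t => f (pt b a t)) 0 1 = CRint (fun t => f (pt a b t)) 0 1).
  { assert (H := cint_ex _ _ _ H01 (cont_seg_cint f a b Hc)).
    (* The substitution t -> 1 - t, which exchanges the limits of integration. *)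
    assert (L := @RInt_comp_lin C_R_CompleteNormedModule (fun t => f (pt a b t)) (-1) 1 0 1).
    replace (-1 * 0 + 1)%R with 1%R in L by ring.
    replace (-1 * 1 + 1)%R with 0%R in L by ring.
    specialize (L (ex_RInt_swap _ _ _ H)).
    rewrite <- (@opp_RInt_swap C_R_CompleteNormedModule _ _ _ H) in L.
    rewrite <- (opp_opp (CRint (fun t => f (pt a b t)) 0 1)), <- L.
    rewrite <- (@RInt_opp C_R_CompleteNormedModule).
    - apply cint_ext; auto. intros t Ht.
      rewrite <- (@scal_opp_one R_AbsRing C_R_NormedModule), !C_scal.
      replace (pt a b (-1 * t + 1)) with (pt b a t)
        by (unfold pt; rewrite RtoC_plus, RtoC_mult, Hm1; ring).
      change (RtoC (opp one)) with (RtoC (-(1))%R). rewrite RtoC_opp, Hm1. ring.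
    - refine (@ex_RInt_comp_lin C_R_NormedModule (fun t => f (pt a b t)) (-1) 1 0 1 _).
      replace (-1 * 0 + 1)%R with 1%R by ring.
      replace (-1 * 1 + 1)%R with 0%R by ring. exact (ex_RInt_swap _ _ _ H). }
  rewrite E. ring.
Qed.

Definition mid (a b : C) : C := pt a b (1 / 2).

Lemma seg_mid (f : C -> C) (a b : C) : cont_seg f a b ->
  seg f a b = seg f a (mid a b) + seg f (mid a b) b.
Proof.
  intros Hc. unfold seg. assert (H01 : (0 <= 1)%R) by lra.
  set (phi := fun t => f (pt a b t)).
  assert (Hphi : cint_on phi 0 1) by now apply cont_seg_cint.
  assert (Ha : @ex_RInt C_R_NormedModule phi 0 (1/2))
    by (apply cint_ex; [lra|intros t Ht; apply Hphi; lra]).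
  assert (Hb : @ex_RInt C_R_NormedModule phi (1/2) 1)
    by (apply cint_ex; [lra|intros t Ht; apply Hphi; lra]).
  rewrite <- (@RInt_Chasles C_R_CompleteNormedModule phi 0 (1/2) 1 Ha Hb).
  assert (L1 := @RInt_comp_lin C_R_CompleteNormedModule phi (1/2) 0 0 1).
  replace (1/2 * 0 + 0)%R with 0%R in L1 by field.
  replace (1/2 * 1 + 0)%R with (1/2)%R in L1 by field.
  assert (L2 := @RInt_comp_lin C_R_CompleteNormedModule phi (1/2) (1/2) 0 1).
  replace (1/2 * 0 + 1/2)%R with (1/2)%R in L2 by field.
  replace (1/2 * 1 + 1/2)%R with 1%R in L2 by field.
  assert (Hh : RtoC (1/2) + RtoC (1/2) = 1) by (rewrite <- RtoC_plus; f_equal; field).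
  assert (P1 : forall t, pt a (mid a b) t = pt a b (1/2 * t + 0)).
  { intros t. unfold mid, pt. rewrite RtoC_plus, RtoC_mult. ring. }
  assert (P2 : forall t, pt (mid a b) b t = pt a b (1/2 * t + 1/2)).
  { intros t. unfold mid, pt. rewrite RtoC_plus, RtoC_mult.
    replace (b - (a + RtoC (1/2) * (b - a))) with ((RtoC 1 - RtoC (1/2)) * (b - a)) by ring.
    rewrite <- Hh. ring. }
  assert (Q1 : cint_on (fun t => f (pt a (mid a b) t)) 0 1).
  { intros t Ht. apply pcont_comp; [|apply pt_cont]. rewrite P1. apply Hc. lra. }
  assert (Q2 : cint_on (fun t => f (pt (mid a b) b t)) 0 1).
  { intros t Ht. apply pcont_comp; [|apply pt_cont]. rewrite P2. apply Hc. lra. }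
  assert (E1 : CRint phi 0 (1/2) = RtoC (1/2) * CRint (fun t => f (pt a (mid a b) t)) 0 1).
  { rewrite <- cint_mult, <- (L1 Ha) by auto. apply cint_ext; auto. intros t Ht.
    rewrite C_scal, P1. reflexivity. }
  assert (E2 : CRint phi (1/2) 1 = RtoC (1/2) * CRint (fun t => f (pt (mid a b) b t)) 0 1).
  { rewrite <- cint_mult, <- (L2 Hb) by auto. apply cint_ext; auto. intros t Ht.
    rewrite C_scal, P2. reflexivity. }
  rewrite E1, E2. change (plus ?u ?v) with (u + v).
  replace (mid a b - a) with (RtoC (1/2) * (b - a)) by (unfold mid, pt; ring).
  replace (b - mid a b) with (RtoC (1/2) * (b - a)).
  - change (@plus _ ?u ?v) with (Cplus u v). ring.
  - unfold mid, pt. replace (RtoC (1/2)) with (1 - RtoC (1/2)) at 1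
      by (rewrite <- Hh; ring). ring.
Qed.

(** * Goursat's lemma *)

(** The steps that remain after [u n] add up to at most 2 D / 2^n, so the intervals of this radius
    around [u n] are nested; the limit is the supremum of their left ends. *)
Lemma geometric_steps_limit_R (u : nat -> R) (D : R) :
  (forall n, (Rabs (u (S n) - u n) <= D / 2 ^ n)%R) ->
  exists l : R, forall n, (Rabs (l - u n) <= 2 * D / 2 ^ n)%R.
Proof.
  intros H.
  assert (P2 : forall n, (0 < 2 ^ n)%R) by (intros n; apply pow_lt; lra).
  assert (E2 : forall n, (2 * D / 2 ^ n = D / 2 ^ n + 2 * D / 2 ^ S n)%R).
  { intros n. simpl. field. specialize (P2 n). lra. }
  assert (HD : forall n, (0 <= D / 2 ^ n)%R).
  { intros n. eapply Rle_trans; [apply Rabs_pos|apply H]. }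
  set (lo := fun n => (u n - 2 * D / 2 ^ n)%R).
  set (hi := fun n => (u n + 2 * D / 2 ^ n)%R).
  assert (Hlo : forall n m, (n <= m)%nat -> (lo n <= lo m)%R).
  { intros n m Hnm. induction Hnm; [lra|]. eapply Rle_trans; [exact IHHnm|].
    unfold lo. specialize (H m). apply Rabs_le_between in H. rewrite (E2 m). lra. }
  assert (Hhi : forall n m, (n <= m)%nat -> (hi m <= hi n)%R).
  { intros n m Hnm. induction Hnm; [lra|]. eapply Rle_trans; [|exact IHHnm].
    unfold hi. specialize (H m). apply Rabs_le_between in H. rewrite (E2 m). lra. }
  assert (Hlh : forall n m, (lo n <= hi m)%R).
  { intros n m. set (k := max n m).
    apply Rle_trans with (lo k); [apply Hlo; unfold k; lia|].
    apply Rle_trans with (hi k); [|apply Hhi; unfold k; lia].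
    unfold lo, hi. rewrite E2. specialize (HD k) as H1. specialize (HD (S k)) as H2.
    unfold Rdiv in *. lra. }
  destruct (completeness (fun r => exists n, r = lo n)) as [l [Hub Hlub]].
  - exists (hi O). intros r [n ->]. apply Hlh.
  - exists (lo O). now exists O.
  - exists l. intros n. apply Rabs_le_between.
    assert (lo n <= l)%R by (apply Hub; now exists n).
    assert (l <= hi n)%R by (apply Hlub; intros r [m ->]; apply Hlh).
    unfold lo, hi in *. lra.
Qed.

Lemma geometric_steps_limit (u : nat -> C) (D : R) :
  (forall n, (Cmod (u (S n) - u n) <= D / 2 ^ n)%R) ->
  exists p : C, forall n, (Cmod (p - u n) <= 4 * D / 2 ^ n)%R.
Proof.
  intros H.
  destruct (geometric_steps_limit_R (fun n => fst (u n)) D) as [l1 H1].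
  { intros n. eapply Rle_trans; [|apply H]. apply (Rabs_re_le (u (S n) - u n)). }
  destruct (geometric_steps_limit_R (fun n => snd (u n)) D) as [l2 H2].
  { intros n. eapply Rle_trans; [|apply H]. apply (Rabs_im_le (u (S n) - u n)). }
  (* The constant 4 is the real constant 2, once for each component. *)
  exists (l1, l2). intros n. eapply Rle_trans; [apply Cmod_le_abs|]. simpl.
  specialize (H1 n). specialize (H2 n). unfold Rdiv, Rminus in *. lra.
Qed.

Definition tri (f : C -> C) (a b c : C) : C := seg f a b + seg f b c + seg f c a.

Definition convex (K : C -> Prop) : Prop :=
  forall a b t, K a -> K b -> (0 <= t <= 1)%R -> K (pt a b t).

(** Closedness in the form that puts the common point of the nested triangles into [K]. Goursat's
    lemma is needed for a closed convex set, the part of a disc cut off by a half plane. *)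
Definition limit_closed (K : C -> Prop) : Prop :=
  forall p, (forall eps, (0 < eps)%R -> exists q, K q /\ (Cmod (q - p) < eps)%R) -> K p.

Lemma mid_diff (a b c : C) : mid a b - mid a c = RtoC (1 / 2) * (b - c).
Proof. unfold mid, pt. ring. Qed.

Lemma mid_comm (a b : C) : mid a b = mid b a.
Proof.
  unfold mid, pt.
  assert (Hh : RtoC (1/2) + RtoC (1/2) = 1) by (rewrite <- RtoC_plus; f_equal; field).
  replace a with ((RtoC (1/2) + RtoC (1/2)) * a) at 1 by (rewrite Hh; ring).
  replace b with ((RtoC (1/2) + RtoC (1/2)) * b) at 2 by (rewrite Hh; ring).
  ring.
Qed.

Lemma mid_id (a : C) : mid a a = a.
Proof. unfold mid, pt. ring. Qed.

Lemma Cmod_half (z : C) : Cmod (RtoC (1 / 2) * z) = (Cmod z / 2)%R.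
Proof. rewrite Cmod_mult, Cmod_R, Rabs_pos_eq by lra. lra. Qed.

Lemma Cmod_sym (a b : C) : Cmod (a - b) = Cmod (b - a).
Proof. rewrite <- Cmod_opp. f_equal. ring. Qed.

Lemma Cmod_pt (a b p : C) (t r : R) : (0 <= t <= 1)%R ->
  (Cmod (a - p) <= r)%R -> (Cmod (b - p) <= r)%R -> (Cmod (pt a b t - p) <= r)%R.
Proof.
  intros Ht Ha Hb.
  replace (pt a b t - p) with (RtoC (1 - t) * (a - p) + RtoC t * (b - p))
    by (unfold pt; rewrite RtoC_minus; ring).
  eapply Rle_trans; [apply Cmod_triangle|]. rewrite !Cmod_mult, !Cmod_R.
  rewrite !Rabs_pos_eq by lra. nra.
Qed.

Lemma Cmod_pt_lt (a b p : C) (t r : R) : (0 <= t <= 1)%R ->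
  (Cmod (a - p) < r)%R -> (Cmod (b - p) < r)%R -> (Cmod (pt a b t - p) < r)%R.
Proof.
  intros Ht Ha Hb.
  apply Rle_lt_trans with (Rmax (Cmod (a - p)) (Cmod (b - p))).
  - apply Cmod_pt; auto; [apply Rmax_l|apply Rmax_r].
  - now apply Rmax_lub_lt.
Qed.

Lemma small_half_pow (M e : R) : (0 < e)%R -> (0 < M)%R ->
  exists n, (M / 2 ^ n < e)%R.
Proof.
  intros He HM. destruct (pow_lt_1_zero (1/2) ltac:(rewrite Rabs_pos_eq; lra) (e / M))
    as [n Hn]; [now apply Rdiv_lt_0_compat|].
  exists n. specialize (Hn n (le_n n)). rewrite Rabs_pos_eq in Hn by (apply pow_le; lra).
  unfold Rdiv in Hn at 1. rewrite Rmult_1_l, pow_inv in Hn. unfold Rdiv.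
  apply Rmult_lt_compat_l with (r := M) in Hn; auto.
  replace (M * (e / M))%R with e in Hn by (field; lra). exact Hn.
Qed.

Section Goursat.

Variables (K : C -> Prop) (f : C -> C).
Hypothesis (Kconv : convex K) (Kclosed : limit_closed K).
Hypothesis Hf : forall z, K z -> excder f z.

Lemma convex_cont_seg (a b : C) : K a -> K b -> cont_seg f a b.
Proof. intros Ha Hb t Ht. apply cder_cont, Hf. now apply Kconv. Qed.

Lemma mid_in (a b : C) : K a -> K b -> K (mid a b).
Proof. intros Ha Hb. apply Kconv; auto. lra. Qed.

(** Each side of the middle triangle is run through once in each direction, and the two integrals
    cancel. *)
Lemma tri_split (a b c : C) : K a -> K b -> K c ->
  tri f a b c =
  tri f a (mid a b) (mid a c) + tri f (mid a b) b (mid b c) +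
  tri f (mid a c) (mid b c) c + tri f (mid a b) (mid b c) (mid a c).
Proof.
  intros Ha Hb Hc. unfold tri.
  pose proof (mid_in a b Ha Hb). pose proof (mid_in a c Ha Hc). pose proof (mid_in b c Hb Hc).
  rewrite (seg_mid f a b), (seg_mid f b c), (seg_mid f c a) by now apply convex_cont_seg.
  rewrite (mid_comm c a).
  rewrite (seg_swap f (mid a b) (mid b c)), (seg_swap f (mid b c) (mid a c)),
    (seg_swap f (mid a c) (mid a b)) by now apply convex_cont_seg.
  ring.
Qed.

Notation triple := (C * C * C)%type.
Definition tri_mod (q : triple) : R := let '(a, b, c) := q in Cmod (tri f a b c).

Definition subtriangle (k : nat) (q : triple) : triple :=
  let '(a, b, c) := q in
  match k with
  | 0%nat => (a, mid a b, mid a c)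
  | 1%nat => (mid a b, b, mid b c)
  | 2%nat => (mid a c, mid b c, c)
  | _ => (mid a b, mid b c, mid a c)
  end.

Definition bisect (q : triple) : triple :=
  if Rle_dec (tri_mod q / 4) (tri_mod (subtriangle 0 q)) then subtriangle 0 q
  else if Rle_dec (tri_mod q / 4) (tri_mod (subtriangle 1 q)) then subtriangle 1 q
  else if Rle_dec (tri_mod q / 4) (tri_mod (subtriangle 2 q)) then subtriangle 2 q
  else subtriangle 3 q.

Definition inK (q : triple) : Prop := let '(a, b, c) := q in K a /\ K b /\ K c.

Definition sides (q : triple) (D : R) : Prop :=
  let '(a, b, c) := q in
  (Cmod (a - b) <= D /\ Cmod (b - c) <= D /\ Cmod (c - a) <= D)%R.

Lemma subtriangle_inK (k : nat) (q : triple) : inK q -> inK (subtriangle k q).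
Proof.
  destruct q as [[a b] c]. intros (Ha & Hb & Hc).
  destruct k as [|[|[|k]]]; simpl; auto using mid_in.
Qed.

Lemma subtriangle_sides (k : nat) (q : triple) (D : R) : sides q D -> sides (subtriangle k q) (D / 2).
Proof.
  destruct q as [[a b] c]. intros (H1 & H2 & H3).
  assert (E1 : Cmod (a - mid a b) = (Cmod (a - b) / 2)%R)
    by (rewrite <- (mid_id a) at 1; now rewrite mid_diff, Cmod_half).
  assert (E2 : Cmod (mid a b - b) = (Cmod (a - b) / 2)%R)
    by (rewrite <- (mid_id b) at 2; rewrite (mid_comm a b); now rewrite mid_diff, Cmod_half).
  assert (E3 : Cmod (b - mid b c) = (Cmod (b - c) / 2)%R)
    by (rewrite <- (mid_id b) at 1; now rewrite mid_diff, Cmod_half).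
  assert (E4 : Cmod (mid b c - c) = (Cmod (b - c) / 2)%R)
    by (rewrite <- (mid_id c) at 2; rewrite (mid_comm b c); now rewrite mid_diff, Cmod_half).
  assert (E5 : Cmod (c - mid a c) = (Cmod (c - a) / 2)%R)
    by (rewrite <- (mid_id c) at 1; rewrite (mid_comm a c); now rewrite mid_diff, Cmod_half).
  assert (E6 : Cmod (mid a c - a) = (Cmod (c - a) / 2)%R)
    by (rewrite <- (mid_id a) at 2; now rewrite mid_diff, Cmod_half).
  assert (E7 : Cmod (mid a b - mid a c) = (Cmod (b - c) / 2)%R)
    by now rewrite mid_diff, Cmod_half.
  assert (E8 : Cmod (mid b c - mid a b) = (Cmod (c - a) / 2)%R)
    by (rewrite (mid_comm a b); now rewrite mid_diff, Cmod_half).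
  assert (E9 : Cmod (mid a c - mid b c) = (Cmod (a - b) / 2)%R)
    by (rewrite (mid_comm a c), (mid_comm b c); now rewrite mid_diff, Cmod_half).
  assert (E7' := Cmod_sym (mid a b) (mid a c)).
  assert (E8' := Cmod_sym (mid b c) (mid a b)).
  assert (E9' := Cmod_sym (mid a c) (mid b c)).
  destruct k as [|[|[|k]]]; simpl; repeat split; lra.
Qed.

Lemma subtriangle_first (k : nat) (q : triple) (D : R) : sides q D ->
  (Cmod (fst (fst (subtriangle k q)) - fst (fst q)) <= D)%R.
Proof.
  destruct q as [[a b] c]. intros (H1 & H2 & H3).
  assert (E1 : Cmod (mid a b - a) = (Cmod (b - a) / 2)%R)
    by (rewrite <- (mid_id a) at 2; now rewrite mid_diff, Cmod_half).
  assert (E6 : Cmod (mid a c - a) = (Cmod (c - a) / 2)%R)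
    by (rewrite <- (mid_id a) at 2; now rewrite mid_diff, Cmod_half).
  rewrite Cmod_sym in E1. rewrite (Cmod_sym b a) in E1.
  rewrite Cmod_sym in E1.
  pose proof (Cmod_ge_0 (a - b)). pose proof (Cmod_ge_0 (c - a)).
  destruct k as [|[|[|k]]]; simpl; try lra.
  replace (a - a) with (RtoC 0) by ring. rewrite Cmod_0. lra.
Qed.

(** By the triangle inequality the four parts cannot all be smaller than a quarter of the whole, so
    [bisect] may fall back on the last one without a test. *)
Lemma bisect_subtriangle (q : triple) : inK q ->
  exists k, bisect q = subtriangle k q /\ (tri_mod q / 4 <= tri_mod (bisect q))%R.
Proof.
  intros Hq. unfold bisect.
  destruct (Rle_dec _ _) as [H0|H0]; [now exists 0%nat|].
  destruct (Rle_dec _ _) as [H1|H1]; [now exists 1%nat|].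
  destruct (Rle_dec _ _) as [H2|H2]; [now exists 2%nat|].
  exists 3%nat. split; auto.
  destruct q as [[a b] c]. destruct Hq as (Ha & Hb & Hc). unfold tri_mod in *; simpl in *.
  rewrite (tri_split a b c) in * by auto.
  set (t1 := tri f a _ _) in *. set (t2 := tri f _ b _) in *.
  set (t3 := tri f _ _ c) in *. set (t4 := tri f (mid a b) (mid b c) (mid a c)) in *.
  pose proof (Cmod_triangle (t1 + t2 + t3) t4).
  pose proof (Cmod_triangle (t1 + t2) t3).
  pose proof (Cmod_triangle t1 t2). lra.
Qed.

Fixpoint iter_bisect (n : nat) (q : triple) : triple :=
  match n with O => q | S m => bisect (iter_bisect m q) end.

Lemma iter_bisect_inv (q : triple) (D : R) (n : nat) : inK q -> sides q D ->
  inK (iter_bisect n q) /\ sides (iter_bisect n q) (D / 2 ^ n) /\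
  (tri_mod q / 4 ^ n <= tri_mod (iter_bisect n q))%R.
Proof.
  intros Hq HD. induction n as [|n (I1 & I2 & I3)].
  - simpl. repeat split; auto; try lra. now replace (D / 1)%R with D by field.
  - simpl. destruct (bisect_subtriangle _ I1) as [k [Ek Hk]].
    assert (P2 : (2 ^ n <> 0)%R) by (apply pow_nonzero; lra).
    assert (P4 : (4 ^ n <> 0)%R) by (apply pow_nonzero; lra).
    repeat split.
    + rewrite Ek. now apply subtriangle_inK.
    + replace (D / (2 * 2 ^ n))%R with (D / 2 ^ n / 2)%R by (field; auto).
      rewrite Ek. now apply subtriangle_sides.
    + replace (tri_mod q / (4 * 4 ^ n))%R with (tri_mod q / 4 ^ n / 4)%R by (field; auto). lra.
Qed.

(** The value is a difference of values of a primitive, so that the sum over a closed triangle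
    telescopes to 0. *)
Lemma seg_affine (A p l a b : C) :
  seg (fun z => A + l * (z - p)) a b =
  (A * b + l * (b - p) * (b - p) / 2) - (A * a + l * (a - p) * (a - p) / 2).
Proof.
  assert (H2 : RtoC 2 <> 0) by (intros E; apply RtoC_inj in E; lra).
  apply (seg_ftc (fun z => A * z + l * (z - p) * (z - p) / 2)).
  - intros t _. eapply cder_val.
    + apply cder_plus.
      * apply cder_mult; [apply cder_const|apply cder_id].
      * apply cder_mult; [|apply cder_const].
        apply cder_mult; [apply cder_mult; [apply cder_const|]|];
          (apply cder_minus; [apply cder_id|apply cder_const]).
    + simpl. field. auto.
  - intros t _. apply cder_cont. eexists.
    apply cder_plus; [apply cder_const|].
    apply cder_mult; [apply cder_const|].
    apply cder_minus; [apply cder_id|apply cder_const].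
Qed.

Theorem goursat (a b c : C) : K a -> K b -> K c -> tri f a b c = 0.
Proof.
  intros Ha Hb Hc. set (q := (a, b, c)).
  destruct (Req_dec (tri_mod q) 0) as [E|NE]; [now apply Cmod_eq_0|exfalso].
  assert (Hpos : (0 < tri_mod q)%R).
  { assert (0 <= tri_mod q)%R by apply Cmod_ge_0. lra. }
  (* The summand 1 keeps [D] positive for a degenerate triangle. *)
  set (D := (Cmod (a - b) + Cmod (b - c) + Cmod (c - a) + 1)%R).
  pose proof (Cmod_ge_0 (a - b)). pose proof (Cmod_ge_0 (b - c)). pose proof (Cmod_ge_0 (c - a)).
  assert (HD : (0 < D)%R) by (unfold D; lra).
  assert (Hs : sides q D) by (unfold D; simpl; repeat split; lra).
  assert (Hin : inK q) by (simpl; auto).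
  assert (P2 : forall n, (0 < 2 ^ n)%R) by (intros n; apply pow_lt; lra).
  destruct (geometric_steps_limit (fun n => fst (fst (iter_bisect n q))) D) as [p Hp].
  { intros n. destruct (iter_bisect_inv q D n Hin Hs) as (I1 & I2 & I3). simpl.
    destruct (bisect_subtriangle _ I1) as [k [-> _]]. now apply subtriangle_first. }
  assert (Kp : K p).
  { apply Kclosed. intros eps Heps. destruct (small_half_pow (4 * D)%R eps Heps ltac:(lra)) as [n Hn].
    exists (fst (fst (iter_bisect n q))). split.
    - destruct (iter_bisect_inv q D n Hin Hs) as (I1 & _).
      destruct (iter_bisect n q) as [[a1 b1] c1]. apply I1.
    - rewrite Cmod_sym. specialize (Hp n). simpl in Hp. lra. }
  destruct (Hf p Kp) as [l Hl]. rewrite cder_eps in Hl.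
  (* With h = D / 2^n the first vertex is within 4 h of [p], so the whole triangle is within 5 h.
     Each of the three sides then contributes at most eps * 5 h * h; the total 15 eps h^2 is half of
     the lower bound tri_mod q / 4^n. *)
  set (eps := (tri_mod q / (30 * D * D))%R).
  assert (Heps : (0 < eps)%R).
  { apply Rdiv_lt_0_compat; auto. repeat apply Rmult_lt_0_compat; lra. }
  destruct (Hl eps Heps) as [d [Hd Hnear]].
  (* Anything above 5 would do: the points within 5 h of [p] have to lie in the disc of radius
     [d]. *)
  destruct (small_half_pow (6 * D)%R d Hd ltac:(lra)) as [n Hn].
  destruct (iter_bisect_inv q D n Hin Hs) as (I1 & I2 & I3).
  specialize (Hp n). destruct (iter_bisect n q) as [[a1 b1] c1]. simpl in Hp, I1, I2, I3.
  destruct I1 as (Ka & Kb & Kc). destruct I2 as (S1 & S2 & S3).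
  set (h := (D / 2 ^ n)%R) in *.
  assert (Hh : (0 < h)%R) by (apply Rdiv_lt_0_compat; auto).
  replace (4 * D / 2 ^ n)%R with (4 * h)%R in Hp by (unfold h; field; specialize (P2 n); lra).
  replace (6 * D / 2 ^ n)%R with (6 * h)%R in Hn by (unfold h; field; specialize (P2 n); lra).
  set (g := fun z => f p + l * (z - p)).
  assert (Hcg : forall u v, cont_seg g u v).
  { intros u v t _. apply cder_cont. eexists. unfold g.
    apply cder_plus; [apply cder_const|].
    apply cder_mult; [apply cder_const|].
    apply cder_minus; [apply cder_id|apply cder_const]. }
  assert (Hbd : forall u v, K u -> K v -> (Cmod (u - p) <= 5 * h)%R ->
     (Cmod (v - p) <= 5 * h)%R -> (Cmod (u - v) <= h)%R ->
     (Cmod (seg f u v - seg g u v) <= eps * (5 * h) * h)%R).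
  { intros u v Hu Hv Hup Hvp Huv.
    eapply Rle_trans.
    - apply seg_minus_bound with (M := (eps * (5 * h))%R); [now apply convex_cont_seg|apply Hcg|].
      intros t Ht.
      assert (Hz : (Cmod (pt u v t - p) <= 5 * h)%R) by now apply Cmod_pt.
      specialize (Hnear (pt u v t) ltac:(lra)). unfold g.
      replace (f (pt u v t) - (f p + l * (pt u v t - p)))
        with (f (pt u v t) - f p - l * (pt u v t - p)) by ring.
      eapply Rle_trans; [exact Hnear|]. apply Rmult_le_compat_l; lra.
    - rewrite (Cmod_sym v u). apply Rmult_le_compat_l; auto. nra. }
  assert (Pa : (Cmod (a1 - p) <= 5 * h)%R) by (rewrite Cmod_sym; lra).
  assert (Pb : (Cmod (b1 - p) <= 5 * h)%R).
  { replace (b1 - p) with ((a1 - p) - (a1 - b1)) by ring.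
    unfold Cminus at 1. eapply Rle_trans; [apply Cmod_triangle|].
    rewrite Cmod_opp, (Cmod_sym a1 p). lra. }
  assert (Pc : (Cmod (c1 - p) <= 5 * h)%R).
  { replace (c1 - p) with ((c1 - a1) + (a1 - p)) by ring.
    eapply Rle_trans; [apply Cmod_triangle|]. rewrite (Cmod_sym a1 p). lra. }
  pose proof (Hbd a1 b1 Ka Kb Pa Pb S1) as B1.
  pose proof (Hbd b1 c1 Kb Kc Pb Pc S2) as B2.
  pose proof (Hbd c1 a1 Kc Ka Pc Pa S3) as B3.
  assert (Hg0 : tri g a1 b1 c1 = 0) by (unfold tri, g; rewrite !seg_affine; ring).
  assert (HT : (Cmod (tri f a1 b1 c1) <= 15 * eps * h * h)%R).
  { replace (tri f a1 b1 c1) with ((seg f a1 b1 - seg g a1 b1) + (seg f b1 c1 - seg g b1 c1)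
      + (seg f c1 a1 - seg g c1 a1)).
    - eapply Rle_trans; [apply Cmod_triangle|].
      pose proof (Cmod_triangle (seg f a1 b1 - seg g a1 b1) (seg f b1 c1 - seg g b1 c1)). lra.
    - transitivity (tri f a1 b1 c1 - tri g a1 b1 c1); [unfold tri; ring|rewrite Hg0; ring]. }
  assert (E4 : (4 ^ n = 2 ^ n * 2 ^ n)%R).
  { rewrite <- Rpow_mult_distr. f_equal; ring. }
  assert (Ehh : (15 * eps * h * h = tri_mod q / 4 ^ n / 2)%R).
  { unfold eps, h. rewrite E4. field. specialize (P2 n). lra. }
  assert (0 < tri_mod q / 4 ^ n)%R by (apply Rdiv_lt_0_compat; auto; apply pow_lt; lra).
  simpl in *. lra.
Qed.

End Goursat.

(** * Primitives with an exceptional point *)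

Lemma seg_const (k a b : C) : seg (fun _ => k) a b = k * (b - a).
Proof.
  rewrite (seg_ftc (fun z => k * z)).
  - ring.
  - intros t _. eapply cder_val; [apply cder_mult; [apply cder_const|apply cder_id]|].
    simpl. ring.
  - intros t _. apply cder_cont. eexists. apply cder_const.
Qed.

Lemma inv_pow2_bounds (n : nat) : (0 < / 2 ^ n <= 1)%R.
Proof.
  split; [apply Rinv_0_lt_compat, pow_lt; lra|].
  rewrite <- Rinv_1. apply Rinv_le_contravar; [lra|]. apply pow_R1_Rle. lra.
Qed.

Section Exceptional_point.

Variables (z0 : C) (R0 : R) (z : C) (g : C -> C).
Hypothesis Hz : (Cmod (z - z0) < R0)%R.
Hypothesis Hcont : forall w, (Cmod (w - z0) < R0)%R -> ccont g w.
Hypothesis Hder : forall w, (Cmod (w - z0) < R0)%R -> w <> z -> excder g w.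

Lemma ball_cont_seg (a b : C) :
  (Cmod (a - z0) < R0)%R -> (Cmod (b - z0) < R0)%R -> cont_seg g a b.
Proof. intros Ha Hb t Ht. apply Hcont. now apply Cmod_pt_lt. Qed.

(** The scalar product of w - z and u as vectors of the plane. Its positivity locates a point
    strictly on one side of a line through the exceptional point. *)
Definition height (u w : C) : R := fst ((w - z) * Cconj u).

Lemma height_pt (u a b : C) (t : R) :
  height u (pt a b t) = ((1 - t) * height u a + t * height u b)%R.
Proof. unfold height, pt. simpl. ring. Qed.

Lemma height_z (u : C) : height u z = 0%R.
Proof. unfold height. simpl. ring. Qed.

Lemma height_le (u a b : C) : (height u a - height u b <= Cmod u * Cmod (a - b))%R.
Proof.
  replace (height u a - height u b)%R with (fst ((a - b) * Cconj u))
    by (unfold height; simpl; ring).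
  eapply Rle_trans; [apply Rle_abs|]. eapply Rle_trans; [apply Rabs_re_le|].
  rewrite Cmod_mult, Cmod_conj. lra.
Qed.

(* The half plane [height u >= k > 0] avoids the exceptional point, so Goursat applies to the
   trapezoid cut off by the midpoints. *)
Lemma tri_halve (u w w' : C) :
  (Cmod (w - z0) < R0)%R -> (Cmod (w' - z0) < R0)%R ->
  (0 < height u w)%R -> (0 < height u w')%R ->
  tri g z w w' = tri g z (mid z w) (mid z w').
Proof.
  intros Hw Hw' Hh Hh'.
  set (k := Rmin (height u w / 2) (height u w' / 2)).
  (* A closed disc inside the open one that contains the triangle, because Goursat's lemma asks for
     a closed set. *)
  set (r := Rmax (Cmod (z - z0)) (Rmax (Cmod (w - z0)) (Cmod (w' - z0)))).
  set (K := fun p => (Cmod (p - z0) <= r)%R /\ (k <= height u p)%R).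
  assert (Hk : (0 < k)%R) by (apply Rmin_pos; lra).
  pose proof (Rmin_l (height u w / 2) (height u w' / 2)) as Hk1. fold k in Hk1.
  pose proof (Rmin_r (height u w / 2) (height u w' / 2)) as Hk2. fold k in Hk2.
  assert (Hr : (r < R0)%R) by (repeat apply Rmax_lub_lt; auto).
  assert (Hr1 : (Cmod (z - z0) <= r)%R) by apply Rmax_l.
  assert (Hr2 : (Cmod (w - z0) <= r)%R)
    by (eapply Rle_trans; [apply Rmax_l|apply Rmax_r]).
  assert (Hr3 : (Cmod (w' - z0) <= r)%R)
    by (eapply Rle_trans; [apply Rmax_r|apply Rmax_r]).
  assert (Kconv : convex K).
  { intros a b t [Ha1 Ha2] [Hb1 Hb2] Ht. split; [now apply Cmod_pt|].
    rewrite height_pt. nra. }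
  assert (Kclosed : limit_closed K).
  { intros p Hp. split.
    - apply le_epsilon. intros e He. destruct (Hp e He) as [q [[Hq _] Hqp]].
      replace (p - z0) with ((q - z0) - (q - p)) by ring.
      unfold Cminus at 1. eapply Rle_trans; [apply Cmod_triangle|].
      rewrite Cmod_opp. lra.
    - apply le_epsilon. intros e He.
      pose proof (Cmod_ge_0 u).
      destruct (Hp (e / (Cmod u + 1))%R) as [q [[_ Hq] Hqp]];
        [apply Rdiv_lt_0_compat; lra|].
      pose proof (height_le u q p).
      assert (Cmod u * Cmod (q - p) <= e)%R.
      { apply Rle_trans with ((Cmod u + 1) * (e / (Cmod u + 1)))%R.
        - apply Rmult_le_compat; try lra. apply Cmod_ge_0.
        - apply Req_le. field. lra. }
      lra. }
  assert (Kder : forall p, K p -> excder g p).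
  { intros p [Hp1 Hp2]. apply Hder; [lra|]. intros ->. rewrite height_z in Hp2. lra. }
  assert (Hm : height u (mid z w) = (height u w / 2)%R)
    by (unfold mid; rewrite height_pt, height_z; lra).
  assert (Hm' : height u (mid z w') = (height u w' / 2)%R)
    by (unfold mid; rewrite height_pt, height_z; lra).
  assert (Kw : K w) by (split; auto; lra).
  assert (Kw' : K w') by (split; auto; lra).
  assert (Km : K (mid z w)) by (split; [apply Cmod_pt; auto; lra|lra]).
  assert (Km' : K (mid z w')) by (split; [apply Cmod_pt; auto; lra|lra]).
  pose proof (goursat K g Kconv Kclosed Kder _ _ _ Km Kw Kw') as G1.
  pose proof (goursat K g Kconv Kclosed Kder _ _ _ Km Kw' Km') as G2.
  assert (B1 : (Cmod (mid z w - z0) < R0)%R) by (destruct Km; lra).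
  assert (B2 : (Cmod (mid z w' - z0) < R0)%R) by (destruct Km'; lra).
  unfold tri in *.
  rewrite (seg_mid g z w), (seg_mid g w' z) by now apply ball_cont_seg.
  rewrite (mid_comm w' z).
  rewrite (seg_swap g (mid z w) w') in G1 by now apply ball_cont_seg.
  rewrite (seg_swap g (mid z w) (mid z w')) in G2 by now apply ball_cont_seg.
  match type of G1 with ?A = _ => match type of G2 with ?B = _ =>
    match goal with |- _ = ?E => transitivity (E + A + B); [ring|rewrite G1, G2; ring] end end end.
Qed.

Lemma tri_halve_pow (u w w' : C) (n : nat) :
  (Cmod (w - z0) < R0)%R -> (Cmod (w' - z0) < R0)%R ->
  (0 < height u w)%R -> (0 < height u w')%R ->
  tri g z w w' = tri g z (pt z w (/ 2 ^ n)) (pt z w' (/ 2 ^ n)).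
Proof.
  intros Hw Hw' Hh Hh'. induction n as [|n IH].
  - simpl. rewrite Rinv_1. unfold pt. f_equal; ring.
  - rewrite IH.
    pose proof (inv_pow2_bounds n) as P.
    assert (E : forall v, pt z v (/ 2 ^ S n) = mid z (pt z v (/ 2 ^ n))).
    { intros v. unfold mid, pt. simpl. rewrite Rinv_mult, RtoC_mult.
      replace (1 / 2)%R with (/ 2)%R by field. ring. }
    rewrite !E. apply (tri_halve u).
    + apply Cmod_pt_lt; auto; lra.
    + apply Cmod_pt_lt; auto; lra.
    + rewrite height_pt, height_z. nra.
    + rewrite height_pt, height_z. nra.
Qed.

(** Halving towards the vertex [z] leaves the integral unchanged, while it tends to 0 with the
    perimeter because [g] is continuous at [z]. *)
Lemma tri_exceptional (u w w' : C) :
  (Cmod (w - z0) < R0)%R -> (Cmod (w' - z0) < R0)%R ->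
  (0 < height u w)%R -> (0 < height u w')%R -> tri g z w w' = 0.
Proof.
  intros Hw Hw' Hh Hh'. apply Cmod_eq_0. apply Rle_antisym; [|apply Cmod_ge_0].
  apply le_epsilon. intros e He. rewrite Rplus_0_l.
  destruct (Hcont z Hz 1%R Rlt_0_1) as [d [Hd Hnear]].
  set (L := (Cmod (w - z) + Cmod (w' - z) + 1)%R).
  pose proof (Cmod_ge_0 (w - z)). pose proof (Cmod_ge_0 (w' - z)).
  assert (HL : (0 < L)%R) by (unfold L; lra).
  (* The small triangle has perimeter at most 4 L / 2^n, as 1 + 2 + 1 = 4, and on it [g] differs
     from [g z] by less than 1. *)
  destruct (small_half_pow L (Rmin d (e / 4))) as [n Hn]; auto.
  { apply Rmin_pos; lra. }
  pose proof (Rmin_l d (e / 4)). pose proof (Rmin_r d (e / 4)).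
  rewrite (tri_halve_pow u w w' n) by auto.
  pose proof (inv_pow2_bounds n) as Pn.
  assert (Hclose : forall v, (Cmod (v - z) <= L)%R -> (Cmod (pt z v (/ 2 ^ n) - z) <= L / 2 ^ n)%R).
  { intros v Hv. replace (pt z v (/ 2 ^ n) - z) with (RtoC (/ 2 ^ n) * (v - z))
      by (unfold pt; ring).
    rewrite Cmod_mult, Cmod_R, Rabs_pos_eq by lra. unfold Rdiv. rewrite Rmult_comm.
    apply Rmult_le_compat_r; lra. }
  set (a := pt z w (/ 2 ^ n)). set (b := pt z w' (/ 2 ^ n)).
  assert (Ha : (Cmod (a - z) <= L / 2 ^ n)%R) by (apply Hclose; unfold L; lra).
  assert (Hb : (Cmod (b - z) <= L / 2 ^ n)%R) by (apply Hclose; unfold L; lra).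
  assert (Ha0 : (Cmod (a - z0) < R0)%R) by (apply Cmod_pt_lt; auto; lra).
  assert (Hb0 : (Cmod (b - z0) < R0)%R) by (apply Cmod_pt_lt; auto; lra).
  assert (Hzz : (Cmod (z - z) <= L / 2 ^ n)%R).
  { replace (z - z) with (RtoC 0) by ring. rewrite Cmod_0. apply Rlt_le, Rdiv_lt_0_compat; auto.
    apply pow_lt; lra. }
  assert (Hbd : forall p q, (Cmod (p - z0) < R0)%R -> (Cmod (q - z0) < R0)%R ->
    (Cmod (p - z) <= L / 2 ^ n)%R -> (Cmod (q - z) <= L / 2 ^ n)%R ->
    (Cmod (seg g p q - g z * (q - p)) <= Cmod (q - p))%R).
  { intros p q Hp Hq Hpz Hqz. rewrite <- seg_const.
    rewrite <- (Rmult_1_l (Cmod (q - p))). apply seg_minus_bound.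
    - now apply ball_cont_seg.
    - intros t _. apply cder_cont. eexists. apply cder_const.
    - intros t Ht. apply Rlt_le, Hnear. apply Rle_lt_trans with (L / 2 ^ n)%R; [|lra].
      now apply Cmod_pt. }
  assert (Hab : (Cmod (b - a) <= 2 * (L / 2 ^ n))%R).
  { replace (b - a) with ((b - z) + - (a - z)) by ring.
    eapply Rle_trans; [apply Cmod_triangle|]. rewrite Cmod_opp. lra. }
  pose proof (Hbd z a Hz Ha0 Hzz Ha) as B1.
  pose proof (Hbd a b Ha0 Hb0 Ha Hb) as B2.
  pose proof (Hbd b z Hb0 Hz Hb Hzz) as B3. rewrite (Cmod_sym z b) in B3.
  replace (tri g z a b) with ((seg g z a - g z * (a - z)) + (seg g a b - g z * (b - a))
     + (seg g b z - g z * (z - b))) by (unfold tri; ring).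
  eapply Rle_trans; [apply Cmod_triangle|].
  pose proof (Cmod_triangle (seg g z a - g z * (a - z)) (seg g a b - g z * (b - a))). lra.
Qed.

(** Integration starts at the exceptional point itself, so every triangle that occurs has it as a
    vertex, which is the case treated by [tri_exceptional]. *)
Lemma primitive_exceptional :
  exists G : C -> C, forall w, (Cmod (w - z0) < R0)%R -> cder G w (g w).
Proof.
  exists (seg g z). intros w Hw. apply cder_eps. intros eps Heps.
  assert (Hinc : near w (fun w' => seg g z w' - seg g z w = seg g w w')).
  { destruct (Ceq_dec w z) as [->|Hne].
    - exists 1%R. split; [lra|]. intros w' _.
      assert (E0 : seg g z z = 0) by (unfold seg; ring). rewrite E0. ring.
    (* In this direction [w] has height Cmod u ^ 2, so all points closer to [w] than Cmod u have
       positive height too. *)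
    - set (u := w - z).
      assert (Hu : (0 < Cmod u)%R).
      { now apply Cmod_gt_0, Cminus_neq_0. }
      assert (Hhw : height u w = (Cmod u * Cmod u)%R).
      { unfold height. fold u. rewrite <- Cmod2_conj. simpl. ring. }
      destruct (near_ball z0 w R0 Hw) as [d [Hd Hb]].
      exists (Rmin d (Cmod u)). split; [now apply Rmin_pos|]. intros w' Hw'.
      pose proof (Rmin_l d (Cmod u)). pose proof (Rmin_r d (Cmod u)).
      assert (Hb' : (Cmod (w' - z0) < R0)%R) by (apply Hb; lra).
      assert (Hh' : (0 < height u w')%R).
      { pose proof (height_le u w w') as Hl. rewrite (Cmod_sym w w') in Hl.
        assert (Cmod u * Cmod (w' - w) < Cmod u * Cmod u)%R
          by (apply Rmult_lt_compat_l; lra). lra. }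
      pose proof (tri_exceptional u w w' Hw Hb' ltac:(rewrite Hhw; nra) Hh') as HT.
      unfold tri in HT. rewrite (seg_swap g z w') in HT by now apply ball_cont_seg.
      transitivity (seg g w w' - (seg g z w + seg g w w' + - seg g z w'));
        [ring|rewrite HT; ring]. }
  destruct (Hcont w Hw eps Heps) as [d [Hd Hn]].
  assert (Hball := near_ball z0 w R0 Hw).
  assert (Hd' : near w (fun w' => (Cmod (w' - w) < d)%R)) by (exists d; auto).
  generalize (near_and _ _ _ Hinc (near_and _ _ _ Hball Hd')).
  apply near_imp. intros w' [E [Hb Hdd]]. rewrite E, <- (seg_const (g w)).
  apply seg_minus_bound.
  - now apply ball_cont_seg.
  - intros t _. apply cder_cont. eexists. apply cder_const.
  - intros t Ht. apply Rlt_le, Hn. apply Cmod_pt_lt; auto.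
    replace (w - w) with (RtoC 0) by ring. now rewrite Cmod_0.
Qed.

End Exceptional_point.

(** * Parametrized circles *)

Definition circ (z0 : C) (r : R) (th : R) : C := z0 + (r * cos th, r * sin th)%R.
Definition circ' (r : R) (th : R) : C := (- (r * sin th), r * cos th)%R.

Lemma pder_pair (f1 f2 : R -> R) (t l1 l2 : R) :
  is_derive f1 t l1 -> is_derive f2 t l2 -> pder (fun s => (f1 s, f2 s)) t (l1, l2).
Proof.
  intros [_ H1] [_ H2]. apply pder_eps. intros eps Heps.
  assert (He2 : (0 < eps / 2)%R) by lra.
  destruct (H1 t (fun P HP => HP) (mkposreal _ He2)) as [d1 Hd1].
  destruct (H2 t (fun P HP => HP) (mkposreal _ He2)) as [d2 Hd2].
  exists (Rmin d1 d2). split; [apply Rmin_pos; apply cond_pos|]. intros s Hs.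
  pose proof (Rmin_l d1 d2). pose proof (Rmin_r d1 d2).
  assert (Hs1 : (Rabs (s - t) < d1)%R) by lra. specialize (Hd1 s Hs1).
  assert (Hs2 : (Rabs (s - t) < d2)%R) by lra. specialize (Hd2 s Hs2).
  change (Rabs (f1 s - f1 t - (s - t) * l1) <= eps / 2 * Rabs (s - t))%R in Hd1.
  change (Rabs (f2 s - f2 t - (s - t) * l2) <= eps / 2 * Rabs (s - t))%R in Hd2.
  eapply Rle_trans; [apply Cmod_le_abs|]. simpl.
  replace (f1 s + - f1 t + - ((s - t) * l1 - 0 * l2))%R with (f1 s - f1 t - (s - t) * l1)%R by ring.
  replace (f2 s + - f2 t + - ((s - t) * l2 + 0 * l1))%R with (f2 s - f2 t - (s - t) * l2)%R by ring.
  lra.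
Qed.

Lemma circ_der (z0 : C) (r th : R) : pder (circ z0 r) th (circ' r th).
Proof.
  apply (pder_pair (fun s => fst z0 + r * cos s)%R (fun s => snd z0 + r * sin s)%R).
  - auto_derive; auto. ring.
  - auto_derive; auto. ring.
Qed.

Lemma circ_cont (z0 : C) (r th : R) : pcont (circ z0 r) th.
Proof. eapply pder_cont. apply circ_der. Qed.

Lemma circ'_cont (r th : R) : pcont (circ' r) th.
Proof.
  eapply pder_cont.
  apply (pder_pair (fun s => - (r * sin s))%R (fun s => r * cos s)%R); auto_derive; auto.
Qed.

Lemma Cmod_circ_center (z0 : C) (r th : R) : (0 <= r)%R -> Cmod (circ z0 r th - z0) = r.
Proof.
  intros Hr. replace (circ z0 r th - z0) with ((r * cos th, r * sin th)%R : C)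
    by (apply injective_projections; simpl; ring).
  unfold Cmod. simpl. pose proof (sin2_cos2 th) as H. unfold Rsqr in H.
  replace (r * cos th * (r * cos th * 1) + r * sin th * (r * sin th * 1))%R
    with (r * r * (sin th * sin th + cos th * cos th))%R by ring.
  rewrite H, Rmult_1_r. now apply sqrt_square.
Qed.

Lemma Cmod_circ' (r th : R) : (0 <= r)%R -> Cmod (circ' r th) = r.
Proof.
  intros Hr. unfold Cmod. simpl. pose proof (sin2_cos2 th) as H. unfold Rsqr in H.
  replace (- (r * sin th) * (- (r * sin th) * 1) + r * cos th * (r * cos th * 1))%R
    with (r * r * (sin th * sin th + cos th * cos th))%R by ring.
  rewrite H, Rmult_1_r. now apply sqrt_square.
Qed.

Lemma circ_dist (z0 z : C) (r th : R) : (0 <= r)%R ->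
  (r - Cmod (z - z0) <= Cmod (circ z0 r th - z))%R.
Proof.
  intros Hr. rewrite <- (Cmod_circ_center z0 r th Hr) at 1.
  replace (circ z0 r th - z) with ((circ z0 r th - z0) - (z - z0)) by ring.
  apply Cmod_reverse.
Qed.

Lemma circ_neq (z0 z : C) (r th : R) : (Cmod (z - z0) < r)%R -> circ z0 r th - z <> 0.
Proof.
  intros Hz E. pose proof (Cmod_ge_0 (z - z0)).
  pose proof (circ_dist z0 z r th ltac:(lra)) as H1. rewrite E, Cmod_0 in H1. lra.
Qed.

(** * Cauchy's formula and the identity theorem *)

Lemma two_PI_pos : (0 <= 2 * PI)%R.
Proof. pose proof PI_RGT_0. lra. Qed.

Lemma pcont_Cmod (f : R -> C) (t : R) : pcont f t -> continuous (fun s => Cmod (f s)) t.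
Proof.
  intros H. apply continuous_ext with (fun s => @norm R_AbsRing C_R_NormedModule (f s)).
  - intros s. exact (norm_Cmod (f s)).
  - apply (continuous_comp f (@norm R_AbsRing C_R_NormedModule)); auto.
    apply (@filterlim_norm R_AbsRing C_R_NormedModule).
Qed.

Lemma pcont_inv (f : R -> C) (t : R) : f t <> 0 -> pcont f t -> pcont (fun s => / f s) t.
Proof.
  intros Hn H. apply pcont_comp; auto. apply cder_cont. eexists. now apply cder_inv.
Qed.

Lemma pcont_minus (f g : R -> C) (t : R) :
  pcont f t -> pcont g t -> pcont (fun s => f s - g s) t.
Proof. apply (@continuous_minus R_UniformSpace R_AbsRing C_R_NormedModule). Qed.

(** Differentiation under the integral sign. A quadratic remainder, uniform in the parameter, can be
    written down explicitly for the Cauchy kernels and replaces any theorem on exchanging limits. *)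
Lemma cder_param_int (phi : R -> C) (k : C -> R -> C) (k' : R -> C) (a b : R) (z : C) (B : R) :
  (a <= b)%R -> cint_on phi a b -> cint_on k' a b ->
  near z (fun w => cint_on (k w) a b) ->
  near z (fun w => forall t, (a <= t <= b)%R ->
    (Cmod (k w t - k z t - k' t * (w - z)) <= B * (Cmod (w - z) * Cmod (w - z)))%R) ->
  cder (fun w => CRint (fun t => phi t * k w t) a b) z (CRint (fun t => phi t * k' t) a b).
Proof.
  intros Hab Hphi Hk' Hk Hest. apply cder_eps. intros eps Heps.
  set (S := RInt (fun t => Cmod (phi t)) a b).
  assert (HS : is_RInt (fun t => Cmod (phi t)) a b S).
  { apply (@RInt_correct R_CompleteNormedModule).
    apply (@ex_RInt_continuous R_CompleteNormedModule).
    rewrite Rmin_left, Rmax_right by lra. intros t Ht. now apply pcont_Cmod, Hphi. }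
  assert (HS0 : (0 <= S)%R).
  { apply RInt_ge_0; auto; [now exists S|]. intros t _. apply Cmod_ge_0. }
  set (M := (Rabs B * S + 1)%R).
  assert (HM : (0 < M)%R) by (pose proof (Rabs_pos B); unfold M; nra).
  assert (Hsm : near z (fun w => (Cmod (w - z) < eps / M)%R)).
  { exists (eps / M)%R. split; auto. now apply Rdiv_lt_0_compat. }
  pose proof (near_at _ _ Hk) as Hkz.
  generalize (near_and _ _ _ Hk (near_and _ _ _ Hest Hsm)). apply near_imp.
  intros w [Hkw [Hw Hlt]].
  assert (C1 : cint_on (fun t => phi t * k w t) a b)
    by (intros t Ht; apply pcont_mult; auto).
  assert (C2 : cint_on (fun t => phi t * k z t) a b)
    by (intros t Ht; apply pcont_mult; auto).
  assert (C3 : cint_on (fun t => phi t * k' t) a b)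
    by (intros t Ht; apply pcont_mult; auto).
  assert (C4 : cint_on (fun t => (w - z) * (phi t * k' t)) a b)
    by (intros t Ht; apply pcont_mult; [apply pcont_const|auto]).
  rewrite (Cmult_comm (CRint _ _ _)), <- cint_mult, <- !cint_minus;
    auto; [|intros t Ht; apply pcont_minus; auto].
  apply Rle_trans with (scal (Rabs B * (Cmod (w - z) * Cmod (w - z)))%R S).
  - apply cint_bound with (h := fun t => scal (Rabs B * (Cmod (w - z) * Cmod (w - z)))%R (Cmod (phi t)));
      auto.
    + intros t Ht. apply pcont_minus; [apply pcont_minus|]; auto.
    + intros t Ht.
      replace (phi t * k w t - phi t * k z t - (w - z) * (phi t * k' t))
        with (phi t * (k w t - k z t - k' t * (w - z))) by ring.
      rewrite Cmod_mult. unfold scal; simpl; unfold mult; simpl.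
      rewrite Rmult_comm. apply Rmult_le_compat_r; [apply Cmod_ge_0|].
      eapply Rle_trans; [now apply Hw|]. apply Rmult_le_compat_r; [|apply Rle_abs].
      pose proof (Cmod_ge_0 (w - z)). nra.
    + now apply (@is_RInt_scal R_NormedModule).
  - unfold scal; simpl; unfold mult; simpl.
    pose proof (Cmod_ge_0 (w - z)) as H0.
    assert (Cmod (w - z) * M <= eps)%R.
    { apply Rle_trans with (eps / M * M)%R; [apply Rmult_le_compat_r; lra|].
      apply Req_le. field. lra. }
    replace (Rabs B * (Cmod (w - z) * Cmod (w - z)) * S)%R
      with ((Cmod (w - z) * (Rabs B * S)) * Cmod (w - z))%R by ring.
    apply Rmult_le_compat_r; auto. unfold M in *. nra.
Qed.

(** * Cauchy transforms on a circle and their derivatives *)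

Section Circle_integrals.

Variables (z0 : C) (r : R) (phi : R -> C).
Hypothesis Hphi : cint_on phi 0 (2 * PI).

(** The density [phi] is meant to include the factor [circ'] of a path integral. [ci2] and [ci3] are
    the first and second derivative of [ci1]; two are needed to differentiate the derivative of a
    holomorphic function. *)
Definition ci1 (z : C) : C := CRint (fun t => phi t * / (circ z0 r t - z)) 0 (2 * PI).
Definition ci2 (z : C) : C :=
  CRint (fun t => phi t * (/ (circ z0 r t - z) * / (circ z0 r t - z))) 0 (2 * PI).
Definition ci3 (z : C) : C :=
  CRint (fun t => phi t * (2 * (/ (circ z0 r t - z) * / (circ z0 r t - z)
                            * / (circ z0 r t - z)))) 0 (2 * PI).

Lemma kernel_cont (z : C) (t : R) : (Cmod (z - z0) < r)%R ->
  pcont (fun s => / (circ z0 r s - z)) t.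
Proof.
  intros Hz. apply pcont_inv; [now apply circ_neq|].
  apply pcont_minus; [apply circ_cont|apply pcont_const].
Qed.

Lemma kernel_bound (z : C) (t d : R) : (0 < d)%R -> (Cmod (z - z0) <= r - d)%R ->
  (Cmod (/ (circ z0 r t - z)) <= / d)%R.
Proof.
  intros Hd Hz. pose proof (Cmod_ge_0 (z - z0)).
  assert (Hn : circ z0 r t - z <> 0) by (apply circ_neq; lra).
  rewrite Cmod_inv by auto. apply Rinv_le_contravar; auto.
  pose proof (circ_dist z0 z r t ltac:(lra)). lra.
Qed.

Lemma ci1_der (z : C) : (Cmod (z - z0) < r)%R -> cder ci1 z (ci2 z).
Proof.
  intros Hz. set (d := ((r - Cmod (z - z0)) / 2)%R). assert (Hd : (0 < d)%R) by (unfold d; lra).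
  assert (Hb : near z (fun w => (Cmod (w - z0) < r - d)%R)) by (apply near_ball; unfold d; lra).
  apply (cder_param_int phi (fun w t => / (circ z0 r t - w))
    (fun t => / (circ z0 r t - z) * / (circ z0 r t - z)) 0 (2 * PI) z (/ d * / d * / d)).
  - apply two_PI_pos.
  - exact Hphi.
  - intros t _. apply pcont_mult; now apply kernel_cont.
  - revert Hb. apply near_imp. intros w Hw t _. apply kernel_cont. lra.
  - revert Hb. apply near_imp. intros w Hw t _.
    assert (N1 : circ z0 r t - z <> 0) by (apply circ_neq; lra).
    assert (N2 : circ z0 r t - w <> 0) by (apply circ_neq; lra).
    replace (/ (circ z0 r t - w) - / (circ z0 r t - z) -
             / (circ z0 r t - z) * / (circ z0 r t - z) * (w - z))
      with (/ (circ z0 r t - z) * / (circ z0 r t - z) * / (circ z0 r t - w) *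
            ((w - z) * (w - z))) by (field; auto).
    rewrite !Cmod_mult.
    pose proof (kernel_bound z t d Hd ltac:(unfold d; lra)) as B1.
    pose proof (kernel_bound w t d Hd ltac:(lra)) as B2.
    apply Rmult_le_compat_r; [pose proof (Cmod_ge_0 (w - z)); nra|].
    pose proof (Cmod_ge_0 (/ (circ z0 r t - z))). pose proof (Cmod_ge_0 (/ (circ z0 r t - w))).
    apply Rmult_le_compat; auto; [nra|]. apply Rmult_le_compat; auto.
Qed.

Lemma ci2_der (z : C) : (Cmod (z - z0) < r)%R -> cder ci2 z (ci3 z).
Proof.
  intros Hz. set (d := ((r - Cmod (z - z0)) / 2)%R). assert (Hd : (0 < d)%R) by (unfold d; lra).
  assert (Hb : near z (fun w => (Cmod (w - z0) < r - d)%R)) by (apply near_ball; unfold d; lra).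
  apply (cder_param_int phi (fun w t => / (circ z0 r t - w) * / (circ z0 r t - w))
    (fun t => 2 * (/ (circ z0 r t - z) * / (circ z0 r t - z) * / (circ z0 r t - z)))
    0 (2 * PI) z (3 * (/ d * / d * / d * / d))).
  - apply two_PI_pos.
  - exact Hphi.
  - intros t _. apply pcont_mult; [apply pcont_const|].
    apply pcont_mult; [apply pcont_mult|]; now apply kernel_cont.
  - revert Hb. apply near_imp. intros w Hw t _. apply pcont_mult; apply kernel_cont; lra.
  - revert Hb. apply near_imp. intros w Hw t _.
    assert (N1 : circ z0 r t - z <> 0) by (apply circ_neq; lra).
    assert (N2 : circ z0 r t - w <> 0) by (apply circ_neq; lra).
    set (u := / (circ z0 r t - z)). set (v := / (circ z0 r t - w)).
    replace (v * v - u * u - 2 * (u * u * u) * (w - z))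
      with ((u * u * v * v + 2 * (u * u * u * v)) * ((w - z) * (w - z)))
      by (unfold u, v; field; auto).
    rewrite !Cmod_mult.
    pose proof (kernel_bound z t d Hd ltac:(unfold d; lra)) as B1.
    pose proof (kernel_bound w t d Hd ltac:(lra)) as B2. fold u in B1. fold v in B2.
    apply Rmult_le_compat_r; [pose proof (Cmod_ge_0 (w - z)); nra|].
    eapply Rle_trans; [apply Cmod_triangle|]. rewrite !Cmod_mult, Cmod_R, Rabs_pos_eq by lra.
    pose proof (Cmod_ge_0 u). pose proof (Cmod_ge_0 v).
    assert (0 < / d)%R by now apply Rinv_0_lt_compat.
    assert (U2 : (Cmod u * Cmod u <= / d * / d)%R) by (apply Rmult_le_compat; auto).
    assert (U2' : (0 <= Cmod u * Cmod u)%R) by nra.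
    assert (U3 : (Cmod u * Cmod u * Cmod u <= / d * / d * / d)%R) by (apply Rmult_le_compat; auto).
    assert (V3 : (Cmod u * Cmod u * Cmod v <= / d * / d * / d)%R) by (apply Rmult_le_compat; auto).
    assert (U4 : (Cmod u * Cmod u * Cmod u * Cmod v <= / d * / d * / d * / d)%R)
      by (apply Rmult_le_compat; auto; apply Rmult_le_pos; auto).
    assert (V4 : (Cmod u * Cmod u * Cmod v * Cmod v <= / d * / d * / d * / d)%R)
      by (apply Rmult_le_compat; auto; apply Rmult_le_pos; auto).
    lra.
Qed.

End Circle_integrals.

(** The argument of circ - z increases strictly: with d = circ - z the imaginary part of the
    integrand is r (r + cos t * e1 + sin t * e2) / |d|^2, where (e1, e2) = z0 - z is shorter than r.
    So the imaginary part of the integral is positive, and the value 2 pi i is never computed. *)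
Lemma winding_neq0 (z0 z : C) (r : R) : (Cmod (z - z0) < r)%R -> ci1 z0 r (circ' r) z <> 0.
Proof.
  intros Hz E.
  assert (Hr : (0 < r)%R) by (pose proof (Cmod_ge_0 (z - z0)); lra).
  set (F := fun t => circ' r t * / (circ z0 r t - z)).
  assert (Hc : cint_on F 0 (2 * PI)).
  { intros t _. apply pcont_mult; [apply circ'_cont|now apply kernel_cont]. }
  pose proof (@RInt_correct C_R_CompleteNormedModule F 0 (2 * PI)
    (cint_ex F _ _ two_PI_pos Hc)) as HI.
  change (CRint F 0 (2 * PI)) with (ci1 z0 r (circ' r) z) in HI. rewrite E in HI.
  pose proof (is_RInt_fct_extend_snd F 0 (2 * PI) _ HI) as Hs.
  apply (@is_RInt_unique R_CompleteNormedModule) in Hs.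
  assert (Hpos : (0 < RInt (fun t => snd (F t)) 0 (2 * PI))%R).
  { apply RInt_gt_0.
    - pose proof PI_RGT_0. lra.
    - intros t _. unfold F.
      pose proof (circ_neq z0 z r t Hz) as Hn.
      set (e1 := (fst z0 - fst z)%R). set (e2 := (snd z0 - snd z)%R).
      assert (He : (e1 * e1 + e2 * e2 < r * r)%R).
      { assert (Hm : (Cmod (z - z0) * Cmod (z - z0) < r * r)%R)
          by (pose proof (Cmod_ge_0 (z - z0)); nra).
        unfold Cmod in Hm. rewrite sqrt_sqrt in Hm.
        - simpl in Hm. unfold e1, e2. lra.
        - apply Rplus_le_le_0_compat; apply pow2_ge_0. }
      pose proof (sin2_cos2 t) as Hsc. unfold Rsqr in Hsc.
      set (d := circ z0 r t - z) in *.
      assert (Hd1 : fst d = (r * cos t + e1)%R) by (unfold d, e1; simpl; ring).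
      assert (Hd2 : snd d = (r * sin t + e2)%R) by (unfold d, e2; simpl; ring).
      clearbody d.
      assert (Hdd : (0 < fst d * fst d + snd d * snd d)%R).
      { assert (fst d <> 0%R \/ snd d <> 0%R).
        { destruct (Req_dec (fst d) 0); auto. right. intros Q. apply Hn.
          now apply injective_projections. }
        destruct H as [H|H]; nra. }
      unfold circ', Cinv, Cmult. simpl.
      replace (- (r * sin t) * (- snd d / (fst d * (fst d * 1) + snd d * (snd d * 1))) +
        r * cos t * (fst d / (fst d * (fst d * 1) + snd d * (snd d * 1))))%R
        with (r * (sin t * snd d + cos t * fst d) / (fst d * fst d + snd d * snd d))%R
        by (field; lra).
      apply Rdiv_lt_0_compat; auto. apply Rmult_lt_0_compat; auto. rewrite Hd1, Hd2.
      replace (sin t * (r * sin t + e2) + cos t * (r * cos t + e1))%R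
        with (r * (sin t * sin t + cos t * cos t) + (sin t * e2 + cos t * e1))%R by ring.
      rewrite Hsc.
      assert (((sin t * e2 + cos t * e1) * (sin t * e2 + cos t * e1) < r * r)%R).
      (* Lagrange's identity, which gives the Cauchy-Schwarz inequality for (cos t, sin t) and (e1,
         e2). *)
      { assert (Hl : ((sin t * e2 + cos t * e1) * (sin t * e2 + cos t * e1) +
          (sin t * e1 - cos t * e2) * (sin t * e1 - cos t * e2) =
          (sin t * sin t + cos t * cos t) * (e1 * e1 + e2 * e2))%R) by ring.
        rewrite Hsc in Hl.
        pose proof (Rle_0_sqr (sin t * e1 - cos t * e2)) as Hq. unfold Rsqr in Hq. lra. }
      nra.
    - intros t Ht. apply (continuous_comp F snd); [now apply Hc|apply continuous_snd]. }
  assert (Hs' : RInt (fun t => snd (F t)) 0 (2 * PI) = 0%R) by exact Hs.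
  lra.
Qed.

(** The difference quotient of [f] at [z], completed by the derivative, is continuous on the disc
    and differentiable off [z]. It therefore has a primitive, and its integral over the circle is 0.
    The winding integral stays as a factor. *)
Theorem cauchy_formula (f : C -> C) (z0 z : C) (R0 r : R) :
  (forall w, (Cmod (w - z0) < R0)%R -> excder f w) -> (r < R0)%R ->
  (Cmod (z - z0) < r)%R ->
  f z * ci1 z0 r (circ' r) z = ci1 z0 r (fun t => circ' r t * f (circ z0 r t)) z.
Proof.
  intros Hf HrR Hz.
  assert (Hr : (0 < r)%R) by (pose proof (Cmod_ge_0 (z - z0)); lra).
  destruct (Hf z ltac:(lra)) as [l Hl].
  set (g := fun w => if Ceq_dec w z then l else (f w - f z) / (w - z)).
  assert (Hgd : forall w, (Cmod (w - z0) < R0)%R -> w <> z -> excder g w).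
  { intros w Hw Hne. destruct (Hf w Hw) as [m Hm].
    assert (Hwz : w - z <> 0) by now apply Cminus_neq_0.
    eexists. apply cder_ext_near with (fun w => (f w - f z) / (w - z)).
    - assert (near w (fun v => v - z <> 0)).
      { apply ccont_neq0; auto. apply cder_cont. eexists.
        apply cder_minus; [apply cder_id|apply cder_const]. }
      revert H. apply near_imp. intros v Hv. unfold g. destruct (Ceq_dec v z) as [->|]; auto.
      exfalso. apply Hv. ring.
    - apply cder_div; auto.
      + apply cder_minus; [exact Hm|apply cder_const].
      + apply cder_minus; [apply cder_id|apply cder_const]. }
  assert (Hgc : forall w, (Cmod (w - z0) < R0)%R -> ccont g w).
  { intros w Hw. destruct (Ceq_dec w z) as [->|Hne]; [|now apply cder_cont, Hgd].
    intros eps Heps. rewrite cder_eps in Hl.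
    generalize (Hl (eps / 2)%R ltac:(lra)). apply near_imp. intros w Hw'. unfold g.
    destruct (Ceq_dec z z) as [_|N]; [|now elim N].
    destruct (Ceq_dec w z) as [E|N].
    - replace (l - l) with (RtoC 0) by ring. now rewrite Cmod_0.
    - assert (Hwz : w - z <> 0) by now apply Cminus_neq_0.
      assert (Hp : (0 < Cmod (w - z))%R) by now apply Cmod_gt_0.
      replace ((f w - f z) / (w - z) - l) with ((f w - f z - l * (w - z)) / (w - z))
        by (field; auto).
      rewrite Cmod_div by auto. apply Rle_lt_trans with (eps / 2)%R; [|lra].
      apply Rmult_le_reg_r with (1 := Hp). unfold Rdiv at 1.
      rewrite Rmult_assoc, Rinv_l, Rmult_1_r by lra. exact Hw'. }
  destruct (primitive_exceptional z0 R0 z g ltac:(lra) Hgc Hgd) as [G HG].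
  assert (Hin : forall t, (Cmod (circ z0 r t - z0) < R0)%R)
    by (intros t; rewrite Cmod_circ_center; lra).
  assert (C0 : cint_on (fun t => g (circ z0 r t) * circ' r t) 0 (2 * PI)).
  { intros t _. apply pcont_mult; [|apply circ'_cont].
    apply pcont_comp; [now apply Hgc|apply circ_cont]. }
  assert (HI : @eq C (CRint (fun t => g (circ z0 r t) * circ' r t) 0 (2 * PI)) 0).
  { rewrite (cint_ftc (fun t => G (circ z0 r t))); auto using two_PI_pos.
    - replace (circ z0 r (2 * PI)) with (circ z0 r 0); [ring|].
      unfold circ. now rewrite cos_0, sin_0, cos_2PI, sin_2PI.
    - intros t _. apply pder_comp; [now apply HG|apply circ_der]. }
  assert (C1 : cint_on (fun t => circ' r t * / (circ z0 r t - z)) 0 (2 * PI)).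
  { intros t _. apply pcont_mult; [apply circ'_cont|now apply kernel_cont]. }
  assert (C2 : cint_on (fun t => circ' r t * f (circ z0 r t) * / (circ z0 r t - z)) 0 (2 * PI)).
  { intros t _. apply pcont_mult; [apply pcont_mult|now apply kernel_cont].
    - apply circ'_cont.
    - apply pcont_comp; [apply cder_cont, Hf, Hin|apply circ_cont]. }
  assert (E : ci1 z0 r (fun t => circ' r t * f (circ z0 r t)) z - f z * ci1 z0 r (circ' r) z = 0).
  { assert (C3 : cint_on (fun t => f z * (circ' r t * / (circ z0 r t - z))) 0 (2 * PI))
      by (intros t Ht; apply pcont_mult; [apply pcont_const|auto]).
    unfold ci1. rewrite <- cint_mult, <- cint_minus by auto using two_PI_pos.
    rewrite <- HI. apply cint_ext; [apply two_PI_pos|]. intros t _. unfold g.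
    pose proof (circ_neq z0 z r t Hz) as Hn.
    destruct (Ceq_dec (circ z0 r t) z) as [E|_]; [exfalso; apply Hn; rewrite E; ring|].
    field. auto. }
  match type of E with ?A - ?B = _ => replace A with (B + (A - B)) by ring end.
  rewrite E. ring.
Qed.

(** Near [z] the function is a quotient of two Cauchy transforms with nonvanishing denominator, and
    both can be differentiated twice. *)
Theorem holomorphic_derive (U : C -> Prop) (f : C -> C) :
  C_open U -> holomorphic_on U f -> holomorphic_on U (C_derive f).
Proof.
  intros HU Hf z Hz. destruct (near_open U z HU Hz) as [R0 [HR Hball]].
  assert (Hd : forall w, (Cmod (w - z) < R0)%R -> excder f w) by (intros w Hw; now apply Hf, Hball).
  set (r := (R0 / 2)%R).
  set (phi := fun t => circ' r t * f (circ z r t)).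
  assert (Hphi : cint_on phi 0 (2 * PI)).
  { intros t _. apply pcont_mult; [apply circ'_cont|].
    apply pcont_comp; [|apply circ_cont]. apply cder_cont, Hd.
    rewrite Cmod_circ_center; unfold r; lra. }
  assert (Hc' : cint_on (circ' r) 0 (2 * PI)) by (intros t _; apply circ'_cont).
  assert (Hnear : near z (fun w => (Cmod (w - z) < r)%R))
    by (exists r; split; auto; unfold r; lra).
  assert (Hrep : near z (fun w => f w = ci1 z r phi w / ci1 z r (circ' r) w)).
  { revert Hnear. apply near_imp. intros w Hw.
    pose proof (winding_neq0 z w r Hw) as Hn.
    unfold phi. rewrite <- (cauchy_formula f z w R0 r); auto; [field; auto|unfold r; lra]. }
  assert (Hder : near z (fun w =>
    (ci2 z r phi w * ci1 z r (circ' r) w - ci1 z r phi w * ci2 z r (circ' r) w)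
      / (ci1 z r (circ' r) w * ci1 z r (circ' r) w) = C_derive f w)).
  { generalize (near_and _ _ _ (near_near _ _ Hrep) Hnear). apply near_imp. intros w [Hw1 Hw2].
    symmetry. rewrite (C_derive_ext_near _ _ _ Hw1). apply cder_unique.
    apply cder_div; [now apply winding_neq0|now apply ci1_der|now apply ci1_der]. }
  pose proof (near_at _ _ Hnear) as Hz0.
  pose proof (winding_neq0 z z r Hz0) as Hn.
  eexists. eapply cder_ext_near; [exact Hder|].
  apply (cder_div _ (fun w => ci1 z r (circ' r) w * ci1 z r (circ' r) w)).
  - now apply Cmult_neq_0.
  - apply cder_minus; apply cder_mult.
    + now apply ci2_der.
    + now apply ci1_der.
    + now apply ci1_der.
    + now apply ci2_der.
  - apply cder_mult; now apply ci1_der.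
Qed.

(* Applied to [f w / (w - w0) ^ n], this replaces the maximum principle. *)
Lemma cauchy_bound (z0 z : C) (R0 r : R) : (r < R0)%R -> (Cmod (z - z0) < r)%R ->
  exists A : R, (0 <= A)%R /\ forall (f : C -> C) (h : R -> R) (S : R),
    (forall w, (Cmod (w - z0) < R0)%R -> excder f w) ->
    (forall t, (Cmod (f (circ z0 r t)) <= h t)%R) -> is_RInt h 0 (2 * PI) S ->
    (Cmod (f z) <= A * S)%R.
Proof.
  intros HrR Hz.
  assert (Hr : (0 < r)%R) by (pose proof (Cmod_ge_0 (z - z0)); lra).
  pose proof (winding_neq0 z0 z r Hz) as Hn.
  set (I := ci1 z0 r (circ' r) z) in *.
  assert (HI : (0 < Cmod I)%R) by now apply Cmod_gt_0.
  set (d := (r - Cmod (z - z0))%R). assert (Hd : (0 < d)%R) by (unfold d; lra).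
  assert (Hdi : (0 < / d)%R) by now apply Rinv_0_lt_compat.
  assert (HIi : (0 < / Cmod I)%R) by now apply Rinv_0_lt_compat.
  exists (r * / d * / Cmod I)%R. split; [repeat apply Rmult_le_pos; lra|].
  intros f h S Hf Hh HS.
  pose proof (cauchy_formula f z0 z R0 r Hf HrR Hz) as E. fold I in E.
  assert (Hb : (Cmod (ci1 z0 r (fun t => circ' r t * f (circ z0 r t))%C z) <= scal (r * / d)%R S)%R).
  { apply cint_bound with (h := fun t => scal (r * / d)%R (h t)).
    - apply two_PI_pos.
    - intros t _. apply pcont_mult; [apply pcont_mult|now apply kernel_cont].
      + apply circ'_cont.
      + apply pcont_comp; [apply cder_cont, Hf|apply circ_cont].
        rewrite Cmod_circ_center; lra.
    - intros t _. rewrite !Cmod_mult, Cmod_circ' by lra.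
      change (scal (r * / d)%R (h t)) with (r * / d * h t)%R.
      replace (r * / d * h t)%R with (r * h t * / d)%R by ring.
      assert (Hk : (Cmod (/ (circ z0 r t - z)) <= / d)%R)
        by (apply (kernel_bound z0 r z t d Hd); unfold d; lra).
      pose proof (Cmod_ge_0 (f (circ z0 r t))).
      apply Rmult_le_compat; auto using Cmod_ge_0.
      + apply Rmult_le_pos; lra.
      + apply Rmult_le_compat_l; [lra|auto].
    - now apply (@is_RInt_scal R_NormedModule). }
  rewrite <- E, Cmod_mult in Hb.
  change (scal (r * / d)%R S) with (r * / d * S)%R in Hb.
  apply Rmult_le_reg_r with (1 := HI).
  replace (r * / d * / Cmod I * S * Cmod I)%R with (r * / d * S)%R by (field; lra). exact Hb.
Qed.

(** Since [f] vanishes near [w], the quotient f v / (v - w)^n is holomorphic on the disc for every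
    n. The constant [A] does not depend on the function, so Cmod (f z) <= A * S * q^n with q = Cmod
    (z - w) / r < 1. *)
Lemma vanishing_ball (f : C -> C) (w z : C) (R0 : R) :
  (forall v, (Cmod (v - w) < R0)%R -> excder f v) -> near w (fun v => f v = 0) ->
  (Cmod (z - w) < R0)%R -> f z = 0.
Proof.
  intros Hf H0 Hz.
  destruct (Ceq_dec z w) as [->|Hne]; [now apply (near_at _ _ H0)|].
  assert (Hzw : z - w <> 0) by now apply Cminus_neq_0.
  assert (Hpos : (0 < Cmod (z - w))%R) by now apply Cmod_gt_0.
  set (r := ((Cmod (z - w) + R0) / 2)%R).
  assert (Hr1 : (Cmod (z - w) < r)%R) by (unfold r; lra).
  assert (Hr2 : (r < R0)%R) by (unfold r; lra).
  destruct (cauchy_bound w z R0 r Hr2 Hr1) as [A [HA Hbound]].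
  set (S := RInt (fun t => Cmod (f (circ w r t))) 0 (2 * PI)).
  assert (HS : is_RInt (fun t => Cmod (f (circ w r t))) 0 (2 * PI) S).
  { apply (@RInt_correct R_CompleteNormedModule).
    apply (@ex_RInt_continuous R_CompleteNormedModule).
    intros t _. apply pcont_Cmod, pcont_comp; [|apply circ_cont].
    apply cder_cont, Hf. rewrite Cmod_circ_center; lra. }
  assert (Hn : forall n, (Cmod (f z) <= A * S * (Cmod (z - w) / r) ^ n)%R).
  { intros n.
    assert (Hp0 : forall v, v - w <> 0 -> (v - w) ^ n <> 0) by (intros v Hv; now apply Cpow_nz).
    set (k := (/ r ^ n)%R).
    assert (B : (Cmod (f z / (z - w) ^ n) <= A * scal k S)%R).
    { apply (Hbound (fun v => f v / (v - w) ^ n) (fun t => scal k (Cmod (f (circ w r t))))).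
      - intros v Hv. destruct (Ceq_dec v w) as [->|Hvw].
        (* Near [w] the numerator is 0, so the quotient is 0 whatever a division by 0 returns. *)
        + exists 0. apply cder_ext_near with (fun _ => 0); [|apply cder_const].
          revert H0. apply near_imp. intros u ->. unfold Cdiv. ring.
        + assert (Hvw' : v - w <> 0) by now apply Cminus_neq_0.
          destruct (Hf v Hv) as [l Hl].
          assert (HP : forall m, excder (fun u => (u - w) ^ m) v).
          { induction m as [|m [lm IH]]; [exists 0; exact (cder_const 1 v)|].
            eexists. apply (cder_mult (fun u => u - w)); [|exact IH].
            apply cder_minus; [apply cder_id|apply cder_const]. }
          destruct (HP n) as [ln Hln]. eexists. apply cder_div; eauto.
      - intros t. change (scal k (Cmod (f (circ w r t)))) with (k * Cmod (f (circ w r t)))%R.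
        assert (Hc : circ w r t - w <> 0).
        { intros E. pose proof (Cmod_circ_center w r t ltac:(lra)) as Q.
          rewrite E, Cmod_0 in Q. lra. }
        rewrite Cmod_div by auto. rewrite Cmod_pow, Cmod_circ_center by lra.
        unfold k. apply Req_le. unfold Rdiv. ring.
      - now apply (@is_RInt_scal R_NormedModule). }
    change (scal k S) with (k * S)%R in B.
    rewrite Cmod_div, Cmod_pow in B by auto.
    assert (Hq : (0 < Cmod (z - w) ^ n)%R) by now apply pow_lt.
    apply Rmult_le_compat_r with (r := (Cmod (z - w) ^ n)%R) in B; [|lra].
    unfold Rdiv at 1 in B. rewrite Rmult_assoc, Rinv_l, Rmult_1_r in B by lra.
    unfold Rdiv. rewrite Rpow_mult_distr, pow_inv. fold k. lra. }
  set (q := (Cmod (z - w) / r)%R) in *.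
  assert (Hq : (0 <= q < 1)%R).
  { split; [apply Rlt_le, Rdiv_lt_0_compat; lra|].
    apply Rmult_lt_reg_r with r; [lra|]. unfold q, Rdiv.
    rewrite Rmult_assoc, Rinv_l by lra. lra. }
  apply Cmod_eq_0, Rle_antisym; [|apply Cmod_ge_0].
  apply le_epsilon. intros e He.
  assert (HM : (0 < Rabs (A * S) + 1)%R) by (pose proof (Rabs_pos (A * S)); lra).
  destruct (pow_lt_1_zero q ltac:(rewrite Rabs_pos_eq; lra) (e / (Rabs (A * S) + 1)))
    as [n Hn']; [now apply Rdiv_lt_0_compat|].
  specialize (Hn n). specialize (Hn' n (le_n n)).
  rewrite Rabs_pos_eq in Hn' by (apply pow_le; lra).
  pose proof (pow_le q n (proj1 Hq)).
  apply Rle_trans with (1 := Hn). rewrite Rplus_0_l.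
  apply Rle_trans with ((Rabs (A * S) + 1) * q ^ n)%R.
  - apply Rmult_le_compat_r; auto. pose proof (Rle_abs (A * S)). lra.
  - apply Rle_trans with ((Rabs (A * S) + 1) * (e / (Rabs (A * S) + 1)))%R.
    + apply Rmult_le_compat_l; lra.
    + apply Req_le. field. lra.
Qed.

(** The interior [A] of the zero set and its complement [B] in [U] are both open and disjoint, so a
    nonempty [B] would contradict connectedness. *)
Theorem identity_theorem (U : C -> Prop) (f : C -> C) (z0 : C) :
  C_open U -> C_connected U -> holomorphic_on U f ->
  U z0 -> near z0 (fun z => f z = 0) -> forall z, U z -> f z = 0.
Proof.
  intros HU Hconn Hf Hz0 H0 z Hz.
  set (A := fun z => near z (fun w => f w = 0)).
  set (B := fun z => U z /\ ~ A z).
  destruct (classic (A z)) as [Ha|Hna]; [now apply (near_at _ _ Ha)|exfalso].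
  destruct (Hconn A B) as [v [Hv [HvA [_ HvB]]]]; auto.
  - apply open_near. intros w Hw. now apply near_near.
  - apply open_near. intros w [Hw HwB]. destruct (near_open U w HU Hw) as [d [Hd Hb]].
    (* If a point [v] within d / 2 of [w] were in [A], then [f] would vanish on the disc of radius d
       / 2 around [v], which contains [w]; so [w] would be in [A]. *)
    exists (d / 2)%R. split; [lra|]. intros v Hv. split; [apply Hb; lra|].
    intros HA. apply HwB. exists (d / 2)%R. split; [lra|]. intros u Hu'.
    assert (Hsub : forall p, (Cmod (p - v) < d / 2)%R -> (Cmod (p - w) < d)%R).
    { intros p Hp. replace (p - w) with ((p - v) + (v - w)) by ring.
      pose proof (Cmod_triangle (p - v) (v - w)). lra. }
    assert (Hvan : forall p, (Cmod (p - v) < d / 2)%R -> f p = 0).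
    { intros p Hp. apply (vanishing_ball f v p (d / 2)); auto.
      intros q Hq. now apply Hf, Hb, Hsub. }
    apply (vanishing_ball f w u d); auto; [intros q Hq; now apply Hf, Hb| |lra].
    exists (d / 2 - Cmod (v - w))%R. split; [lra|]. intros q Hq. apply Hvan.
    replace (q - v) with ((q - w) + - (v - w)) by ring.
    eapply Rle_lt_trans; [apply Cmod_triangle|]. rewrite Cmod_opp. lra.
  - intros w Hw. destruct (classic (A w)); [now left|right; now split].
  - exists z0. split; auto.
  - exists z. repeat split; auto.
Qed.

(** * Holomorphic functions of two variables *)

Definition near2 (p : C * C) (P : C * C -> Prop) : Prop :=
  exists d : R, (0 < d)%R /\ forall q, (Cmod (fst q - fst p) < d)%R ->
    (Cmod (snd q - snd p) < d)%R -> P q.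

Lemma Cmod_box (z w : C) (d : R) :
  (Rabs (fst z - fst w) < d / 2)%R -> (Rabs (snd z - snd w) < d / 2)%R -> (Cmod (z - w) < d)%R.
Proof.
  intros H1 H2. pose proof (Cmod_le_abs (z - w)) as H.
  change (fst (z - w)) with (fst z - fst w)%R in H.
  change (snd (z - w)) with (snd z - snd w)%R in H. lra.
Qed.

Lemma near2_locally (p : C * C) (P : C * C -> Prop) :
  @locally (prod_UniformSpace C_UniformSpace C_UniformSpace) p P <-> near2 p P.
Proof.
  split.
  - intros [d Hd]. exists d. split; [apply cond_pos|]. intros q H1 H2. apply Hd.
    split; split.
    + eapply Rle_lt_trans; [apply (Rabs_re_le (fst q - fst p))|exact H1].
    + eapply Rle_lt_trans; [apply (Rabs_im_le (fst q - fst p))|exact H1].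
    + eapply Rle_lt_trans; [apply (Rabs_re_le (snd q - snd p))|exact H2].
    + eapply Rle_lt_trans; [apply (Rabs_im_le (snd q - snd p))|exact H2].
  - intros [d [Hd H]]. assert (Hd2 : (0 < d / 2)%R) by lra.
    exists (mkposreal _ Hd2). intros q [[H1 H2] [H3 H4]].
    apply H; eapply Cmod_box; eassumption.
Qed.

Lemma near2_imp (p : C * C) (P Q : C * C -> Prop) :
  (forall q, P q -> Q q) -> near2 p P -> near2 p Q.
Proof. intros H [d [Hd HP]]. exists d. auto. Qed.

Lemma near2_and (p : C * C) (P Q : C * C -> Prop) :
  near2 p P -> near2 p Q -> near2 p (fun q => P q /\ Q q).
Proof.
  intros [d [Hd HP]] [e [He HQ]]. exists (Rmin d e).
  split; [now apply Rmin_pos|]. intros q H1 H2.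
  pose proof (Rmin_l d e). pose proof (Rmin_r d e).
  split; [apply HP|apply HQ]; lra.
Qed.

Lemma near2_open (Om : C * C -> Prop) (p : C * C) : C2_open Om -> Om p -> near2 p Om.
Proof. intros HU Hz. apply near2_locally. now apply HU. Qed.

Lemma open_near2 (Om : C * C -> Prop) : (forall p, Om p -> near2 p Om) -> C2_open Om.
Proof. intros H z Hz. apply near2_locally. now apply H. Qed.

Lemma near2_near2 (p : C * C) (P : C * C -> Prop) :
  near2 p P -> near2 p (fun q => near2 q P).
Proof.
  intros [d [Hd H]]. exists (d / 2)%R. split; [lra|]. intros q H1 H2.
  exists (d / 2)%R. split; [lra|]. intros v V1 V2. apply H.
  - replace (fst v - fst p) with ((fst v - fst q) + (fst q - fst p)) by ring.
    pose proof (Cmod_triangle (fst v - fst q) (fst q - fst p)). lra.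
  - replace (snd v - snd p) with ((snd v - snd q) + (snd q - snd p)) by ring.
    pose proof (Cmod_triangle (snd v - snd q) (snd q - snd p)). lra.
Qed.

Lemma Cmod_self (z : C) : Cmod (z - z) = 0%R.
Proof. replace (z - z) with (RtoC 0) by ring. apply Cmod_0. Qed.

Lemma near2_at (p : C * C) (P : C * C -> Prop) : near2 p P -> P p.
Proof. intros [d [Hd H]]. apply H; now rewrite Cmod_self. Qed.

Lemma near2_fst (p : C * C) (P : C * C -> Prop) :
  near2 p P -> near (fst p) (fun u => P (u, snd p)).
Proof. intros [d [Hd H]]. exists d. split; auto. intros u Hu. apply H; simpl; auto.
  now rewrite Cmod_self. Qed.

Lemma near2_snd (p : C * C) (P : C * C -> Prop) :
  near2 p P -> near (snd p) (fun v => P (fst p, v)).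
Proof. intros [d [Hd H]]. exists d. split; auto. intros u Hu. apply H; simpl; auto.
  now rewrite Cmod_self. Qed.

Definition der2 (f : C * C -> C) (p : C * C) (l1 l2 : C) : Prop :=
  forall eps : R, (0 < eps)%R -> near2 p (fun q =>
    (Cmod (f q - f p - (l1 * (fst q - fst p) + l2 * (snd q - snd p))) <=
     eps * (Cmod (fst q - fst p) + Cmod (snd q - snd p)))%R).

Definition cont2 (f : C * C -> C) (p : C * C) : Prop :=
  forall eps : R, (0 < eps)%R -> near2 p (fun q => (Cmod (f q - f p) < eps)%R).

Notation C2_NormedModule := (prod_NormedModule C_AbsRing C_NormedModule C_NormedModule).

Lemma C2_norm_le (h k : C) :
  (@norm C_AbsRing C2_NormedModule (h, k) <= Cmod h + Cmod k)%R.
Proof.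
  change (sqrt (Cmod h ^ 2 + Cmod k ^ 2) <= Cmod h + Cmod k)%R.
  pose proof (Cmod_ge_0 h). pose proof (Cmod_ge_0 k).
  rewrite <- (sqrt_Rsqr (Cmod h + Cmod k)) by lra.
  apply sqrt_le_1_alt. unfold Rsqr. nra.
Qed.

Lemma C2_norm_ge (h k : C) :
  (Cmod h + Cmod k <= 2 * @norm C_AbsRing C2_NormedModule (h, k))%R.
Proof.
  change (Cmod h + Cmod k <= 2 * sqrt (Cmod h ^ 2 + Cmod k ^ 2))%R.
  pose proof (sqrt_plus_sqr (Cmod h) (Cmod k)) as [H _].
  rewrite !Rabs_pos_eq in H by apply Cmod_ge_0.
  pose proof (Rmax_l (Cmod h) (Cmod k)). pose proof (Rmax_r (Cmod h) (Cmod k)). lra.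
Qed.

Lemma C2_differentiable_der2 (f : C * C -> C) (p : C * C) :
  C2_differentiable f p <-> exists l1 l2, der2 f p l1 l2.
Proof.
  split.
  - intros [l [Hlin H]]. exists (l (RtoC 1, RtoC 0)), (l (RtoC 0, RtoC 1)).
    assert (El : forall h k : C, l (h, k) = l (RtoC 1, RtoC 0) * h + l (RtoC 0, RtoC 1) * k).
    { intros h k.
      replace ((h, k) : C * C) with
        (@plus C2_NormedModule (@scal C_AbsRing C2_NormedModule h (RtoC 1, RtoC 0))
          (@scal C_AbsRing C2_NormedModule k (RtoC 0, RtoC 1))).
      - rewrite (linear_plus l Hlin), !(linear_scal l Hlin).
        rewrite (Cmult_comm _ h), (Cmult_comm _ k). reflexivity.
      - change ((h * 1 + k * 0, h * 0 + k * 1) = (h, k)). f_equal; ring. }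
    intros eps Heps.
    specialize (H p (fun P HP => HP) (mkposreal eps Heps)).
    apply near2_locally in H. revert H. apply near2_imp. intros q Hq.
    change (Cmod (f q - f p - l ((fst q - fst p)%C, (snd q - snd p)%C)) <=
      eps * @norm C_AbsRing C2_NormedModule ((fst q - fst p)%C, (snd q - snd p)%C))%R in Hq.
    rewrite El in Hq. eapply Rle_trans; [exact Hq|].
    apply Rmult_le_compat_l; [lra|apply C2_norm_le].
  - intros [l1 [l2 H]].
    exists (fun h : C * C => l1 * fst h + l2 * snd h). split.
    + apply Build_is_linear.
      * intros u v. change (l1 * (fst u + fst v) + l2 * (snd u + snd v) =
          l1 * fst u + l2 * snd u + (l1 * fst v + l2 * snd v)). ring.
      * intros k u. change (l1 * (k * fst u) + l2 * (k * snd u) =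
          k * (l1 * fst u + l2 * snd u)). ring.
      * pose proof (Cmod_ge_0 l1). pose proof (Cmod_ge_0 l2).
        exists (2 * (Cmod l1 + Cmod l2 + 1))%R. split; [lra|].
        intros [h k]. change (Cmod (l1 * h + l2 * k) <= 2 * (Cmod l1 + Cmod l2 + 1) *
          @norm C_AbsRing C2_NormedModule (h, k))%R.
        eapply Rle_trans; [apply Cmod_triangle|]. rewrite !Cmod_mult.
        pose proof (C2_norm_ge h k). pose proof (Cmod_ge_0 h). pose proof (Cmod_ge_0 k).
        apply Rle_trans with ((Cmod l1 + Cmod l2 + 1) * (Cmod h + Cmod k))%R; [nra|].
        rewrite (Rmult_comm 2), Rmult_assoc. apply Rmult_le_compat_l; [lra|apply C2_norm_ge].
    + intros x Hx.
      assert (Hxp : p = x).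
      { apply (@is_filter_lim_locally_unique C_AbsRing C2_NormedModule). exact Hx. }
      subst x. intros eps.
      assert (He : (0 < eps / 2)%R) by (pose proof (cond_pos eps); lra).
      specialize (H _ He). apply near2_locally. revert H. apply near2_imp. intros q Hq.
      change (Cmod (f q - f p - (l1 * (fst q - fst p) + l2 * (snd q - snd p))) <=
        eps * @norm C_AbsRing C2_NormedModule ((fst q - fst p)%C, (snd q - snd p)%C))%R.
      eapply Rle_trans; [exact Hq|].
      replace (pos eps) with (eps / 2 * 2)%R at 2 by field. rewrite Rmult_assoc.
      apply Rmult_le_compat_l; [lra|apply C2_norm_ge].
Qed.

Lemma der2_cont (f : C * C -> C) (p : C * C) (l1 l2 : C) : der2 f p l1 l2 -> cont2 f p.
Proof.
  intros H eps Heps. specialize (H 1%R Rlt_0_1).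
  set (K := (2 * (Cmod l1 + Cmod l2 + 2))%R).
  pose proof (Cmod_ge_0 l1) as P1. pose proof (Cmod_ge_0 l2) as P2.
  assert (HK : (0 < K)%R) by (unfold K; lra).
  assert (Hs : near2 p (fun q => (Cmod (fst q - fst p) < eps / K)%R /\
    (Cmod (snd q - snd p) < eps / K)%R)).
  { exists (eps / K)%R. split; auto. now apply Rdiv_lt_0_compat. }
  generalize (near2_and _ _ _ H Hs). apply near2_imp. intros q [Hq [S1 S2]].
  assert (E : (eps / K * K = eps)%R) by (field; lra).
  set (s := (eps / K)%R) in *.
  set (h := fst q - fst p) in *. set (k := snd q - snd p) in *.
  replace (f q - f p) with ((f q - f p - (l1 * h + l2 * k)) + (l1 * h + l2 * k)) by ring.
  eapply Rle_lt_trans; [apply Cmod_triangle|].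
  pose proof (Cmod_triangle (l1 * h) (l2 * k)) as T. rewrite !Cmod_mult in T.
  pose proof (Cmod_ge_0 h). pose proof (Cmod_ge_0 k). unfold K in E. nra.
Qed.

Lemma der2_x (f : C * C -> C) (p : C * C) (l1 l2 : C) :
  der2 f p l1 l2 -> cder (fun u => f (u, snd p)) (fst p) l1.
Proof.
  intros H. apply cder_eps. intros eps Heps.
  specialize (H eps Heps). apply near2_fst in H. revert H. apply near_imp. intros u Hu.
  simpl in Hu. rewrite Cmod_self, Rplus_0_r in Hu. rewrite <- surjective_pairing.
  replace (l1 * (u - fst p) + l2 * (snd p - snd p)) with (l1 * (u - fst p)) in Hu by ring.
  exact Hu.
Qed.

Lemma der2_y (f : C * C -> C) (p : C * C) (l1 l2 : C) :
  der2 f p l1 l2 -> cder (fun v => f (fst p, v)) (snd p) l2.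
Proof.
  intros H. apply cder_eps. intros eps Heps.
  specialize (H eps Heps). apply near2_snd in H. revert H. apply near_imp. intros u Hu.
  simpl in Hu. rewrite Cmod_self, Rplus_0_l in Hu. rewrite <- surjective_pairing.
  replace (l1 * (fst p - fst p) + l2 * (u - snd p)) with (l2 * (u - snd p)) in Hu by ring.
  exact Hu.
Qed.

Lemma der2_Dx (f : C * C -> C) (p : C * C) (l1 l2 : C) : der2 f p l1 l2 -> Dx f p = l1.
Proof. intros H. apply cder_unique. eapply der2_x; eauto. Qed.

Lemma der2_Dy (f : C * C -> C) (p : C * C) (l1 l2 : C) : der2 f p l1 l2 -> Dy f p = l2.
Proof. intros H. apply cder_unique. eapply der2_y; eauto. Qed.

Lemma der2_ext (f g : C * C -> C) (p : C * C) (l1 l2 : C) :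
  near2 p (fun q => f q = g q) -> der2 f p l1 l2 -> der2 g p l1 l2.
Proof.
  intros E H eps Heps. generalize (near2_and _ _ _ E (H eps Heps)). apply near2_imp.
  intros q [Eq Hq]. now rewrite <- Eq, <- (near2_at _ _ E).
Qed.

Lemma der2_affine (f : C * C -> C) (p : C * C) (l1 l2 : C) :
  (forall q, f q - f p - (l1 * (fst q - fst p) + l2 * (snd q - snd p)) = 0) -> der2 f p l1 l2.
Proof.
  intros H eps Heps. exists 1%R. split; [lra|]. intros q _ _. rewrite H, Cmod_0.
  pose proof (Cmod_ge_0 (fst q - fst p)). pose proof (Cmod_ge_0 (snd q - snd p)). nra.
Qed.

Lemma der2_const (k : C) (p : C * C) : der2 (fun _ => k) p 0 0.
Proof. apply der2_affine. intros q. ring. Qed.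

Lemma der2_fst (p : C * C) : der2 fst p 1 0.
Proof. apply der2_affine. intros q. ring. Qed.

Lemma der2_snd (p : C * C) : der2 snd p 0 1.
Proof. apply der2_affine. intros q. ring. Qed.

Lemma der2_plus (f g : C * C -> C) (p : C * C) (l1 l2 m1 m2 : C) :
  der2 f p l1 l2 -> der2 g p m1 m2 -> der2 (fun q => f q + g q) p (l1 + m1) (l2 + m2).
Proof.
  intros Hf Hg eps Heps.
  generalize (near2_and _ _ _ (Hf (eps / 2)%R ltac:(lra)) (Hg (eps / 2)%R ltac:(lra))).
  apply near2_imp. intros q [Q1 Q2].
  set (h := fst q - fst p) in *. set (k := snd q - snd p) in *.
  replace (f q + g q - (f p + g p) - ((l1 + m1) * h + (l2 + m2) * k)) with
    ((f q - f p - (l1 * h + l2 * k)) + (g q - g p - (m1 * h + m2 * k))) by ring.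
  eapply Rle_trans; [apply Cmod_triangle|]. lra.
Qed.

Lemma der2_mult (f g : C * C -> C) (p : C * C) (l1 l2 m1 m2 : C) :
  der2 f p l1 l2 -> der2 g p m1 m2 ->
  der2 (fun q => f q * g q) p (l1 * g p + f p * m1) (l2 * g p + f p * m2).
Proof.
  intros Hf Hg eps Heps.
  pose proof (der2_cont _ _ _ _ Hf) as Cf.
  pose proof (Cmod_ge_0 (g p)) as G0. pose proof (Cmod_ge_0 (f p)) as F0.
  pose proof (Cmod_ge_0 m1) as M1. pose proof (Cmod_ge_0 m2) as M2.
  (* [A], [B] and [M] bound g p, the values of [f] near [p] and the partials of [g]; each of the
     three parts of the remainder gets a third of [eps]. *)
  set (A := (Cmod (g p) + 1)%R). set (B := (Cmod (f p) + 2)%R). set (M := (Cmod m1 + Cmod m2 + 1)%R).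
  assert (HA : (0 < eps / (3 * A))%R) by (apply Rdiv_lt_0_compat; unfold A; lra).
  assert (HB : (0 < eps / (3 * B))%R) by (apply Rdiv_lt_0_compat; unfold B; lra).
  assert (HM : (0 < eps / (3 * M))%R) by (apply Rdiv_lt_0_compat; unfold M; lra).
  generalize (near2_and _ _ _ (near2_and _ _ _ (Hf _ HA) (Hg _ HB))
    (near2_and _ _ _ (Cf 1%R Rlt_0_1) (Cf _ HM))).
  apply near2_imp. intros q [[Q1 Q2] [Q3 Q4]].
  assert (EA : (eps / (3 * A) * A = eps / 3)%R) by (field; unfold A; lra).
  assert (EB : (eps / (3 * B) * B = eps / 3)%R) by (field; unfold B; lra).
  assert (EM : (eps / (3 * M) * M = eps / 3)%R) by (field; unfold M; lra).
  set (eA := (eps / (3 * A))%R) in *. set (eB := (eps / (3 * B))%R) in *.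
  set (eM := (eps / (3 * M))%R) in *.
  set (h := fst q - fst p) in *. set (k := snd q - snd p) in *.
  assert (Fq : (Cmod (f q) <= B)%R).
  { replace (f q) with ((f q - f p) + f p) by ring.
    pose proof (Cmod_triangle (f q - f p) (f p)). unfold B. lra. }
  set (u := (Cmod h + Cmod k)%R) in *.
  assert (U0 : (0 <= u)%R) by (pose proof (Cmod_ge_0 h); pose proof (Cmod_ge_0 k); unfold u; lra).
  assert (Hm : (Cmod (m1 * h + m2 * k) <= M * u)%R).
  { eapply Rle_trans; [apply Cmod_triangle|]. rewrite !Cmod_mult.
    pose proof (Cmod_ge_0 h). pose proof (Cmod_ge_0 k). unfold M, u. nra. }
  replace (f q * g q - f p * g p - ((l1 * g p + f p * m1) * h + (l2 * g p + f p * m2) * k))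
    with ((f q - f p - (l1 * h + l2 * k)) * g p + f q * (g q - g p - (m1 * h + m2 * k))
      + (f q - f p) * (m1 * h + m2 * k)) by ring.
  eapply Rle_trans; [apply Cmod_triangle|].
  eapply Rle_trans; [apply Rplus_le_compat_r, Cmod_triangle|]. rewrite !Cmod_mult.
  set (X := Cmod (f q - f p - (l1 * h + l2 * k))) in *.
  set (Y := Cmod (g q - g p - (m1 * h + m2 * k))) in *.
  set (Z := Cmod (m1 * h + m2 * k)) in *.
  assert (X * Cmod (g p) <= eps / 3 * u)%R.
  { apply Rle_trans with (eA * u * A)%R.
    - apply Rmult_le_compat; auto; [apply Cmod_ge_0|unfold A; lra].
    - rewrite <- EA. apply Req_le. ring. }
  assert (Cmod (f q) * Y <= eps / 3 * u)%R.
  { apply Rle_trans with (B * (eB * u))%R.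
    - apply Rmult_le_compat; auto; apply Cmod_ge_0.
    - rewrite <- EB. apply Req_le. ring. }
  assert (Cmod (f q - f p) * Z <= eps / 3 * u)%R.
  { apply Rle_trans with (eM * (M * u))%R.
    - apply Rmult_le_compat; auto; try apply Cmod_ge_0. lra.
    - rewrite <- EM. apply Req_le. ring. }
  lra.
Qed.

Lemma Dx_ext (f g : C * C -> C) (p : C * C) :
  near2 p (fun q => f q = g q) -> Dx f p = Dx g p.
Proof. intros H. apply C_derive_ext_near. exact (near2_fst _ _ H). Qed.

Lemma Dy_ext (f g : C * C -> C) (p : C * C) :
  near2 p (fun q => f q = g q) -> Dy f p = Dy g p.
Proof. intros H. apply C_derive_ext_near. exact (near2_snd _ _ H). Qed.

Section Holomorphic2.

Variable Om : C * C -> Prop.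
Hypothesis HOm : C2_open Om.

Lemma near2_of_eq (f g : C * C -> C) (p : C * C) :
  (forall q, Om q -> f q = g q) -> Om p -> near2 p (fun q => f q = g q).
Proof. intros H Hp. generalize (near2_open _ _ HOm Hp). now apply near2_imp. Qed.

Lemma iterated_partial_ext (w : list bool) (f g : C * C -> C) :
  (forall p, Om p -> f p = g p) ->
  forall p, Om p -> iterated_partial w f p = iterated_partial w g p.
Proof.
  intros H. induction w as [|[] w IH]; simpl; auto; intros p Hp.
  - apply Dx_ext. now apply near2_of_eq.
  - apply Dy_ext. now apply near2_of_eq.
Qed.

Lemma iterated_partial_snoc (w : list bool) (b : bool) (f : C * C -> C) :
  iterated_partial (w ++ b :: nil) f = iterated_partial w (if b then Dx f else Dy f).
Proof. induction w as [|c w IH]; [now destruct b|]. simpl. now rewrite IH. Qed.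

(** Bounding the order of the derivatives makes closure under sums and products provable by
    induction. *)
Definition smooth (n : nat) (f : C * C -> C) : Prop :=
  forall w p, (length w <= n)%nat -> Om p -> exists l1 l2, der2 (iterated_partial w f) p l1 l2.

Lemma smooth_all (f : C * C -> C) : holomorphic2_on Om f <-> forall n, smooth n f.
Proof.
  split.
  - intros H n w p _ Hp. apply C2_differentiable_der2. now apply H.
  - intros H w p Hp. apply C2_differentiable_der2. now apply (H (length w)).
Qed.

Lemma smooth_O (f : C * C -> C) : smooth 0 f <-> forall p, Om p -> exists l1 l2, der2 f p l1 l2.
Proof.
  split.
  - intros H p Hp. apply (H nil p); simpl; auto.
  - intros H w p Hw Hp. destruct w; [now apply H|simpl in Hw; lia].
Qed.

Lemma smooth_ext (n : nat) (f g : C * C -> C) :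
  (forall p, Om p -> f p = g p) -> smooth n f -> smooth n g.
Proof.
  intros E H w p Hw Hp. destruct (H w p Hw Hp) as [l1 [l2 Hl]]. exists l1, l2.
  apply der2_ext with (iterated_partial w f); auto.
  apply near2_of_eq; auto. intros q Hq. now apply iterated_partial_ext.
Qed.

(** The last letter of a word acts first on [f]. Splitting off this letter leaves a condition on the
    first partials, to which the Leibniz rule applies. *)
Lemma smooth_S (n : nat) (f : C * C -> C) :
  smooth (S n) f <-> smooth 0 f /\ smooth n (Dx f) /\ smooth n (Dy f).
Proof.
  split.
  - intros H. repeat split.
    + intros w p Hw. apply H. lia.
    + intros w p Hw Hp. pose proof (iterated_partial_snoc w true f) as E. simpl in E.
      rewrite <- E. apply H; auto. rewrite length_app. simpl. lia.
    + intros w p Hw Hp. pose proof (iterated_partial_snoc w false f) as E. simpl in E.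
      rewrite <- E. apply H; auto. rewrite length_app. simpl. lia.
  - intros (H0 & Hx & Hy) w p Hw Hp.
    destruct w as [|b0 w0].
    + apply (H0 nil); simpl; auto.
    + destruct (@exists_last bool (b0 :: w0)) as [w' [b E]]; [discriminate|].
      rewrite E in *. rewrite iterated_partial_snoc. rewrite length_app in Hw. simpl in Hw.
      destruct b; [apply Hx|apply Hy]; auto; lia.
Qed.

Lemma smooth_of_partials (n : nat) (f f1 f2 : C * C -> C) :
  (forall p, der2 f p (f1 p) (f2 p)) ->
  (forall m, (m < n)%nat -> smooth m f1 /\ smooth m f2) -> smooth n f.
Proof.
  intros H Hs.
  assert (H0 : smooth 0 f) by (apply smooth_O; intros p _; exists (f1 p), (f2 p); auto).
  destruct n as [|n]; auto. destruct (Hs n) as [S1 S2]; [lia|].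
  apply smooth_S. split; [exact H0|]. split.
  - apply smooth_ext with f1; auto. intros p _. symmetry. exact (der2_Dx _ _ _ _ (H p)).
  - apply smooth_ext with f2; auto. intros p _. symmetry. exact (der2_Dy _ _ _ _ (H p)).
Qed.

Lemma smooth_const (n : nat) (k : C) : smooth n (fun _ => k).
Proof.
  revert k. induction n as [n IH] using (well_founded_induction Wf_nat.lt_wf). intros k.
  apply (smooth_of_partials n _ _ _ (der2_const k)). auto.
Qed.

Lemma smooth_fst (n : nat) : smooth n fst.
Proof. apply (smooth_of_partials n _ _ _ der2_fst). intros m _. split; apply smooth_const. Qed.

Lemma smooth_snd (n : nat) : smooth n snd.
Proof. apply (smooth_of_partials n _ _ _ der2_snd). intros m _. split; apply smooth_const. Qed.

Lemma der2_partials (f : C * C -> C) (p : C * C) :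
  (exists l1 l2, der2 f p l1 l2) -> der2 f p (Dx f p) (Dy f p).
Proof.
  intros [l1 [l2 H]]. now rewrite (der2_Dx _ _ _ _ H), (der2_Dy _ _ _ _ H).
Qed.

Lemma smooth_plus (n : nat) (f g : C * C -> C) :
  smooth n f -> smooth n g -> smooth n (fun p => f p + g p).
Proof.
  revert f g. induction n as [|n IH]; intros f g Hf Hg.
  - rewrite smooth_O in *. intros p Hp.
    destruct (Hf p Hp) as [l1 [l2 Hl]]. destruct (Hg p Hp) as [m1 [m2 Hm]].
    eexists. eexists. apply der2_plus; eauto.
  - rewrite smooth_S in *. destruct Hf as (F0 & Fx & Fy). destruct Hg as (G0 & Gx & Gy).
    rewrite smooth_O in *.
    assert (D : forall p, Om p ->
      der2 (fun p => f p + g p) p (Dx f p + Dx g p) (Dy f p + Dy g p)).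
    { intros p Hp. apply der2_plus; apply der2_partials; auto. }
    repeat split.
    + intros p Hp. eexists. eexists. now apply D.
    + apply smooth_ext with (fun p => Dx f p + Dx g p); auto.
      intros p Hp. symmetry. exact (der2_Dx _ _ _ _ (D p Hp)).
    + apply smooth_ext with (fun p => Dy f p + Dy g p); auto.
      intros p Hp. symmetry. exact (der2_Dy _ _ _ _ (D p Hp)).
Qed.

Lemma smooth_pred (n : nat) (f : C * C -> C) : smooth (S n) f -> smooth n f.
Proof. intros H w p Hw. apply H. lia. Qed.

Lemma smooth_mult (n : nat) (f g : C * C -> C) :
  smooth n f -> smooth n g -> smooth n (fun p => f p * g p).
Proof.
  revert f g. induction n as [|n IH]; intros f g Hf Hg.
  - rewrite smooth_O in *. intros p Hp.
    destruct (Hf p Hp) as [l1 [l2 Hl]]. destruct (Hg p Hp) as [m1 [m2 Hm]].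
    eexists. eexists. apply der2_mult; eauto.
  - pose proof (smooth_pred _ _ Hf) as Hf'. pose proof (smooth_pred _ _ Hg) as Hg'.
    rewrite smooth_S in *. destruct Hf as (F0 & Fx & Fy). destruct Hg as (G0 & Gx & Gy).
    rewrite smooth_O in *.
    assert (D : forall p, Om p -> der2 (fun p => f p * g p) p
      (Dx f p * g p + f p * Dx g p) (Dy f p * g p + f p * Dy g p)).
    { intros p Hp. apply der2_mult; apply der2_partials; auto. }
    repeat split.
    + intros p Hp. eexists. eexists. now apply D.
    + apply smooth_ext with (fun p => Dx f p * g p + f p * Dx g p);
        [|apply smooth_plus; now apply IH].
      intros p Hp. symmetry. exact (der2_Dx _ _ _ _ (D p Hp)).
    + apply smooth_ext with (fun p => Dy f p * g p + f p * Dy g p);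
        [|apply smooth_plus; now apply IH].
      intros p Hp. symmetry. exact (der2_Dy _ _ _ _ (D p Hp)).
Qed.

Lemma holomorphic2_ext (f g : C * C -> C) :
  (forall p, Om p -> f p = g p) -> holomorphic2_on Om f -> holomorphic2_on Om g.
Proof. rewrite !smooth_all. intros E H n. now apply smooth_ext with f. Qed.

Lemma holomorphic2_const (k : C) : holomorphic2_on Om (fun _ => k).
Proof. apply smooth_all. intros n. apply smooth_const. Qed.

Lemma holomorphic2_fst : holomorphic2_on Om fst.
Proof. apply smooth_all. intros n. apply smooth_fst. Qed.

Lemma holomorphic2_snd : holomorphic2_on Om snd.
Proof. apply smooth_all. intros n. apply smooth_snd. Qed.

Lemma holomorphic2_plus (f g : C * C -> C) :
  holomorphic2_on Om f -> holomorphic2_on Om g -> holomorphic2_on Om (fun p => f p + g p).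
Proof. rewrite !smooth_all. intros Hf Hg n. now apply smooth_plus. Qed.

Lemma holomorphic2_mult (f g : C * C -> C) :
  holomorphic2_on Om f -> holomorphic2_on Om g -> holomorphic2_on Om (fun p => f p * g p).
Proof. rewrite !smooth_all. intros Hf Hg n. now apply smooth_mult. Qed.

Lemma holomorphic2_Dx (f : C * C -> C) : holomorphic2_on Om f -> holomorphic2_on Om (Dx f).
Proof. rewrite !smooth_all. intros H n. exact (proj1 (proj2 (proj1 (smooth_S n f) (H (S n))))). Qed.

Lemma holomorphic2_Dy (f : C * C -> C) : holomorphic2_on Om f -> holomorphic2_on Om (Dy f).
Proof. rewrite !smooth_all. intros H n. exact (proj2 (proj2 (proj1 (smooth_S n f) (H (S n))))). Qed.

Lemma holomorphic2_der2 (f : C * C -> C) (p : C * C) :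
  holomorphic2_on Om f -> Om p -> der2 f p (Dx f p) (Dy f p).
Proof.
  intros H Hp. apply der2_partials. apply C2_differentiable_der2. exact (H nil p Hp).
Qed.

End Holomorphic2.

(** * The connection of the F4 system *)

Lemma der2_comp (G : C -> C) (f : C * C -> C) (p : C * C) (l l1 l2 : C) :
  cder G (f p) l -> der2 f p l1 l2 -> der2 (fun q => G (f q)) p (l * l1) (l * l2).
Proof.
  rewrite cder_eps. intros HG Hf eps Heps.
  pose proof (Cmod_ge_0 l) as L0. pose proof (Cmod_ge_0 l1) as L1. pose proof (Cmod_ge_0 l2) as L2.
  set (A := (Cmod l1 + Cmod l2 + 1)%R). set (B := (Cmod l + 1)%R).
  set (e1 := (eps / (2 * A))%R). set (e2 := Rmin 1 (eps / (2 * B))%R).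
  assert (He1 : (0 < e1)%R) by (apply Rdiv_lt_0_compat; unfold A; lra).
  assert (He2 : (0 < e2)%R) by (apply Rmin_pos; [lra|apply Rdiv_lt_0_compat; unfold B; lra]).
  assert (E1 : (e1 * A = eps / 2)%R) by (unfold e1; field; unfold A; lra).
  assert (E2 : (e2 <= 1)%R) by apply Rmin_l.
  assert (E2' : (e2 * B <= eps / 2)%R).
  { apply Rle_trans with (eps / (2 * B) * B)%R.
    - apply Rmult_le_compat_r; [unfold B; lra|apply Rmin_r].
    - apply Req_le. field. unfold B. lra. }
  destruct (HG e1 He1) as [d [Hd HG']].
  generalize (near2_and _ _ _ (Hf e2 He2) (der2_cont _ _ _ _ Hf d Hd)).
  apply near2_imp. intros q [Q1 Q2]. specialize (HG' _ Q2).
  set (h := fst q - fst p) in *. set (k := snd q - snd p) in *.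
  set (u := (Cmod h + Cmod k)%R) in *.
  assert (U0 : (0 <= u)%R) by (pose proof (Cmod_ge_0 h); pose proof (Cmod_ge_0 k); unfold u; lra).
  assert (Hm : (Cmod (f q - f p) <= A * u)%R).
  { replace (f q - f p) with ((f q - f p - (l1 * h + l2 * k)) + (l1 * h + l2 * k)) by ring.
    eapply Rle_trans; [apply Cmod_triangle|].
    pose proof (Cmod_triangle (l1 * h) (l2 * k)) as T. rewrite !Cmod_mult in T.
    pose proof (Cmod_ge_0 h). pose proof (Cmod_ge_0 k). unfold A, u in *. nra. }
  replace (G (f q) - G (f p) - (l * l1 * h + l * l2 * k)) with
    ((G (f q) - G (f p) - l * (f q - f p)) + l * (f q - f p - (l1 * h + l2 * k))) by ring.
  eapply Rle_trans; [apply Cmod_triangle|]. rewrite Cmod_mult.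
  set (X := Cmod (f q - f p - (l1 * h + l2 * k))) in *.
  assert (e1 * Cmod (f q - f p) <= eps / 2 * u)%R.
  { rewrite <- E1, Rmult_assoc. apply Rmult_le_compat_l; lra. }
  assert (Cmod l * X <= eps / 2 * u)%R.
  { apply Rle_trans with (B * (e2 * u))%R.
    - apply Rmult_le_compat; auto; [apply Cmod_ge_0|unfold B; lra].
    - rewrite <- Rmult_assoc, (Rmult_comm B). now apply Rmult_le_compat_r. }
  lra.
Qed.

(** The discriminant (1 - x - y)^2 - 4 x y of y p^2 + (1 - x - y) p + x as a polynomial in p. *)
Definition Delta (p : C * C) : C :=
  fst p * fst p + snd p * snd p + 1 - 2 * fst p * snd p - 2 * fst p - 2 * snd p.

Definition regular (p : C * C) : Prop := fst p <> 0 /\ snd p <> 0 /\ Delta p <> 0.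

(* Syntactic elements of [C[x, y, 1/x, 1/y, 1/Delta]]: on syntax the two partial derivations
   commute without an appeal to the symmetry of second derivatives. *)
Inductive rexp : Type :=
| Cst (k : C) | VX | VY | IX | IY | ID
| Add (e f : rexp) | Mul (e f : rexp).

Declare Scope rexp_scope.
Delimit Scope rexp_scope with rexp.
Bind Scope rexp_scope with rexp.
Notation "e + f" := (Add e f) : rexp_scope.
Notation "e * f" := (Mul e f) : rexp_scope.

Fixpoint ev (e : rexp) (p : C * C) : C :=
  match e with
  | Cst k => k
  | VX => fst p
  | VY => snd p
  | IX => / fst p
  | IY => / snd p
  | ID => / Delta p
  | Add e f => ev e p + ev f p
  | Mul e f => ev e p * ev f p
  end.

Fixpoint dX (e : rexp) : rexp :=
  match e with
  | Cst _ | VY | IY => Cst 0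
  | VX => Cst 1
  | IX => Cst (-(1)) * (IX * IX)
  | ID => (Cst 2 * (Cst 1 + VY + Cst (-(1)) * VX)) * (ID * ID)
  | Add e f => dX e + dX f
  | Mul e f => dX e * f + e * dX f
  end%rexp.

Fixpoint dY (e : rexp) : rexp :=
  match e with
  | Cst _ | VX | IX => Cst 0
  | VY => Cst 1
  | IY => Cst (-(1)) * (IY * IY)
  | ID => (Cst 2 * (Cst 1 + VX + Cst (-(1)) * VY)) * (ID * ID)
  | Add e f => dY e + dY f
  | Mul e f => dY e * f + e * dY f
  end%rexp.

Lemma dX_dY (e : rexp) (p : C * C) : ev (dX (dY e)) p = ev (dY (dX e)) p.
Proof.
  induction e; simpl; try ring.
  - now rewrite IHe1, IHe2.
  - rewrite IHe1, IHe2. ring.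
Qed.

Lemma der2_val (f : C * C -> C) (p : C * C) (l1 l2 m1 m2 : C) :
  der2 f p l1 l2 -> l1 = m1 -> l2 = m2 -> der2 f p m1 m2.
Proof. now intros H <- <-. Qed.

Lemma der2_Delta (p : C * C) :
  der2 Delta p (2 * (fst p - snd p - 1)) (2 * (snd p - fst p - 1)).
Proof.
  pose proof (der2_fst p) as HX. pose proof (der2_snd p) as HY.
  pose proof (fun k => der2_const k p) as HK.
  pose proof (der2_plus _ _ _ _ _ _ _
    (der2_plus _ _ _ _ _ _ _
      (der2_plus _ _ _ _ _ _ _ (der2_mult _ _ _ _ _ _ _ HX HX) (der2_mult _ _ _ _ _ _ _ HY HY))
      (HK 1))
    (der2_mult _ _ _ _ _ _ _ (HK (-(2)))
      (der2_plus _ _ _ _ _ _ _ (der2_plus _ _ _ _ _ _ _ (der2_mult _ _ _ _ _ _ _ HX HY) HX) HY)))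
    as H.
  eapply der2_val.
  - eapply der2_ext; [|exact H]. exists 1%R. split; [lra|]. intros q _ _. unfold Delta. ring.
  - simpl. ring.
  - simpl. ring.
Qed.

Lemma ev_der2 (e : rexp) (p : C * C) : regular p ->
  der2 (ev e) p (ev (dX e) p) (ev (dY e) p).
Proof.
  intros (Hx & Hy & HD). induction e; simpl.
  - apply der2_const.
  - apply der2_fst.
  - apply der2_snd.
  - eapply der2_val.
    + apply (der2_comp Cinv fst); [now apply cder_inv|apply der2_fst].
    + field. auto.
    + ring.
  - eapply der2_val.
    + apply (der2_comp Cinv snd); [now apply cder_inv|apply der2_snd].
    + ring.
    + field. auto.
  - eapply der2_val.
    + apply (der2_comp Cinv Delta); [now apply cder_inv|apply der2_Delta].
    + field. auto.
    + field. auto.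
  - now apply der2_plus.
  - now apply der2_mult.
Qed.

Lemma regular_near (p : C * C) : regular p -> near2 p regular.
Proof.
  intros (Hx & Hy & HD).
  assert (H : forall f l1 l2, der2 f p l1 l2 -> f p <> 0 -> near2 p (fun q => f q <> 0)).
  { intros f l1 l2 Hf Hn. pose proof (proj1 (Cmod_gt_0 _) Hn) as Hm.
    generalize (der2_cont _ _ _ _ Hf _ Hm). apply near2_imp. intros q Hq E.
    rewrite E in Hq. replace (0 - f p) with (- f p) in Hq by ring. rewrite Cmod_opp in Hq. lra. }
  generalize (near2_and _ _ _ (H _ _ _ (der2_fst p) Hx)
    (near2_and _ _ _ (H _ _ _ (der2_snd p) Hy) (H _ _ _ (der2_Delta p) HD))).
  apply near2_imp. intros q. unfold regular. tauto.
Qed.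

Section Connection.

Variables a b c1 c2 : C.
Let m := a * b.
Let g := a + b + 1.
Let h := / RtoC 2.

(** The difference of the two equations is x F_xx - y F_yy + c1 F_x - c2 F_y = 0. Solved for F_yy it
    gives [w1], [w2], [w3]; inserted into either equation it gives F_xy with the coefficients [q0]
    to [q3]. *)
Definition q0 : rexp := (Cst (- m * h) * (IX * IY))%rexp.
Definition q1 : rexp :=
  (Cst h * (Cst c1 + Cst (- c1) * VY + Cst (- g) * VX) * (IX * IY))%rexp.
Definition q2 : rexp := (Cst ((c2 - g) * h) * IX)%rexp.
Definition q3 : rexp := (Cst h * (Cst 1 + Cst (-(1)) * VX + Cst (-(1)) * VY) * IY)%rexp.

Definition w1 : rexp := (Cst c1 * IY)%rexp.
Definition w2 : rexp := (Cst (- c2) * IY)%rexp.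
Definition w3 : rexp := (VX * IY)%rexp.

Definition Y1 : rexp := (Cst 1 + Cst (-(1)) * VY)%rexp.

(* The row r is solved from the compatibility d(F_xy)/dy = d(F_yy)/dx, where F_xxx occurs with
   coefficient - Delta / (4 y^2). *)
Definition r0 : rexp :=
  (IX * IX * ID * (Cst (m * h) * (Cst (c2 + 2 * c1 - g - 2) * Y1 + Cst (3 * c2 - g - 2) * VX)))%rexp.
Definition r1 : rexp :=
  (IX * IX * ID * (Cst h * (Cst (c1 * (2 - c2 - 2 * c1 + g)) * (Y1 * Y1)
    + VX * (Cst (c1 * (2 - 3 * c2 + 3 * g)) + Cst (c1 * (2 - c2 + g)) * VY
            + Cst (g * c2 - g * g + 2 * m) * Y1)
    + Cst (3 * g * c2 - 4 * g - g * g - 2 * m) * (VX * VX))))%rexp.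
Definition r2 : rexp :=
  (IX * IX * ID * (Cst h * (VY *
     (Cst (2 * c2 - c2 * c2 - 2 * c1 * c2 - 2 * g + 2 * g * c2 + 2 * g * c1 - g * g) * Y1
      + Cst (c2 * c2 - 2 * c2 + 2 * g - g * g + 4 * m) * VX))))%rexp.
Definition r3 : rexp :=
  (IX * ID * (Cst h * (Cst (g - c2 - 4 * c1) * (Y1 * Y1)
     + Cst (2 * (3 - c2 + 2 * c1 + g)) * (VX * (Cst 1 + VY))
     + Cst (3 * c2 - 3 * g - 6) * (VX * VX))))%rexp.

(** F_xxy as the x-derivative of F_xy, where F_xy and F_xxx are reduced by the rows q and r. *)
Definition s0 : rexp := (dX q0 + q2 * q0 + q3 * r0)%rexp.
Definition s1 : rexp := (dX q1 + q0 + q2 * q1 + q3 * r1)%rexp.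
Definition s2 : rexp := (dX q2 + q2 * q2 + q3 * r2)%rexp.
Definition s3 : rexp := (dX q3 + q1 + q2 * q3 + q3 * r3)%rexp.

Lemma C2_neq0 : RtoC 2 <> 0.
Proof. intros E. apply RtoC_inj in E. lra. Qed.

Ltac rexp_field := intros (Hx & Hy & HD); 
  cbn [ev dX dY q0 q1 q2 q3 w1 w2 w3 r0 r1 r2 r3 s0 s1 s2 s3 Y1];
  unfold Delta in *; unfold m, g, h; field; repeat split; auto using C2_neq0.

(** The derivations have to commute on the four basis elements. On F this is clear and on F_x it is
    the definition of s. There remain F_y, where the x-derivative of F_yy is compared with the
    y-derivative of F_xy, and F_xx, where the x-derivative of F_xxy is compared with the
    y-derivative of F_xxx. *)
Lemma compat_y0 (p : C * C) : regular p ->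
  ev (w2 * q0 + w3 * r0) p = ev (dY q0 + q1 * q0 + q3 * s0) p.
Proof. rexp_field. Qed.

Lemma compat_y1 (p : C * C) : regular p ->
  ev (dX w1 + w2 * q1 + w3 * r1) p = ev (dY q1 + q1 * q1 + q2 * w1 + q3 * s1) p.
Proof. rexp_field. Qed.

Lemma compat_y2 (p : C * C) : regular p ->
  ev (dX w2 + w2 * q2 + w3 * r2) p = ev (dY q2 + q0 + q1 * q2 + q2 * w2 + q3 * s2) p.
Proof. rexp_field. Qed.

Lemma compat_y3 (p : C * C) : regular p ->
  ev (dX w3 + w1 + w2 * q3 + w3 * r3) p = ev (dY q3 + q1 * q3 + q2 * w3 + q3 * s3) p.
Proof. rexp_field. Qed.

Lemma compat_xx0 (p : C * C) : regular p ->
  ev (dX s0 + s2 * q0 + s3 * r0) p = ev (dY r0 + r1 * q0 + r3 * s0) p.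
Proof. rexp_field. Qed.

Lemma compat_xx1 (p : C * C) : regular p ->
  ev (dX s1 + s0 + s2 * q1 + s3 * r1) p = ev (dY r1 + r1 * q1 + r2 * w1 + r3 * s1) p.
Proof. rexp_field. Qed.

Lemma compat_xx2 (p : C * C) : regular p ->
  ev (dX s2 + s2 * q2 + s3 * r2) p = ev (dY r2 + r0 + r1 * q2 + r2 * w2 + r3 * s2) p.
Proof. rexp_field. Qed.

Lemma compat_xx3 (p : C * C) : regular p ->
  ev (dX s3 + s1 + s2 * q3 + s3 * r3) p = ev (dY r3 + r1 * q3 + r2 * w3 + r3 * s3) p.
Proof. rexp_field. Qed.

(* [Vec u0 u1 u2 u3] stands for [u0 F + u1 F_x + u2 F_y + u3 F_xx]; [nx] and [ny] are its
   partial derivatives, reduced by F_xy = q, F_yy = w, F_xxx = r, F_xxy = s. *)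
Record vec := Vec { u0 : rexp; u1 : rexp; u2 : rexp; u3 : rexp }.

Definition nx (v : vec) : vec :=
  Vec (dX (u0 v) + u2 v * q0 + u3 v * r0)
      (dX (u1 v) + u0 v + u2 v * q1 + u3 v * r1)
      (dX (u2 v) + u2 v * q2 + u3 v * r2)
      (dX (u3 v) + u1 v + u2 v * q3 + u3 v * r3).

Definition ny (v : vec) : vec :=
  Vec (dY (u0 v) + u1 v * q0 + u3 v * s0)
      (dY (u1 v) + u1 v * q1 + u2 v * w1 + u3 v * s1)
      (dY (u2 v) + u0 v + u1 v * q2 + u2 v * w2 + u3 v * s2)
      (dY (u3 v) + u1 v * q3 + u2 v * w3 + u3 v * s3).

Definition veq (v v' : vec) : Prop := forall p, regular p ->
  ev (u0 v) p = ev (u0 v') p /\ ev (u1 v) p = ev (u1 v') p /\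
  ev (u2 v) p = ev (u2 v') p /\ ev (u3 v) p = ev (u3 v') p.

Lemma veq_trans (u v w : vec) : veq u v -> veq v w -> veq u w.
Proof.
  intros H1 H2 p Hp. destruct (H1 p Hp) as (A0 & A1 & A2 & A3).
  destruct (H2 p Hp) as (B0 & B1 & B2 & B3). repeat split; congruence.
Qed.

(** Different expressions may have the same values; their formal derivatives still agree, because at
    regular points [dX] computes the partial derivative of [ev] and regular points form an open
    set. *)
Lemma dX_congr (e f : rexp) : (forall p, regular p -> ev e p = ev f p) ->
  forall p, regular p -> ev (dX e) p = ev (dX f) p.
Proof.
  intros H p Hp.
  rewrite <- (der2_Dx _ _ _ _ (ev_der2 e p Hp)), <- (der2_Dx _ _ _ _ (ev_der2 f p Hp)).
  apply Dx_ext. generalize (regular_near p Hp). now apply near2_imp.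
Qed.

Lemma nx_congr (v v' : vec) : veq v v' -> veq (nx v) (nx v').
Proof.
  intros H p Hp. destruct (H p Hp) as (A0 & A1 & A2 & A3). simpl.
  rewrite (dX_congr (u0 v) (u0 v')), (dX_congr (u1 v) (u1 v')),
    (dX_congr (u2 v) (u2 v')), (dX_congr (u3 v) (u3 v')); auto;
    try (intros q Hq; destruct (H q Hq) as (B0 & B1 & B2 & B3); assumption).
  now rewrite A0, A1, A2, A3.
Qed.

Lemma ny_nx (v : vec) : veq (ny (nx v)) (nx (ny v)).
Proof.
  intros p Hp.
  pose proof (compat_y0 p Hp) as Y0. pose proof (compat_y1 p Hp) as Y1'.
  pose proof (compat_y2 p Hp) as Y2. pose proof (compat_y3 p Hp) as Y3.
  pose proof (compat_xx0 p Hp) as X0. pose proof (compat_xx1 p Hp) as X1.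
  pose proof (compat_xx2 p Hp) as X2. pose proof (compat_xx3 p Hp) as X3.
  destruct v as [v0 v1 v2 v3].
  pose proof (dX_dY v0 p) as D0. pose proof (dX_dY v1 p) as D1.
  pose proof (dX_dY v2 p) as D2. pose proof (dX_dY v3 p) as D3.
  cbn [ev] in *.
  assert (S0 : ev s0 p = ev (dX q0) p + ev q2 p * ev q0 p + ev q3 p * ev r0 p) by reflexivity.
  assert (S1 : ev s1 p = ev (dX q1) p + ev q0 p + ev q2 p * ev q1 p + ev q3 p * ev r1 p)
    by reflexivity.
  assert (S2 : ev s2 p = ev (dX q2) p + ev q2 p * ev q2 p + ev q3 p * ev r2 p) by reflexivity.
  assert (S3 : ev s3 p = ev (dX q3) p + ev q1 p + ev q2 p * ev q3 p + ev q3 p * ev r3 p)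
    by reflexivity.
  unfold nx, ny. cbn [u0 u1 u2 u3 ev dX dY]. rewrite D0, D1, D2, D3.
  (* The commutator of [nx] and [ny] at [v] is linear in [v]: each coordinate is the defect of the
     relation for F_y times the F_y coordinate plus the defect of the relation for F_xx times the
     F_xx coordinate. *)
  assert (K : forall A B L R L' R' x y : C, L = R -> L' = R' ->
    B = A + x * (L - R) + y * (L' - R') -> A = B).
  { intros A B L R L' R' x y -> -> ->. ring. }
  repeat split.
  - apply (K _ _ _ _ _ _ (ev v2 p) (ev v3 p) Y0 X0). rewrite ?S0, ?S1, ?S2, ?S3. ring.
  - apply (K _ _ _ _ _ _ (ev v2 p) (ev v3 p) Y1' X1). rewrite ?S0, ?S1, ?S2, ?S3. ring.
  - apply (K _ _ _ _ _ _ (ev v2 p) (ev v3 p) Y2 X2). rewrite ?S0, ?S1, ?S2, ?S3. ring.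
  - apply (K _ _ _ _ _ _ (ev v2 p) (ev v3 p) Y3 X3). rewrite ?S0, ?S1, ?S2, ?S3. ring.
Qed.

Definition e00 : vec := Vec (Cst 1) (Cst 0) (Cst 0) (Cst 0).

(** The normal form of the derivative of order i in x and j in y. The y-derivatives are taken first,
    so raising i is a conversion and raising j is [ny_jet]. *)
Definition jet (i j : nat) : vec := Nat.iter i nx (Nat.iter j ny e00).

Lemma ny_jet (i j : nat) : veq (ny (jet i j)) (jet i (S j)).
Proof.
  induction i as [|i IH].
  - intros p _. auto.
  - eapply veq_trans; [apply ny_nx|]. now apply nx_congr.
Qed.

End Connection.

(** * Consequences of the F4 system *)

Fixpoint csum (f : nat -> C) (n : nat) : C :=
  match n with O => 0 | S k => csum f k + f k end.

Lemma csum_ext (f g : nat -> C) (n : nat) :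
  (forall i, (i < n)%nat -> f i = g i) -> csum f n = csum g n.
Proof. induction n as [|n IH]; simpl; intros H; auto. rewrite IH, H; auto. Qed.

Lemma csum_zero (f : nat -> C) (n : nat) : (forall i, (i < n)%nat -> f i = 0) -> csum f n = 0.
Proof. induction n as [|n IH]; simpl; intros H; auto. rewrite IH, H; auto. ring. Qed.

Lemma csum_plus (f g : nat -> C) (n : nat) :
  csum (fun i => f i + g i) n = csum f n + csum g n.
Proof. induction n as [|n IH]; simpl; [ring|rewrite IH; ring]. Qed.

Lemma csum_mult_r (f : nat -> C) (k : C) (n : nat) :
  csum (fun i => f i * k) n = csum f n * k.
Proof. induction n as [|n IH]; simpl; [ring|rewrite IH; ring]. Qed.

Lemma csum_shift (f : nat -> C) (n : nat) :
  csum (fun i => match i with O => 0 | S k => f k end) (S n) = csum f n.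
Proof. induction n as [|n IH]; [simpl; ring|]. simpl in *. now rewrite IH. Qed.

Lemma csum_support (f : nat -> C) (m n : nat) : (m <= n)%nat ->
  (forall i, (m <= i)%nat -> f i = 0) -> csum f n = csum f m.
Proof. intros Hmn H. induction Hmn; auto. simpl. rewrite IHHmn, H; auto. ring. Qed.

Lemma der2_csum (f : nat -> C * C -> C) (l1 l2 : nat -> C) (n : nat) (p : C * C) :
  (forall i, (i < n)%nat -> der2 (f i) p (l1 i) (l2 i)) ->
  der2 (fun q => csum (fun i => f i q) n) p (csum l1 n) (csum l2 n).
Proof.
  induction n as [|n IH]; simpl; intros H.
  - apply der2_const.
  - apply der2_plus; auto.
Qed.

Definition csum2 (f : nat -> nat -> C) (n : nat) : C := csum (fun i => csum (f i) n) n.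

Lemma csum2_ext (f g : nat -> nat -> C) (n : nat) :
  (forall i j, (i < n)%nat -> (j < n)%nat -> f i j = g i j) -> csum2 f n = csum2 g n.
Proof. intros H. apply csum_ext. intros i Hi. apply csum_ext. auto. Qed.

Lemma csum2_plus (f g : nat -> nat -> C) (n : nat) :
  csum2 (fun i j => f i j + g i j) n = csum2 f n + csum2 g n.
Proof.
  unfold csum2. rewrite <- csum_plus. apply csum_ext. intros i _. apply csum_plus.
Qed.

Lemma csum2_mult_r (f : nat -> nat -> C) (k : C) (n : nat) :
  csum2 (fun i j => f i j * k) n = csum2 f n * k.
Proof.
  unfold csum2. rewrite <- csum_mult_r. apply csum_ext. intros i _. apply csum_mult_r.
Qed.

Lemma csum2_support (f : nat -> nat -> C) (m n : nat) : (m <= n)%nat ->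
  (forall i j, (m <= i \/ m <= j)%nat -> f i j = 0) -> csum2 f n = csum2 f m.
Proof.
  intros Hmn H. unfold csum2.
  rewrite (csum_support (fun i => csum (f i) n) m n Hmn).
  - apply csum_ext. intros i _. apply csum_support; auto.
  - intros i Hi. apply csum_zero. auto.
Qed.

Lemma csum2_shift_l (f : nat -> nat -> C) (n : nat) : (forall j, f n j = 0) ->
  csum2 (fun i j => match i with O => 0 | S k => f k j end) (S n) = csum2 f (S n).
Proof.
  intros H. unfold csum2.
  rewrite (csum_ext _ (fun i => match i with O => 0 | S k => csum (f k) (S n) end)).
  - rewrite csum_shift. symmetry.
    change (csum (fun i => csum (f i) (S n)) n + csum (f n) (S n) =
            csum (fun k => csum (f k) (S n)) n).
    rewrite (csum_zero (f n)); auto. ring.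
  - intros [|i] _; auto. apply csum_zero. auto.
Qed.

Lemma csum2_shift_r (f : nat -> nat -> C) (n : nat) : (forall i, f i n = 0) ->
  csum2 (fun i j => match j with O => 0 | S k => f i k end) (S n) = csum2 f (S n).
Proof.
  intros H. apply csum_ext. intros i _. rewrite csum_shift. simpl. rewrite H. ring.
Qed.

Lemma der2_csum2 (f : nat -> nat -> C * C -> C) (l1 l2 : nat -> nat -> C) (n : nat) (p : C * C) :
  (forall i j, der2 (f i j) p (l1 i j) (l2 i j)) ->
  der2 (fun q => csum2 (fun i j => f i j q) n) p (csum2 l1 n) (csum2 l2 n).
Proof.
  intros H. apply (der2_csum (fun i q => csum (fun j => f i j q) n)). intros i _.
  apply (der2_csum (fun j q => f i j q)). auto.
Qed.

Definition comp (k : nat) (v : vec) : rexp :=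
  match k with 0%nat => u0 v | 1%nat => u1 v | 2%nat => u2 v | _ => u3 v end.

(** * Reduction of the consequences to normal form *)

Section Consequences.

Variables (a b c1 c2 : C) (Om : C * C -> Prop).
Hypothesis HOm : C2_open Om.

Definition jc (i j k : nat) (p : C * C) : C := ev (comp k (jet a b c1 c2 i j)) p.

Definition pairing (n : nat) (P : pde) (k : nat) (p : C * C) : C :=
  csum2 (fun i j => P i j p * jc i j k p) n.

Definition supported (n : nat) (P : pde) : Prop :=
  forall i j p, Om p -> (n <= i \/ n <= j)%nat -> P i j p = 0.

(* [pairing n P] gives the coordinates of the class of the operator [P] in the rank 4 quotient module. *)
Definition reduces_to_zero (P : pde) : Prop :=
  (forall i j, holomorphic2_on Om (P i j)) /\
  exists n, supported n P /\
    forall k p, Om p -> regular p -> pairing n P k p = 0.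

Lemma pairing_enlarge (P : pde) (m n k : nat) (p : C * C) :
  supported m P -> (m <= n)%nat -> Om p -> pairing n P k p = pairing m P k p.
Proof.
  intros HP Hmn Hp. apply csum2_support; auto. intros i j Hij. rewrite HP by auto. ring.
Qed.

Lemma der2_pairing (n : nat) (P : pde) (k : nat) (p : C * C) :
  (forall i j, holomorphic2_on Om (P i j)) -> Om p -> regular p ->
  der2 (pairing n P k) p
   (csum2 (fun i j => Dx (P i j) p * jc i j k p +
      P i j p * ev (dX (comp k (jet a b c1 c2 i j))) p) n)
   (csum2 (fun i j => Dy (P i j) p * jc i j k p +
      P i j p * ev (dY (comp k (jet a b c1 c2 i j))) p) n).
Proof.
  intros HP Hp Hr. apply (der2_csum2 (fun i j q => P i j q * jc i j k q)). intros i j.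
  apply der2_mult.
  - now apply (holomorphic2_der2 Om).
  - now apply ev_der2.
Qed.

Lemma near2_zero_partials (f : C * C -> C) (p : C * C) (l1 l2 : C) :
  near2 p (fun q => f q = 0) -> der2 f p l1 l2 -> l1 = 0 /\ l2 = 0.
Proof.
  intros H0 H. rewrite <- (der2_Dx _ _ _ _ H), <- (der2_Dy _ _ _ _ H).
  rewrite (Dx_ext _ _ _ H0), (Dy_ext _ _ _ H0).
  split; [exact (der2_Dx _ _ _ _ (der2_const 0 p))|exact (der2_Dy _ _ _ _ (der2_const 0 p))].
Qed.

Lemma near2_regular (p : C * C) : Om p -> regular p -> near2 p (fun q => Om q /\ regular q).
Proof. intros Hp Hr. apply near2_and; [now apply near2_open|now apply regular_near]. Qed.

(** [nx] differentiates the coordinates and adds the terms of the connection matrix. These terms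
    contribute combinations of the pairings themselves, which vanish at [p]. *)
Lemma pairing_nx (n : nat) (P : pde) (k : nat) (p : C * C) :
  (forall l, pairing n P l p = 0) ->
  csum2 (fun i j => P i j p * jc (S i) j k p) n =
  csum2 (fun i j => P i j p * ev (dX (comp k (jet a b c1 c2 i j))) p) n.
Proof.
  intros H. unfold pairing in *.
  set (A := fun l i j => P i j p * jc i j l p) in *.
  set (B := fun i j => P i j p * ev (dX (comp k (jet a b c1 c2 i j))) p).
  assert (Z : forall l x, (l < 4)%nat -> csum2 (fun i j => A l i j * x) n = 0).
  { intros l x Hl. rewrite csum2_mult_r. unfold A. rewrite H. ring. }
  destruct k as [|[|[|k]]].
  - rewrite (csum2_ext _ (fun i j => B i j + A 2%nat i j * ev (q0 a b) p +
      A 3%nat i j * ev (r0 a b c1 c2) p)).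
    + rewrite !csum2_plus, !Z by lia. ring.
    + intros i j _ _. unfold A, B, jc, jet. simpl. ring.
  - rewrite (csum2_ext _ (fun i j => B i j + A 0%nat i j * 1 + A 2%nat i j * ev (q1 a b c1) p +
      A 3%nat i j * ev (r1 a b c1 c2) p)).
    + rewrite !csum2_plus, !Z by lia. ring.
    + intros i j _ _. unfold A, B, jc, jet. simpl. ring.
  - rewrite (csum2_ext _ (fun i j => B i j + A 2%nat i j * ev (q2 a b c2) p +
      A 3%nat i j * ev (r2 a b c1 c2) p)).
    + rewrite !csum2_plus, !Z by lia. ring.
    + intros i j _ _. unfold A, B, jc, jet. simpl. ring.
  - rewrite (csum2_ext _ (fun i j => B i j + A 1%nat i j * 1 + A 2%nat i j * ev q3 p +
      A 3%nat i j * ev (r3 a b c1 c2) p)).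
    + rewrite !csum2_plus, !Z by lia. ring.
    + intros i j _ _. unfold A, B, jc, jet. simpl. ring.
Qed.

Lemma pairing_ny (n : nat) (P : pde) (k : nat) (p : C * C) : regular p ->
  (forall l, pairing n P l p = 0) ->
  csum2 (fun i j => P i j p * jc i (S j) k p) n =
  csum2 (fun i j => P i j p * ev (dY (comp k (jet a b c1 c2 i j))) p) n.
Proof.
  intros Hr H. unfold pairing in *.
  set (A := fun l i j => P i j p * jc i j l p) in *.
  set (B := fun i j => P i j p * ev (dY (comp k (jet a b c1 c2 i j))) p).
  assert (Z : forall l x, (l < 4)%nat -> csum2 (fun i j => A l i j * x) n = 0).
  { intros l x Hl. rewrite csum2_mult_r. unfold A. rewrite H. ring. }
  (* The point where integrability is used: the y-derivative has to pass the [i] derivatives in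
     x. *)
  assert (J : forall i j, jc i (S j) k p = ev (comp k (ny a b c1 c2 (jet a b c1 c2 i j))) p).
  { intros i j. destruct (ny_jet a b c1 c2 i j p Hr) as (N0 & N1 & N2 & N3).
    unfold jc. destruct k as [|[|[|k]]]; cbn [comp]; auto. }
  destruct k as [|[|[|k]]].
  - rewrite (csum2_ext _ (fun i j => B i j + A 1%nat i j * ev (q0 a b) p +
      A 3%nat i j * ev (s0 a b c1 c2) p)).
    + rewrite !csum2_plus, !Z by lia. ring.
    + intros i j _ _. rewrite J. unfold A, B, jc. simpl. ring.
  - rewrite (csum2_ext _ (fun i j => B i j + A 1%nat i j * ev (q1 a b c1) p +
      A 2%nat i j * ev (w1 c1) p + A 3%nat i j * ev (s1 a b c1 c2) p)).
    + rewrite !csum2_plus, !Z by lia. ring.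
    + intros i j _ _. rewrite J. unfold A, B, jc. simpl. ring.
  - rewrite (csum2_ext _ (fun i j => B i j + A 0%nat i j * 1 + A 1%nat i j * ev (q2 a b c2) p +
      A 2%nat i j * ev (w2 c2) p + A 3%nat i j * ev (s2 a b c1 c2) p)).
    + rewrite !csum2_plus, !Z by lia. ring.
    + intros i j _ _. rewrite J. unfold A, B, jc. simpl. ring.
  - rewrite (csum2_ext _ (fun i j => B i j + A 1%nat i j * ev q3 p +
      A 2%nat i j * ev w3 p + A 3%nat i j * ev (s3 a b c1 c2) p)).
    + rewrite !csum2_plus, !Z by lia. ring.
    + intros i j _ _. rewrite J. unfold A, B, jc. simpl. ring.
Qed.

(** The pairing vanishes near every regular point, hence so does its x-derivative. [pairing_nx]
    turns the derivatives of the normal forms into normal forms of derivatives, and after a shift of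
    the index the result is the pairing of [pde_dx P]. *)
Lemma reduces_dx (P : pde) : reduces_to_zero P -> reduces_to_zero (pde_dx P).
Proof.
  intros [HP [n [Hs Hn]]]. split.
  - intros i j. apply (holomorphic2_plus Om HOm); [now apply holomorphic2_Dx|].
    destruct i; [now apply holomorphic2_const|apply HP].
  - exists (S n). split.
    + intros i j p Hp Hij. unfold pde_dx.
      rewrite (Dx_ext _ (fun _ => 0)).
      * rewrite (der2_Dx _ _ _ _ (der2_const 0 p)).
        destruct i; [ring|]. rewrite Hs by (auto; lia). ring.
      * generalize (near2_open _ _ HOm Hp). apply near2_imp. intros q Hq.
        apply Hs; auto. lia.
    + intros k p Hp Hr.
      assert (HN : forall l q, Om q -> regular q -> pairing (S n) P l q = 0).
      { intros l q Hq Hrq. rewrite (pairing_enlarge P n); auto. }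
      assert (Hz : near2 p (fun q => pairing (S n) P k q = 0)).
      { generalize (near2_regular p Hp Hr). apply near2_imp. intros q []; auto. }
      destruct (near2_zero_partials _ _ _ _ Hz (der2_pairing (S n) P k p HP Hp Hr)) as [E _].
      rewrite csum2_plus, <- pairing_nx in E by auto.
      rewrite <- (csum2_shift_l (fun i j => P i j p * jc (S i) j k p)) in E
        by (intros j; rewrite Hs by auto; ring).
      rewrite <- csum2_plus in E. rewrite <- E. apply csum2_ext. intros i j _ _.
      unfold pde_dx. destruct i; ring.
Qed.

Lemma reduces_dy (P : pde) : reduces_to_zero P -> reduces_to_zero (pde_dy P).
Proof.
  intros [HP [n [Hs Hn]]]. split.
  - intros i j. apply (holomorphic2_plus Om HOm); [now apply holomorphic2_Dy|].
    destruct j; [now apply holomorphic2_const|apply HP].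
  - exists (S n). split.
    + intros i j p Hp Hij. unfold pde_dy.
      rewrite (Dy_ext _ (fun _ => 0)).
      * rewrite (der2_Dy _ _ _ _ (der2_const 0 p)).
        destruct j; [ring|]. rewrite Hs by (auto; lia). ring.
      * generalize (near2_open _ _ HOm Hp). apply near2_imp. intros q Hq.
        apply Hs; auto. lia.
    + intros k p Hp Hr.
      assert (HN : forall l q, Om q -> regular q -> pairing (S n) P l q = 0).
      { intros l q Hq Hrq. rewrite (pairing_enlarge P n); auto. }
      assert (Hz : near2 p (fun q => pairing (S n) P k q = 0)).
      { generalize (near2_regular p Hp Hr). apply near2_imp. intros q []; auto. }
      destruct (near2_zero_partials _ _ _ _ Hz (der2_pairing (S n) P k p HP Hp Hr)) as [_ E].
      rewrite csum2_plus, <- pairing_ny in E by auto.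
      rewrite <- (csum2_shift_r (fun i j => P i j p * jc i (S j) k p)) in E
        by (intros i; rewrite Hs by auto; ring).
      rewrite <- csum2_plus in E. rewrite <- E. apply csum2_ext. intros i j _ _.
      unfold pde_dy. destruct j; ring.
Qed.

Lemma reduces_add (P Q : pde) :
  reduces_to_zero P -> reduces_to_zero Q -> reduces_to_zero (pde_add P Q).
Proof.
  intros [HP [n [Hs Hn]]] [HQ [m [Ht Hm]]]. split.
  - intros i j. now apply (holomorphic2_plus Om HOm).
  - exists (max n m). split.
    + intros i j p Hp Hij. unfold pde_add. rewrite Hs, Ht by (auto; lia). ring.
    + intros k p Hp Hr.
      transitivity (pairing (max n m) P k p + pairing (max n m) Q k p).
      * unfold pairing. rewrite <- csum2_plus. apply csum2_ext. intros i j _ _.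
        unfold pde_add. ring.
      * rewrite (pairing_enlarge P n), (pairing_enlarge Q m), Hn, Hm by (auto; lia). ring.
Qed.

Lemma pairing_mul (f : C * C -> C) (P : pde) (n k : nat) (p : C * C) :
  pairing n (pde_mul f P) k p = pairing n P k p * f p.
Proof.
  unfold pairing. rewrite <- csum2_mult_r. apply csum2_ext. intros i j _ _.
  unfold pde_mul. ring.
Qed.

Lemma reduces_mul (f : C * C -> C) (P : pde) :
  holomorphic2_on Om f -> reduces_to_zero P -> reduces_to_zero (pde_mul f P).
Proof.
  intros Hf [HP [n [Hs Hn]]]. split.
  - intros i j. now apply (holomorphic2_mult Om HOm).
  - exists n. split.
    + intros i j p Hp Hij. unfold pde_mul. rewrite Hs by auto. ring.
    + intros k p Hp Hr. rewrite pairing_mul, Hn by auto. ring.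
Qed.

(** If h p were not 0, then [h] would have no zero on a neighbourhood of [p], and [f] would vanish
    on an open set. *)
Lemma cont2_zero_of_dense (f h : C * C -> C) (p : C * C) :
  (forall W, C2_open W -> (forall p, W p -> Om p) -> (exists p, W p) ->
     exists p, W p /\ f p <> 0) ->
  Om p -> cont2 h p -> near2 p (fun q => h q * f q = 0) -> h p = 0.
Proof.
  intros Hf Hp Hh Hz. apply NNPP. intros Hn.
  pose proof (proj1 (Cmod_gt_0 _) Hn) as Hm.
  assert (Hnz : near2 p (fun q => (Om q /\ h q * f q = 0) /\ h q <> 0)).
  { apply near2_and; [apply near2_and; auto; now apply near2_open|].
    generalize (Hh _ Hm). apply near2_imp. intros q Hq E.
    rewrite E in Hq. replace (0 - h p) with (- h p) in Hq by ring. rewrite Cmod_opp in Hq. lra. }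
  set (W := fun q => near2 q (fun q => (Om q /\ h q * f q = 0) /\ h q <> 0)).
  destruct (Hf W) as [q [Hq Hfq]].
  - apply open_near2. intros q. apply near2_near2.
  - intros q Hq. apply (near2_at _ _ Hq).
  - now exists p.
  - destruct (near2_at _ _ Hq) as [[_ E] Hhq]. now apply (Cmult_neq_0 (h q) (f q)).
Qed.

(** At zeros of [f] both the bound on the order and the vanishing of the pairing are recovered by
    continuity. *)
Lemma reduces_div (f : C * C -> C) (P : pde) :
  (forall i j, holomorphic2_on Om (P i j)) ->
  (forall W, C2_open W -> (forall p, W p -> Om p) -> (exists p, W p) ->
     exists p, W p /\ f p <> 0) ->
  reduces_to_zero (pde_mul f P) -> reduces_to_zero P.
Proof.
  intros HP Hf [_ [n [Hs Hn]]]. split; auto. exists n. split.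
  - intros i j p Hp Hij. apply (cont2_zero_of_dense f (P i j) p Hf Hp).
    + eapply der2_cont. now apply (holomorphic2_der2 Om).
    + generalize (near2_open _ _ HOm Hp). apply near2_imp. intros q Hq.
      rewrite Cmult_comm. now apply (Hs i j q).
  - intros k p Hp Hr. apply (cont2_zero_of_dense f (pairing n P k) p Hf Hp).
    + eapply der2_cont. now apply der2_pairing.
    + generalize (near2_regular p Hp Hr). apply near2_imp. intros q [Hq Hrq].
      rewrite <- pairing_mul. auto.
Qed.

Lemma reduces_ext (P Q : pde) :
  (forall i j p, Om p -> P i j p = Q i j p) -> reduces_to_zero P -> reduces_to_zero Q.
Proof.
  intros E [HP [n [Hs Hn]]]. split.
  - intros i j. apply (holomorphic2_ext Om HOm (P i j)); auto.
  - exists n. split.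
    + intros i j p Hp Hij. rewrite <- E by auto. auto.
    + intros k p Hp Hr. rewrite <- (Hn k p Hp Hr). apply csum2_ext. intros i j _ _.
      now rewrite E.
Qed.

Lemma pairing_order2 (P : pde) (k : nat) (p : C * C) :
  (forall i j, (2 < i + j)%nat -> P i j p = 0) ->
  pairing 3 P k p = P 0%nat 0%nat p * jc 0 0 k p + P 1%nat 0%nat p * jc 1 0 k p
    + P 0%nat 1%nat p * jc 0 1 k p + P 2%nat 0%nat p * jc 2 0 k p
    + P 1%nat 1%nat p * jc 1 1 k p + P 0%nat 2%nat p * jc 0 2 k p.
Proof.
  intros H. unfold pairing, csum2. cbn [csum].
  rewrite (H 1%nat 2%nat), (H 2%nat 1%nat), (H 2%nat 2%nat) by lia. ring.
Qed.

Lemma jc_values (p : C * C) :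
  (jc 0 0 0 p = 1 /\ jc 0 0 1 p = 0 /\ jc 0 0 2 p = 0 /\ jc 0 0 3 p = 0) /\
  (jc 1 0 0 p = 0 /\ jc 1 0 1 p = 1 /\ jc 1 0 2 p = 0 /\ jc 1 0 3 p = 0) /\
  (jc 0 1 0 p = 0 /\ jc 0 1 1 p = 0 /\ jc 0 1 2 p = 1 /\ jc 0 1 3 p = 0) /\
  (jc 2 0 0 p = 0 /\ jc 2 0 1 p = 0 /\ jc 2 0 2 p = 0 /\ jc 2 0 3 p = 1) /\
  (jc 1 1 0 p = ev (q0 a b) p /\ jc 1 1 1 p = ev (q1 a b c1) p /\
   jc 1 1 2 p = ev (q2 a b c2) p /\ jc 1 1 3 p = ev q3 p) /\
  (jc 0 2 0 p = 0 /\ jc 0 2 1 p = ev (w1 c1) p /\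
   jc 0 2 2 p = ev (w2 c2) p /\ jc 0 2 3 p = ev w3 p).
Proof.
  unfold jc, jet.
  cbn [Nat.iter nat_rect comp nx ny u0 u1 u2 u3 e00 ev dX dY].
  repeat split; ring.
Qed.

Lemma pairing_order2_values (P : pde) (p : C * C) : regular p ->
  (forall i j, (2 < i + j)%nat -> P i j p = 0) ->
  let x := fst p in let y := snd p in
  pairing 3 P 0 p = P 0%nat 0%nat p - P 1%nat 1%nat p * (a * b) / (2 * x * y) /\
  pairing 3 P 1 p = P 1%nat 0%nat p
     + P 1%nat 1%nat p * (c1 * (1 - y) - (a + b + 1) * x) / (2 * x * y)
     + P 0%nat 2%nat p * c1 / y /\
  pairing 3 P 2 p = P 0%nat 1%nat p + P 1%nat 1%nat p * (c2 - (a + b + 1)) / (2 * x)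
     - P 0%nat 2%nat p * c2 / y /\
  pairing 3 P 3 p = P 2%nat 0%nat p + P 1%nat 1%nat p * (1 - x - y) / (2 * y)
     + P 0%nat 2%nat p * x / y.
Proof.
  intros (Hx & Hy & HD) H x y.
  destruct (jc_values p) as ((A0 & A1 & A2 & A3) & (B0 & B1 & B2 & B3) & (D0 & D1 & D2 & D3)
    & (E0 & E1 & E2 & E3) & (F0 & F1 & F2 & F3) & (G0 & G1 & G2 & G3)).
  rewrite !pairing_order2 by auto.
  rewrite A0, A1, A2, A3, B0, B1, B2, B3, D0, D1, D2, D3, E0, E1, E2, E3, F0, F1, F2, F3,
    G0, G1, G2, G3.
  cbn [ev q0 q1 q2 q3 w1 w2 w3]. fold x. fold y.
  pose proof C2_neq0. fold x in Hx. fold y in Hy.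
  repeat split; field; auto.
Qed.

(** [comp] sends every index from 3 on to the last coordinate. *)
Lemma pairing_ge3 (n k : nat) (P : pde) (p : C * C) : pairing n P (S (S (S k))) p = pairing n P 3 p.
Proof. reflexivity. Qed.

Lemma order2_reduces (P : pde) :
  (forall i j, holomorphic2_on Om (P i j)) ->
  (forall i j p, (2 < i + j)%nat -> P i j p = 0) ->
  (forall k p, regular p -> (k < 4)%nat -> pairing 3 P k p = 0) -> reduces_to_zero P.
Proof.
  intros HP H2 H. split; auto. exists 3%nat. split.
  - intros i j p _ Hij. apply H2. lia.
  - intros k p _ Hr. destruct k as [|[|[|k]]]; [| | |rewrite pairing_ge3]; apply H; auto; lia.
Qed.

Lemma holomorphic2_opp (f : C * C -> C) :
  holomorphic2_on Om f -> holomorphic2_on Om (fun p => - f p).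
Proof.
  intros H. apply (holomorphic2_ext Om HOm (fun p => -(1) * f p)).
  - intros p _. ring.
  - apply (holomorphic2_mult Om HOm); auto. now apply holomorphic2_const.
Qed.

Ltac holo2 := cbv beta;
  match goal with
  | |- holomorphic2_on _ (fun _ => ?k) => exact (holomorphic2_const Om HOm k)
  | |- holomorphic2_on _ (fun p => fst p) => exact (holomorphic2_fst Om HOm)
  | |- holomorphic2_on _ (fun p => snd p) => exact (holomorphic2_snd Om HOm)
  | |- holomorphic2_on _ (fun p => Copp (@?f p)) => apply (holomorphic2_opp f); holo2
  | |- holomorphic2_on _ (fun p => Cplus (@?f p) (@?g p)) =>
      apply (holomorphic2_plus Om HOm f g); holo2
  | |- holomorphic2_on _ (fun p => Cmult (@?f p) (@?g p)) =>
      apply (holomorphic2_mult Om HOm f g); holo2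
  end.

Lemma system_reduces (P : pde) : F4_system a b c1 c2 P -> reduces_to_zero P.
Proof.
  pose proof C2_neq0.
  assert (Z : forall k : nat, (k < 4)%nat -> k = 0%nat \/ k = 1%nat \/ k = 2%nat \/ k = 3%nat) by lia.
  intros [->| ->]; apply order2_reduces.
  - intros i j. unfold F4_eq1, Cminus.
    destruct i as [|[|[|i]]]; destruct j as [|[|[|j]]]; cbv zeta; holo2.
  - intros i j p Hij.
    destruct i as [|[|[|i]]]; destruct j as [|[|[|j]]]; simpl in Hij; try lia; reflexivity.
  - intros k p Hr Hk.
    destruct (pairing_order2_values (F4_eq1 a b c1) p Hr) as (P0 & P1 & P2 & P3).
    { intros i j Hij.
      destruct i as [|[|[|i]]]; destruct j as [|[|[|j]]]; simpl in Hij; try lia; reflexivity. }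
    destruct Hr as (Hx & Hy & _).
    destruct (Z k Hk) as [->|[->|[->| ->]]]; [rewrite P0|rewrite P1|rewrite P2|rewrite P3];
      unfold F4_eq1; field; auto.
  - intros i j. unfold F4_eq2, Cminus.
    destruct i as [|[|[|i]]]; destruct j as [|[|[|j]]]; cbv zeta; holo2.
  - intros i j p Hij.
    destruct i as [|[|[|i]]]; destruct j as [|[|[|j]]]; simpl in Hij; try lia; reflexivity.
  - intros k p Hr Hk.
    destruct (pairing_order2_values (F4_eq2 a b c2) p Hr) as (P0 & P1 & P2 & P3).
    { intros i j Hij.
      destruct i as [|[|[|i]]]; destruct j as [|[|[|j]]]; simpl in Hij; try lia; reflexivity. }
    destruct Hr as (Hx & Hy & _).
    destruct (Z k Hk) as [->|[->|[->| ->]]]; [rewrite P0|rewrite P1|rewrite P2|rewrite P3];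
      unfold F4_eq2; field; auto.
Qed.

Theorem follows_reduces (P : pde) : follows Om (F4_system a b c1 c2) P -> reduces_to_zero P.
Proof.
  induction 1.
  - now apply system_reduces.
  - now apply reduces_add.
  - now apply reduces_mul.
  - now apply reduces_div with f.
  - now apply reduces_dx.
  - now apply reduces_dy.
  - now apply reduces_ext with P.
Qed.

(** The order is restricted at the single point [p]: a consequence is compared with an equation of
    order 2 on the curve and may have higher order elsewhere. *)
Theorem follows_order2 (P : pde) (p : C * C) :
  follows Om (F4_system a b c1 c2) P -> Om p -> regular p ->
  (forall i j, (2 < i + j)%nat -> P i j p = 0) ->
  let x := fst p in let y := snd p in
  P 0%nat 0%nat p - P 1%nat 1%nat p * (a * b) / (2 * x * y) = 0 /\
  P 1%nat 0%nat p + P 1%nat 1%nat p * (c1 * (1 - y) - (a + b + 1) * x) / (2 * x * y)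
     + P 0%nat 2%nat p * c1 / y = 0 /\
  P 0%nat 1%nat p + P 1%nat 1%nat p * (c2 - (a + b + 1)) / (2 * x)
     - P 0%nat 2%nat p * c2 / y = 0 /\
  P 2%nat 0%nat p + P 1%nat 1%nat p * (1 - x - y) / (2 * y) + P 0%nat 2%nat p * x / y = 0.
Proof.
  intros HF Hp Hr H2 x y. destruct (follows_reduces P HF) as [_ [n [Hs Hn]]].
  assert (E : forall k, pairing 3 P k p = 0).
  { intros k. rewrite <- (Hn k p Hp Hr). unfold pairing.
    (* The bound [n] holds on all of [Om], the bound 3 at [p]; both truncations agree with the one
       at [max n 3]. *)
    transitivity (csum2 (fun i j => P i j p * jc i j k p) (max n 3)).
    - symmetry. apply csum2_support; [lia|]. intros i j Hij. rewrite H2 by lia. ring.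
    - apply csum2_support; [lia|]. intros i j Hij. rewrite Hs by auto. ring. }
  destruct (pairing_order2_values P p Hr H2) as (P0 & P1 & P2 & P3).
  fold x in P0, P1, P2, P3. fold y in P0, P1, P2, P3.
  rewrite <- P0, <- P1, <- P2, <- P3. auto.
Qed.

End Consequences.

(** * The hypergeometric series *)

Definition cseries (f : nat -> C) (l : C) : Prop := @is_series C_AbsRing C_NormedModule f l.

Lemma cseries_plus (f g : nat -> C) (l m : C) :
  cseries f l -> cseries g m -> cseries (fun n => f n + g n) (l + m).
Proof. exact (@is_series_plus C_AbsRing C_NormedModule f g l m). Qed.

Lemma cseries_scal (k : C) (f : nat -> C) (l : C) :
  cseries f l -> cseries (fun n => k * f n) (k * l).
Proof. exact (@is_series_scal C_AbsRing C_NormedModule k f l). Qed.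

Lemma cseries_ext (f g : nat -> C) (l : C) :
  (forall n, f n = g n) -> cseries f l -> cseries g l.
Proof. exact (@is_series_ext C_AbsRing C_NormedModule f g l). Qed.

Lemma cseries_lim (f : nat -> C) (l : C) : cseries f l ->
  forall eps, (0 < eps)%R -> exists N, forall n, (N <= n)%nat ->
    (Cmod (sum_n f n - l) < eps)%R.
Proof.
  intros H eps Heps.
  destruct (H (fun w => (Cmod (w - l) < eps)%R)) as [N HN].
  - apply near_locally. exists eps. auto.
  - exists N. exact HN.
Qed.

Lemma cseries_unique (f : nat -> C) (l m : C) : cseries f l -> cseries f m -> l = m.
Proof.
  intros Hl Hm. apply NNPP. intros Hne.
  assert (Hd : (0 < Cmod (l - m))%R).
  { now apply Cmod_gt_0, Cminus_neq_0. }
  destruct (cseries_lim f l Hl (Cmod (l - m) / 2) ltac:(lra)) as [N1 H1].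
  destruct (cseries_lim f m Hm (Cmod (l - m) / 2) ltac:(lra)) as [N2 H2].
  specialize (H1 (max N1 N2) ltac:(lia)). specialize (H2 (max N1 N2) ltac:(lia)).
  set (s := sum_n f (max N1 N2)) in *.
  replace (l - m) with (- (s - l) + (s - m)) in Hd by ring.
  replace (l - m) with (- (s - l) + (s - m)) in H1, H2 by ring.
  pose proof (Cmod_triangle (- (s - l)) (s - m)) as T. rewrite Cmod_opp in T. lra.
Qed.

Lemma cseries_shift (f : nat -> C) (l : C) :
  cseries f l <-> cseries (fun n => f (S n)) (l - f O).
Proof.
  split; intros H.
  - apply (@is_series_incr_1 C_AbsRing C_NormedModule).
    replace (@plus C_NormedModule (l - f O) (f O)) with l; [exact H|].
    change (l = l - f O + f O). ring.
  - apply (@is_series_decr_1 C_AbsRing C_NormedModule). exact H.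
Qed.

Lemma cseries_bound (f : nat -> C) (b : nat -> R) (l : C) (B : R) :
  cseries f l -> (forall n, (Cmod (f n) <= b n)%R) -> is_series b B -> (Cmod l <= B)%R.
Proof.
  intros Hf Hb HB. apply le_epsilon. intros e He.
  destruct (cseries_lim f l Hf e He) as [N HN]. specialize (HN N (le_n N)).
  assert (Hs : forall n, (Cmod (sum_n f n) <= sum_n b n)%R).
  { induction n as [|n IH].
    - rewrite !sum_O. apply Hb.
    - rewrite !sum_Sn. eapply Rle_trans; [apply Cmod_triangle|].
      apply Rplus_le_compat; auto. }
  assert (Hpos : forall n, (0 <= b n)%R)
    by (intros n; eapply Rle_trans; [apply Cmod_ge_0|apply Hb]).
  assert (HsB : (sum_n b N <= B)%R).
  { apply (is_lim_seq_incr_compare (sum_n b) B); [exact HB|].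
    intros n. rewrite sum_Sn. unfold plus; simpl. specialize (Hpos (S n)). lra. }
  replace l with (- (sum_n f N - l) + sum_n f N) by ring.
  eapply Rle_trans; [apply Cmod_triangle|]. rewrite Cmod_opp.
  specialize (Hs N). lra.
Qed.

Lemma cseries_abs_ex (f : nat -> C) (b : nat -> R) :
  (forall n, (Cmod (f n) <= b n)%R) -> ex_series b -> exists l, cseries f l.
Proof.
  intros H Hb. exact (@ex_series_le C_AbsRing C_CompleteNormedModule f b H Hb).
Qed.

Lemma cseries_terms_bounded (f : nat -> C) (l : C) : cseries f l ->
  exists M, (0 <= M)%R /\ forall n, (Cmod (f n) <= M)%R.
Proof.
  intros H. destruct (cseries_lim f l H 1 Rlt_0_1) as [N HN].
  assert (Hfin : forall m, exists M, (0 <= M)%R /\ forall n, (n <= m)%nat -> (Cmod (f n) <= M)%R).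
  { induction m as [|m [M [HM IH]]].
    - exists (Cmod (f O)). split; [apply Cmod_ge_0|]. intros n Hn.
      replace n with O by lia. lra.
    - exists (Rmax M (Cmod (f (S m)))). split.
      + eapply Rle_trans; [exact HM|apply Rmax_l].
      + intros n Hn. destruct (Nat.eq_dec n (S m)) as [->|Hne]; [apply Rmax_r|].
        eapply Rle_trans; [apply IH; lia|apply Rmax_l]. }
  destruct (Hfin (S N)) as [M [HM HMb]]. exists (Rmax M 2). split.
  - eapply Rle_trans; [exact HM|apply Rmax_l].
  - intros n. destruct (Compare_dec.le_dec n (S N)) as [Hn|Hn].
    + eapply Rle_trans; [now apply HMb|apply Rmax_l].
    + eapply Rle_trans; [|apply Rmax_r]. destruct n as [|n]; [lia|].
      assert (E : f (S n) = (sum_n f (S n) - l) + - (sum_n f n - l)).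
      { rewrite sum_Sn. change (f (S n) = sum_n f n + f (S n) - l + - (sum_n f n - l)). ring. }
      rewrite E. eapply Rle_trans; [apply Cmod_triangle|]. rewrite Cmod_opp.
      pose proof (HN (S n) ltac:(lia)). pose proof (HN n ltac:(lia)). lra.
Qed.

(** * Termwise differentiation of power series *)

Definition dcoef (a : nat -> C) (n : nat) : C := RtoC (INR (S n)) * a (S n).

Definition sums_on_disc (a : nat -> C) (G : C -> C) : Prop :=
  forall z, (Cmod z < 1)%R -> cseries (fun n => z ^ n * a n) (G z).

Section Power_series.

Variables (a : nat -> C) (G : C -> C).
Hypothesis HG : sums_on_disc a G.

Let A (n : nat) : R := Cmod (a n).

(** The terms at a real point u < 1 are bounded, so for s < u the series of absolute values is
    dominated by a geometric series of ratio s / u. Its terms tend to 0, which excludes a radius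
    below s. Convergence of the derived series is thereby reduced to real power series. *)
Lemma abs_radius (rho : R) : (0 <= rho < 1)%R -> Rbar_lt rho (CV_radius A).
Proof.
  intros Hrho. set (s := ((rho + 1) / 2)%R).
  assert (Hs : (rho < s < 1)%R) by (unfold s; lra).
  apply Rbar_lt_le_trans with s; [simpl; lra|].
  apply Rbar_not_lt_le. intros Hlt.
  set (u := ((s + 1) / 2)%R). assert (Hu : (s < u < 1)%R) by (unfold u; lra).
  destruct (cseries_terms_bounded _ _ (HG (RtoC u) ltac:(rewrite Cmod_R, Rabs_pos_eq; lra)))
    as [M [HM Hb]].
  revert Hlt. replace s with (Rabs s) by (apply Rabs_pos_eq; lra). intros Hlt.
  apply (CV_disk_outside A s Hlt).
  apply ex_series_lim_0.
  apply (@ex_series_le R_AbsRing R_CompleteNormedModule _ (fun n => M * (s / u) ^ n)%R).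
  - intros n. change (Rabs (A n * s ^ n) <= M * (s / u) ^ n)%R.
    assert (Hun : (0 < u ^ n)%R) by (apply pow_lt; lra).
    assert (Hsn : (0 <= s ^ n)%R) by (apply pow_le; lra).
    rewrite Rabs_pos_eq by (apply Rmult_le_pos; [apply Cmod_ge_0|auto]).
    specialize (Hb n). rewrite Cmod_mult, Cmod_pow, Cmod_R, Rabs_pos_eq in Hb by lra.
    unfold Rdiv. rewrite Rpow_mult_distr, pow_inv.
    replace (A n * s ^ n)%R with (u ^ n * A n * (s ^ n * / u ^ n))%R by (field; lra).
    apply Rmult_le_compat_r; auto. apply Rmult_le_pos; auto.
    apply Rlt_le, Rinv_0_lt_compat; auto.
  - apply (@ex_series_scal R_AbsRing R_NormedModule). apply ex_series_geom.
    rewrite Rabs_pos_eq.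
    + apply Rmult_lt_reg_r with u; [lra|]. unfold Rdiv.
      rewrite Rmult_assoc, Rinv_l by lra. lra.
    + apply Rlt_le, Rdiv_lt_0_compat; lra.
Qed.

Lemma PS_derive_abs_nonneg (n : nat) : (0 <= PS_derive A n)%R.
Proof. unfold PS_derive. apply Rmult_le_pos; [apply pos_INR|apply Cmod_ge_0]. Qed.

Lemma PS_derive2_abs_nonneg (n : nat) : (0 <= PS_derive (PS_derive A) n)%R.
Proof.
  unfold PS_derive at 1. apply Rmult_le_pos; [apply pos_INR|apply PS_derive_abs_nonneg].
Qed.

Lemma derived_abs_ex (rho : R) : (0 <= rho < 1)%R ->
  ex_series (fun n => PS_derive A n * rho ^ n)%R.
Proof.
  intros H.
  assert (Hr : Rbar_lt (Rabs rho) (CV_radius (PS_derive A)))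
    by (rewrite CV_radius_derive, Rabs_pos_eq by lra; now apply abs_radius).
  apply CV_disk_inside in Hr. unfold CV_disk in Hr. revert Hr. apply ex_series_ext. intros n.
  apply Rabs_pos_eq, Rmult_le_pos; [apply PS_derive_abs_nonneg|apply pow_le; lra].
Qed.

Lemma derived2_abs_ex (rho : R) : (0 <= rho < 1)%R ->
  ex_series (fun n => PS_derive (PS_derive A) n * rho ^ n)%R.
Proof.
  intros H.
  assert (Hr : Rbar_lt (Rabs rho) (CV_radius (PS_derive (PS_derive A))))
    by (rewrite !CV_radius_derive, Rabs_pos_eq by lra; now apply abs_radius).
  apply CV_disk_inside in Hr. unfold CV_disk in Hr. revert Hr. apply ex_series_ext. intros n.
  apply Rabs_pos_eq, Rmult_le_pos; [apply PS_derive2_abs_nonneg|apply pow_le; lra].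
Qed.

(** The constant is twice the sharp one, which makes it the factor in [PS_derive (PS_derive A)]. *)
Lemma pow_taylor_bound (z w : C) (rho : R) (n : nat) :
  (Cmod z <= rho)%R -> (Cmod w <= rho)%R ->
  (Cmod (w ^ S (S n) - z ^ S (S n) - RtoC (INR (S (S n))) * z ^ S n * (w - z)) <=
   INR (S n) * INR (S (S n)) * rho ^ n * (Cmod (w - z) * Cmod (w - z)))%R.
Proof.
  intros Hz Hw. pose proof (Cmod_ge_0 z). pose proof (Cmod_ge_0 w).
  set (H2 := (Cmod (w - z) * Cmod (w - z))%R).
  assert (P2 : (0 <= H2)%R) by (pose proof (Cmod_ge_0 (w - z)); unfold H2; nra).
  induction n as [|n IH].
  - replace (w ^ 2 - z ^ 2 - RtoC (INR 2) * z ^ 1 * (w - z)) with ((w - z) * (w - z))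
      by (replace (INR 2) with 2%R by (simpl; ring); simpl; ring).
    rewrite Cmod_mult. fold H2.
    replace (INR 1 * INR 2 * rho ^ 0 * H2)%R with (2 * H2)%R by (simpl; ring). lra.
  - replace (w ^ S (S (S n)) - z ^ S (S (S n)) - RtoC (INR (S (S (S n)))) * z ^ S (S n) * (w - z))
      with (w * (w ^ S (S n) - z ^ S (S n) - RtoC (INR (S (S n))) * z ^ S n * (w - z))
            + RtoC (INR (S (S n))) * z ^ S n * ((w - z) * (w - z)))
      by (rewrite (S_INR (S (S n))), RtoC_plus; simpl Cpow; ring).
    eapply Rle_trans; [apply Cmod_triangle|]. rewrite !Cmod_mult, Cmod_R, Cmod_pow. fold H2.
    rewrite (Rabs_pos_eq (INR _)) by apply pos_INR.
    set (X := Cmod (w ^ S (S n) - z ^ S (S n) - RtoC (INR (S (S n))) * z ^ S n * (w - z))) in *.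
    assert (Hp : (0 <= rho ^ n)%R) by (apply pow_le; lra).
    assert (Hzp : (Cmod z ^ S n <= rho ^ S n)%R) by (apply pow_incr; lra).
    assert (I1 : (0 <= INR (S n))%R) by apply pos_INR.
    assert (I2 : (0 <= INR (S (S n)))%R) by apply pos_INR.
    assert (E2 : INR (S (S n)) = (INR (S n) + 1)%R) by apply S_INR.
    assert (E3 : INR (S (S (S n))) = (INR (S n) + 2)%R) by (rewrite S_INR, E2; ring).
    apply Rle_trans with (rho * (INR (S n) * INR (S (S n)) * rho ^ n * H2) +
      INR (S (S n)) * rho ^ S n * H2)%R.
    + apply Rplus_le_compat.
      * apply Rmult_le_compat; auto. apply Cmod_ge_0.
      * apply Rmult_le_compat_r; auto. apply Rmult_le_compat_l; auto.
    + simpl (rho ^ S n)%R. rewrite E3.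
      replace (rho * (INR (S n) * INR (S (S n)) * rho ^ n * H2) +
        INR (S (S n)) * (rho * rho ^ n) * H2)%R
        with (INR (S (S n)) * (INR (S n) + 1) * (rho * rho ^ n * H2))%R by ring.
      replace (INR (S (S n)) * (INR (S n) + 2) * (rho * rho ^ n) * H2)%R
        with (INR (S (S n)) * (INR (S n) + 2) * (rho * rho ^ n * H2))%R by ring.
      apply Rmult_le_compat_r; [|apply Rmult_le_compat_l; lra].
      apply Rmult_le_pos; [apply Rmult_le_pos; lra|exact P2].
Qed.

(** The remainder of order 2 of the sum is bounded termwise by Cmod (w - z)^2 times the second
    derived series of absolute values at a radius [rho] between Cmod z and 1. *)
Lemma power_series_derive (z : C) : (Cmod z < 1)%R ->
  excder G z /\ cseries (fun n => z ^ n * dcoef a n) (C_derive G z).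
Proof.
  intros Hz. pose proof (Cmod_ge_0 z) as Hz0.
  assert (Hex : exists l, cseries (fun n => z ^ n * dcoef a n) l).
  { apply (cseries_abs_ex _ (fun n => PS_derive A n * Cmod z ^ n)%R); [|now apply derived_abs_ex].
    intros n. unfold dcoef, PS_derive, A.
    rewrite !Cmod_mult, Cmod_pow, Cmod_R, (Rabs_pos_eq (INR _)) by apply pos_INR. lra. }
  destruct Hex as [l Hl].
  set (rho := ((1 + Cmod z) / 2)%R). assert (Hrho : (Cmod z < rho < 1)%R) by (unfold rho; lra).
  destruct (derived2_abs_ex rho ltac:(lra)) as [K HK].
  assert (HK0 : (0 <= K)%R).
  { set (d := fun n => (PS_derive (PS_derive A) n * rho ^ n)%R) in *.
    assert (Hpos : forall n, (0 <= d n)%R)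
      by (intros n; apply Rmult_le_pos; [apply PS_derive2_abs_nonneg|apply pow_le; lra]).
    apply Rle_trans with (sum_n d 0); [rewrite sum_O; apply Hpos|].
    apply (is_lim_seq_incr_compare (sum_n d) K); [exact HK|].
    intros n. rewrite sum_Sn. unfold plus; simpl. specialize (Hpos (S n)). lra. }
  assert (Hd : cder G z l).
  { apply cder_eps. intros eps Heps.
    assert (Hball : near z (fun w => (Cmod w < rho)%R)).
    { exists (rho - Cmod z)%R. split; [lra|]. intros w Hw.
      replace w with ((w - z) + z) by ring. pose proof (Cmod_triangle (w - z) z). lra. }
    assert (Hs : near z (fun w => (Cmod (w - z) < eps / (K + 1))%R)).
    { exists (eps / (K + 1))%R. split; auto. apply Rdiv_lt_0_compat; lra. }
    generalize (near_and _ _ _ Hball Hs). apply near_imp. intros w [Hw Hlt].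
    (* The derived series is shifted by one place, so that both parts of term n carry the
       coefficient a n. *)
    set (f := fun n => (w ^ n - z ^ n) * a n +
       - (w - z) * (match n with O => 0 | S k => z ^ k * dcoef a k end)).
    assert (Hf : cseries f (G w - G z - l * (w - z))).
    { replace (G w - G z - l * (w - z)) with ((G w + -(1) * G z) + - (w - z) * l) by ring.
      apply cseries_plus.
      - apply (cseries_ext (fun n => w ^ n * a n + -(1) * (z ^ n * a n))); [intros n; ring|].
        apply cseries_plus; [apply HG; lra|apply cseries_scal, HG; lra].
      - apply cseries_scal.
        apply (proj2 (cseries_shift (fun n => match n with O => RtoC 0 | S k => z ^ k * dcoef a k end) l)).
        replace (l - 0) with l by ring. exact Hl. }
    (* The remainder starts with the quadratic term; dropping two indices aligns it with
       [PS_derive (PS_derive A)]. *)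
    assert (F0 : f O = 0) by (unfold f; simpl; ring).
    assert (F1 : f 1%nat = 0) by (unfold f, dcoef; simpl; ring).
    pose proof (proj1 (cseries_shift f _) Hf) as Hf1.
    pose proof (proj1 (cseries_shift (fun n => f (S n)) _) Hf1) as Hf2.
    cbv beta in Hf2. rewrite F0, F1 in Hf2. clear Hf Hf1. rename Hf2 into Hf.
    replace (G w - G z - l * (w - z) - 0 - 0) with (G w - G z - l * (w - z)) in Hf by ring.
    set (H2 := (Cmod (w - z) * Cmod (w - z))%R).
    assert (Hb : (Cmod (G w - G z - l * (w - z)) <= H2 * K)%R).
    { apply (cseries_bound _ (fun n => H2 * (PS_derive (PS_derive A) n * rho ^ n))%R _ _ Hf).
      - intros n. unfold f, dcoef.
        replace ((w ^ S (S n) - z ^ S (S n)) * a (S (S n)) +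
          - (w - z) * (z ^ S n * (RtoC (INR (S (S n))) * a (S (S n)))))
          with ((w ^ S (S n) - z ^ S (S n) - RtoC (INR (S (S n))) * z ^ S n * (w - z)) * a (S (S n)))
          by ring.
        rewrite Cmod_mult. unfold PS_derive. fold (A (S (S n))).
        replace (H2 * (INR (S n) * (INR (S (S n)) * A (S (S n))) * rho ^ n))%R
          with (INR (S n) * INR (S (S n)) * rho ^ n * H2 * A (S (S n)))%R by ring.
        apply Rmult_le_compat_r; [apply Cmod_ge_0|]. apply pow_taylor_bound; lra.
      - now apply (@is_series_scal R_AbsRing R_NormedModule). }
    eapply Rle_trans; [exact Hb|]. unfold H2.
    pose proof (Cmod_ge_0 (w - z)) as Hp.
    assert (Cmod (w - z) * (K + 1) <= eps)%R.
    { apply Rle_trans with (eps / (K + 1) * (K + 1))%R; [apply Rmult_le_compat_r; lra|].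
      apply Req_le. field. lra. }
    replace (Cmod (w - z) * Cmod (w - z) * K)%R with (Cmod (w - z) * K * Cmod (w - z))%R by ring.
    apply Rmult_le_compat_r; auto. nra. }
  split; [now exists l|]. now rewrite (cder_unique _ _ _ Hd).
Qed.

End Power_series.

Lemma sums_on_disc_derive (a : nat -> C) (G : C -> C) :
  sums_on_disc a G -> sums_on_disc (dcoef a) (C_derive G).
Proof. intros H z Hz. now apply (power_series_derive a G H z Hz). Qed.

(** * Euler's equation for the hypergeometric series *)

Definition euler_expr (A B c : C) (G : C -> C) (z : C) : C :=
  z * (1 - z) * C_derive (C_derive G) z + (c - (A + B + 1) * z) * C_derive G z - A * B * G z.

Lemma pochhammer_neq0 (c : C) (n : nat) :
  (forall m : nat, c <> - RtoC (INR m)) -> pochhammer c n <> 0.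
Proof.
  intros H. induction n as [|n IH]; simpl.
  - intros E. apply RtoC_inj in E. lra.
  - apply Cmult_neq_0; auto. intros E. apply (H n).
    replace c with ((c + RtoC (INR n)) - RtoC (INR n)) by ring. rewrite E. ring.
Qed.

Lemma hyp2F1_coef_rec (A B c : C) (n : nat) : (forall m : nat, c <> - RtoC (INR m)) ->
  RtoC (INR (S n)) * (c + RtoC (INR n)) * hyp2F1_coef A B c (S n) =
  (A + RtoC (INR n)) * (B + RtoC (INR n)) * hyp2F1_coef A B c n.
Proof.
  intros H. unfold hyp2F1_coef.
  pose proof (pochhammer_neq0 c n H) as H1.
  assert (H2 : RtoC (INR (Factorial.fact n)) <> 0)
    by (intros E; apply RtoC_inj in E; now apply (INR_fact_neq_0 n)).
  assert (H3 : RtoC (INR (S n)) <> 0)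
    by (intros E; apply RtoC_inj in E; now apply (not_0_INR (S n))).
  assert (H4 : c + RtoC (INR n) <> 0).
  { intros E. apply (H n). replace c with ((c + RtoC (INR n)) - RtoC (INR n)) by ring.
    rewrite E. ring. }
  change (Factorial.fact (S n)) with (S n * Factorial.fact n)%nat.
  rewrite mult_INR, RtoC_mult. cbn [pochhammer]. field. auto.
Qed.

(** Multiplication of a power series by z, on coefficients. *)
Definition shift (d : nat -> C) (n : nat) : C := match n with O => 0 | S k => d k end.

(** The coefficient of z^n in Euler's expression is (n + 1) (c + n) a_(n+1) - (A + n) (B + n) a_n,
    which is 0 by the recurrence of the coefficients. *)
Lemma hyp2F1_series_euler (A B c : C) (G : C -> C) :
  (forall m : nat, c <> - RtoC (INR m)) -> sums_on_disc (hyp2F1_coef A B c) G ->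
  forall z, (Cmod z < 1)%R -> euler_expr A B c G z = 0.
Proof.
  intros Hc HG z Hz. set (a := hyp2F1_coef A B c) in *.
  pose proof (HG z Hz) as S0.
  pose proof (sums_on_disc_derive a G HG) as HG1. pose proof (HG1 z Hz) as S1.
  pose proof (sums_on_disc_derive _ _ HG1 z Hz) as S2.
  set (g0 := G z) in *. set (g1 := C_derive G z) in *. set (g2 := C_derive (C_derive G) z) in *.
  assert (Hshift : forall (d : nat -> C) l, cseries (fun n => z ^ n * d n) l ->
    cseries (fun n => z ^ n * shift d n) (z * l)).
  { intros d l Hl. apply (proj2 (cseries_shift (fun n => z ^ n * shift d n) (z * l))).
    replace (z * l - z ^ 0 * shift d 0) with (z * l) by (simpl; ring).
    apply (cseries_ext (fun n => z * (z ^ n * d n))); [intros n; simpl; ring|].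
    now apply cseries_scal. }
  pose proof (Hshift _ _ S1) as T1. pose proof (Hshift _ _ S2) as T2.
  pose proof (Hshift _ _ T2) as T3.
  assert (E : forall n, shift (dcoef (dcoef a)) n =
     RtoC (INR n) * RtoC (INR (S n)) * a (S n)).
  { intros [|n]; [simpl; ring|]. unfold shift, dcoef. ring. }
  assert (E1 : forall n, shift (dcoef a) n = RtoC (INR n) * a n).
  { intros [|n]; [simpl; ring|]. unfold shift, dcoef. ring. }
  assert (Hsum : cseries (fun n => 0) (euler_expr A B c G z)).
  { unfold euler_expr. fold g0 g1 g2.
    replace (z * (1 - z) * g2 + (c - (A + B + 1) * z) * g1 - A * B * g0) with
      (z * g2 + -(1) * (z * (z * g2)) + c * g1 + - (A + B + 1) * (z * g1) + - (A * B) * g0) by ring.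
    apply (cseries_ext (fun n =>
      z ^ n * shift (dcoef (dcoef a)) n +
      -(1) * (z ^ n * shift (shift (dcoef (dcoef a))) n) +
      c * (z ^ n * dcoef a n) +
      - (A + B + 1) * (z ^ n * shift (dcoef a) n) +
      - (A * B) * (z ^ n * a n))).
    - intros n. rewrite E, E1.
      assert (E2 : shift (shift (dcoef (dcoef a))) n =
               (RtoC (INR n) - 1) * RtoC (INR n) * a n).
      { destruct n as [|k]; [simpl; ring|].
        change (shift (shift (dcoef (dcoef a))) (S k)) with (shift (dcoef (dcoef a)) k).
        rewrite E, S_INR, RtoC_plus. ring. }
      rewrite E2. unfold dcoef.
      pose proof (hyp2F1_coef_rec A B c n Hc) as R. fold a in R.
      set (an := a n) in *. set (an1 := a (S n)) in *.
      set (N := RtoC (INR n)) in *. set (N1 := RtoC (INR (S n))) in *.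
      transitivity (z ^ n * (N1 * (c + N) * an1 - (A + N) * (B + N) * an)); [ring|].
      rewrite R. ring.
    - apply cseries_plus; [apply cseries_plus; [apply cseries_plus; [apply cseries_plus|]|]|];
        first [exact T2|apply cseries_scal; assumption]. }
  apply (cseries_unique (fun _ => 0)); [exact Hsum|].
  apply (cseries_ext (fun n => 0 * (z ^ n * a n))); [intros n; ring|].
  pose proof (cseries_scal 0 _ _ S0) as Q. replace (0 * g0) with (RtoC 0) in Q by ring. exact Q.
Qed.

(** * Specializations of F4 *)

Lemma holo_const (U : C -> Prop) (k : C) : holomorphic_on U (fun _ => k).
Proof. intros z _. eexists. apply cder_const. Qed.

Lemma holo_id (U : C -> Prop) : holomorphic_on U (fun z => z).
Proof. intros z _. eexists. apply cder_id. Qed.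

Lemma holo_plus (U : C -> Prop) (f g : C -> C) :
  holomorphic_on U f -> holomorphic_on U g -> holomorphic_on U (fun z => f z + g z).
Proof. intros Hf Hg z Hz. destruct (Hf z Hz), (Hg z Hz). eexists. apply cder_plus; eassumption. Qed.

Lemma holo_minus (U : C -> Prop) (f g : C -> C) :
  holomorphic_on U f -> holomorphic_on U g -> holomorphic_on U (fun z => f z - g z).
Proof. intros Hf Hg z Hz. destruct (Hf z Hz), (Hg z Hz). eexists. apply cder_minus; eassumption. Qed.

Lemma holo_mult (U : C -> Prop) (f g : C -> C) :
  holomorphic_on U f -> holomorphic_on U g -> holomorphic_on U (fun z => f z * g z).
Proof. intros Hf Hg z Hz. destruct (Hf z Hz), (Hg z Hz). eexists. apply cder_mult; eassumption. Qed.

Ltac holo := cbv beta;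
  match goal with
  | H : holomorphic_on ?U ?f |- holomorphic_on ?U ?f => exact H
  | |- holomorphic_on _ (fun _ => ?k) => exact (holo_const _ k)
  | |- holomorphic_on _ (fun z => z) => exact (holo_id _)
  | H : holomorphic_on ?U ?f |- holomorphic_on ?U (fun z => ?f z) => exact H
  | |- holomorphic_on _ (fun z => Cplus (@?f z) (@?g z)) => apply (holo_plus _ f g); holo
  | |- holomorphic_on _ (fun z => Cminus (@?f z) (@?g z)) => apply (holo_minus _ f g); holo
  | |- holomorphic_on _ (fun z => Cmult (@?f z) (@?g z)) => apply (holo_mult _ f g); holo
  end.

Lemma near_eq_of_zero (z : C) (f g : C -> C) :
  near z (fun w => f w - g w = 0) <-> near z (fun w => f w = g w).
Proof.
  split; apply near_imp; intros w H.
  - now apply Cminus_eq_0.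
  - rewrite H. ring.
Qed.

Lemma constant_on_ball (f : C -> C) (z0 : C) (r : R) :
  (forall z, (Cmod (z - z0) < r)%R -> cder f z 0) ->
  forall z, (Cmod (z - z0) < r)%R -> f z = f z0.
Proof.
  intros H z Hz.
  assert (H0 : (Cmod (z0 - z0) < r)%R).
  { rewrite Cmod_self. eapply Rle_lt_trans; [apply Cmod_ge_0|exact Hz]. }
  assert (E : seg (fun _ => 0) z0 z = f z - f z0).
  { apply seg_ftc.
    - intros t Ht. apply H. now apply Cmod_pt_lt.
    - intros t _. apply cder_cont. eexists. apply cder_const. }
  rewrite seg_const in E. replace (f z) with ((f z - f z0) + f z0) by ring.
  rewrite <- E. ring.
Qed.

Section Domain.

Variable U : C -> Prop.
Hypothesis HU : C_open U.
Hypothesis HUc : C_connected U.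

Lemma identity_eq (f g : C -> C) (z0 : C) :
  holomorphic_on U f -> holomorphic_on U g -> U z0 -> near z0 (fun z => f z = g z) ->
  forall z, U z -> f z = g z.
Proof.
  intros Hf Hg Hz0 Hn z Hz.
  apply Cminus_eq_0. apply (identity_theorem U (fun z => f z - g z) z0); auto; [holo|].
  now apply near_eq_of_zero.
Qed.

(** The nonzeros of a holomorphic function that is not identically 0 are dense in a domain. This
    moves from a given point to a nearby one in general position. *)
Lemma nonzero_near (f : C -> C) (z0 : C) (P : C -> Prop) :
  holomorphic_on U f -> not_identically_zero U f -> U z0 -> near z0 P ->
  exists z, U z /\ P z /\ near z P /\ f z <> 0.
Proof.
  intros Hf [w [Hw Hfw]] Hz0 HP. apply NNPP. intros Hno. apply Hfw.
  apply (identity_theorem U f z0); auto.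
  generalize (near_and _ _ _ (near_open U z0 HU Hz0) (near_near _ _ HP)). apply near_imp.
  intros z [Hz HPz]. apply NNPP. intros Hfz. apply Hno. exists z.
  repeat split; auto. now apply (near_at z P).
Qed.

Lemma not_identically_zero_mult (f g : C -> C) :
  holomorphic_on U f -> holomorphic_on U g ->
  not_identically_zero U f -> not_identically_zero U g ->
  not_identically_zero U (fun z => f z * g z).
Proof.
  intros Hf Hg Nf [w [Hw Hgw]].
  destruct (nonzero_near f w (fun z => g z <> 0)) as [z (Hz & Hgz & _ & Hfz)]; auto.
  - apply ccont_neq0; auto. apply cder_cont. now apply Hg.
  - exists z. split; auto. now apply Cmult_neq_0.
Qed.

Lemma constant_of_derive_zero (f : C -> C) (z0 : C) :
  holomorphic_on U f -> U z0 -> near z0 (fun z => C_derive f z = 0) ->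
  forall z, U z -> f z = f z0.
Proof.
  intros Hf Hz0 Hn. apply (identity_eq f (fun _ => f z0) z0); auto; [holo|].
  destruct (near_and _ _ _ Hn (near_open U z0 HU Hz0)) as [d [Hd H]].
  exists d. split; auto. intros z Hz. apply (constant_on_ball f z0 d); auto.
  intros w Hw. destruct (H w Hw) as [E HwU]. rewrite <- E.
  apply excder_C_derive. now apply Hf.
Qed.

End Domain.

Lemma pow_n_Cpow (z : C) (n : nat) : @pow_n C_Ring z n = z ^ n.
Proof. induction n as [|n IH]; [reflexivity|]. simpl. now rewrite IH. Qed.

Lemma euler_expr_holo (A B c : C) (W : C -> Prop) (G : C -> C) :
  C_open W -> holomorphic_on W G -> holomorphic_on W (euler_expr A B c G).
Proof.
  intros HW HG. pose proof (holomorphic_derive W G HW HG) as HG1.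
  pose proof (holomorphic_derive W _ HW HG1) as HG2.
  change (holomorphic_on W (fun z => z * (1 - z) * C_derive (C_derive G) z
    + (c - (A + B + 1) * z) * C_derive G z - A * B * G z)). holo.
Qed.

(** Induction along the continuation: Euler's expression of the new branch is holomorphic on the
    connected set [W'] and vanishes on the overlap. *)
Lemma hyp2F1_branch_euler (A B c : C) (W : C -> Prop) (G : C -> C) :
  (forall n : nat, c <> - RtoC (INR n)) -> hyp2F1_branch A B c W G ->
  C_open W /\ holomorphic_on W G /\ forall z, W z -> euler_expr A B c G z = 0.
Proof.
  intros Hc H. induction H as [G HG|W G W' G' HB IH [HW' [Hconn _]] HG' [V [HV [[v0 Hv0] HVeq]]]].
  - assert (HS : sums_on_disc (hyp2F1_coef A B c) G).
    { intros z Hz. generalize (HG z Hz). apply cseries_ext. intros n.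
      change (@pow_n C_Ring z n * hyp2F1_coef A B c n = z ^ n * hyp2F1_coef A B c n).
      now rewrite pow_n_Cpow. }
    repeat split.
    + apply open_near. intros z Hz.
      assert (Hz' : (Cmod (z - 0) < 1)%R) by (now replace (z - 0) with z by ring).
      generalize (near_ball 0 z 1 Hz'). apply near_imp. intros w.
      now replace (w - 0) with w by ring.
    + intros z Hz. now apply (power_series_derive _ _ HS z Hz).
    + intros z Hz. now apply hyp2F1_series_euler.
  - destruct IH as (HW & HGh & HE). split; [exact HW'|]. split; [exact HG'|].
    destruct (HVeq v0 Hv0) as (_ & Hv0' & _).
    apply (identity_theorem W' (euler_expr A B c G') v0 HW' Hconn); auto.
    + now apply euler_expr_holo.
    + generalize (near_open V v0 HV Hv0). apply near_imp. intros z Hz.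
      destruct (HVeq z Hz) as (HWz & _ & E). rewrite <- (HE z HWz).
      (* [V] is open, so the two branches agree near each of its points, and with them their
         derivatives. *)
      assert (Hn : near z (fun w => G w = G' w)).
      { generalize (near_open V z HV Hz). apply near_imp. intros w Hw. apply HVeq, Hw. }
      assert (Hn1 : near z (fun w => C_derive G w = C_derive G' w)).
      { generalize (near_near _ _ Hn). apply near_imp. intros w. apply C_derive_ext_near. }
      unfold euler_expr. now rewrite E, (near_at _ _ Hn1), (C_derive_ext_near _ _ _ Hn1).
Qed.

Lemma derive_scal (f : C -> C) (k z : C) : excder f z ->
  C_derive (fun w => k * f w) z = k * C_derive f z.
Proof.
  intros H. apply cder_unique. eapply cder_val.
  - apply cder_mult; [apply cder_const|now apply excder_C_derive].
  - simpl. ring.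
Qed.

(* Clairaut's equation: differentiating y p^2 + (1 - x - y) p + x = 0 along x' = p y' leaves
   p' (2 y p + 1 - x - y) = 0, and the second factor is a square root of Delta. *)
Lemma clairaut_slope_constant (x y : C -> C) (t0 : C) (r : R) :
  (forall t, (Cmod (t - t0) < r)%R ->
     excder x t /\ excder y t /\ excder (C_derive x) t /\ excder (C_derive y) t /\
     C_derive y t <> 0 /\ Delta (x t, y t) <> 0 /\
     y t * (C_derive x t * C_derive x t) + (1 - x t - y t) * (C_derive x t * C_derive y t)
       + x t * (C_derive y t * C_derive y t) = 0) ->
  forall t, (Cmod (t - t0) < r)%R ->
    C_derive x t / C_derive y t = C_derive x t0 / C_derive y t0.
Proof.
  intros H. apply (constant_on_ball (fun t => C_derive x t / C_derive y t)). intros t Ht.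
  destruct (H t Ht) as (Hx & Hy & Hx1 & Hy1 & Hny & HD & HE).
  apply excder_C_derive in Hx, Hy, Hx1, Hy1.
  pose proof (cder_div (C_derive x) (C_derive y) t _ _ Hny Hx1 Hy1) as Hp.
  set (p := fun t => C_derive x t / C_derive y t) in *.
  set (p1 := (C_derive (C_derive x) t * C_derive y t - C_derive x t * C_derive (C_derive y) t)
             / (C_derive y t * C_derive y t)) in *.
  set (F := fun t => y t * (p t * p t) + (1 - x t - y t) * p t + x t).
  assert (HF : near t (fun w => F w = 0)).
  { generalize (near_ball _ _ _ Ht). apply near_imp. intros w Hw.
    destruct (H w Hw) as (_ & _ & _ & _ & Hn & _ & E). unfold F, p.
    replace (y w * (C_derive x w / C_derive y w * (C_derive x w / C_derive y w)) +
      (1 - x w - y w) * (C_derive x w / C_derive y w) + x w) with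
      ((y w * (C_derive x w * C_derive x w) + (1 - x w - y w) * (C_derive x w * C_derive y w)
       + x w * (C_derive y w * C_derive y w)) / (C_derive y w * C_derive y w)) by (field; auto).
    rewrite E. field. auto. }
  assert (HdF := cder_plus _ _ _ _ _
    (cder_plus _ _ _ _ _ (cder_mult _ _ _ _ _ Hy (cder_mult _ _ _ _ _ Hp Hp))
      (cder_mult _ _ _ _ _ (cder_minus _ _ _ _ _ (cder_minus _ _ _ _ _ (cder_const 1 t) Hx) Hy) Hp))
    Hx).
  assert (Hd0 : C_derive F t = 0).
  { rewrite (C_derive_ext_near F (fun _ => 0) t HF). apply cder_unique, cder_const. }
  unfold F in Hd0. rewrite (cder_unique _ _ _ HdF) in Hd0. simpl in Hd0.
  assert (Exp : C_derive x t = p t * C_derive y t) by (unfold p; field; auto).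
  set (D := 2 * (y t * p t) + 1 - x t - y t).
  assert (HDp : D * p1 = 0).
  { rewrite <- Hd0, Exp. unfold D. ring. }
  assert (HDD : D * D = Delta (x t, y t)).
  { pose proof (near_at _ _ HF) as F0. unfold F in F0. unfold D, Delta. simpl.
    transitivity (4 * y t * (y t * (p t * p t) + (1 - x t - y t) * p t + x t) +
      (x t * x t + y t * y t + 1 - 2 * x t * y t - 2 * x t - 2 * y t)); [ring|].
    rewrite F0. ring. }
  assert (HDn : D <> 0) by (intros E; apply HD; rewrite <- HDD, E; ring).
  apply cder_val with (1 := Hp).
  transitivity (D * p1 / D); [field; auto|rewrite HDp; field; auto].
Qed.

Lemma implied_on_curve (a b c1 c2 : C) (V : C -> Prop) (Om : C * C -> Prop) (P : pde)
    (x y : C -> C) (E : ode) (t : C) :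
  C2_open Om -> (forall t, V t -> Om (x t, y t)) ->
  follows Om (F4_system a b c1 c2) P ->
  (forall t, V t -> forall i j, partial_form x y E i j t = specialized_form x y P i j t) ->
  V t -> regular (x t, y t) ->
  let x0 := x t in let x1 := C_derive x t in let x2 := C_derive (C_derive x) t in
  let y0 := y t in let y1 := C_derive y t in let y2 := C_derive (C_derive y) t in
  ode0 E t - ode2 E t * (2 * x1 * y1) * (a * b) / (2 * x0 * y0) = 0 /\
  ode2 E t * x2 + ode1 E t * x1
    + ode2 E t * (2 * x1 * y1) * (c1 * (1 - y0) - (a + b + 1) * x0) / (2 * x0 * y0)
    + ode2 E t * (y1 * y1) * c1 / y0 = 0 /\
  ode2 E t * y2 + ode1 E t * y1 + ode2 E t * (2 * x1 * y1) * (c2 - (a + b + 1)) / (2 * x0)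
    - ode2 E t * (y1 * y1) * c2 / y0 = 0 /\
  ode2 E t * (x1 * x1) + ode2 E t * (2 * x1 * y1) * (1 - x0 - y0) / (2 * y0)
    + ode2 E t * (y1 * y1) * x0 / y0 = 0.
Proof.
  intros HOm HVOm HF HP Ht Hr x0 x1 x2 y0 y1 y2.
  pose proof (fun i j => eq_sym (HP t Ht i j)) as HPt. unfold specialized_form in HPt.
  destruct (follows_order2 a b c1 c2 Om HOm P (x t, y t) HF (HVOm t Ht) Hr) as (A & B & D & F).
  { intros i j Hij. rewrite HPt.
    destruct i as [|[|[|i]]]; destruct j as [|[|[|j]]]; simpl in Hij; try lia; reflexivity. }
  rewrite !HPt in A. rewrite !HPt in B. rewrite !HPt in D. rewrite !HPt in F.
  exact (conj A (conj B (conj D F))).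
Qed.

(** [T], [T1], [T2] are the values of the parameter of the line and of its first two derivatives.
    The conditions from F_x and F_y both determine [e1]; their agreement is the relation between the
    parameters. *)
Lemma pullback_relations (a b c1 c2 s T T1 T2 e0 e1 e2 : C) :
  let x0 := s * T in let x1 := s * T1 in let x2 := s * T2 in
  let y0 := (1 - s) * (1 - T) in let y1 := - (1 - s) * T1 in let y2 := - (1 - s) * T2 in
  s <> 0 -> 1 - s <> 0 -> T <> 0 -> 1 - T <> 0 -> T1 <> 0 -> e2 <> 0 ->
  e0 - e2 * (2 * x1 * y1) * (a * b) / (2 * x0 * y0) = 0 ->
  e2 * x2 + e1 * x1 + e2 * (2 * x1 * y1) * (c1 * (1 - y0) - (a + b + 1) * x0) / (2 * x0 * y0)
    + e2 * (y1 * y1) * c1 / y0 = 0 ->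
  e2 * y2 + e1 * y1 + e2 * (2 * x1 * y1) * (c2 - (a + b + 1)) / (2 * x0)
    - e2 * (y1 * y1) * c2 / y0 = 0 ->
  c2 = a + b - c1 + 1 /\
  T * (1 - T) * T1 * e1 = e2 * ((c1 - (a + b + 1) * T) * (T1 * T1) - T * (1 - T) * T2) /\
  T * (1 - T) * T1 * e0 = e2 * (- (a * b) * (T1 * T1 * T1)).
Proof.
  intros x0 x1 x2 y0 y1 y2 Hs Hs1 HT HT1 HTd He HA HB HC. pose proof C2_neq0 as H2.
  assert (K : forall u v w k : C, w = 0 -> u - v = k * w -> u = v).
  { intros u v w k Hw E. replace u with ((u - v) + v) by ring. rewrite E, Hw. ring. }
  repeat split.
  (* Divided by s and 1 - s, the two conditions contain e2 * T2 + e1 * T1 with opposite signs, so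
     their sum is free of [e1] and [T2]. *)
  - apply (K _ _ _ (- (T * (1 - T)) / (e2 * (T1 * T1) * s)) HB).
    match type of HC with ?Z = _ => 
      transitivity ((- (T * (1 - T)) / (e2 * (T1 * T1) * s)) * 
        (e2 * x2 + e1 * x1 + e2 * (2 * x1 * y1) * (c1 * (1 - y0) - (a + b + 1) * x0) / (2 * x0 * y0)
    + e2 * (y1 * y1) * c1 / y0) + - (T * (1 - T)) / (e2 * (T1 * T1) * (1 - s)) * Z) end.
    + unfold x0, x1, x2, y0, y1, y2. field. repeat split; auto.
    + rewrite HC. ring.
  - apply (K _ _ _ (T * (1 - T) / s) HB).
    unfold x0, x1, x2, y0, y1, y2. field. repeat split; auto.
  - apply (K _ _ _ (T * (1 - T) * T1) HA).
    unfold x0, x1, x2, y0, y1, y2. field. repeat split; auto.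
Qed.

Lemma nonconstant_derivatives (U : C -> Prop) (x y : C -> C) (t0 : C) :
  univariate_specialization U x y -> U t0 ->
  ~ near t0 (fun t => C_derive x t = 0 /\ C_derive y t = 0).
Proof.
  intros [[HU [HUc _]] [Hx [Hy [t1 [t2 [H1 [H2 Hne]]]]]]] Ht0 Hn. apply Hne.
  assert (Ex : near t0 (fun t => C_derive x t = 0)) by (revert Hn; apply near_imp; tauto).
  assert (Ey : near t0 (fun t => C_derive y t = 0)) by (revert Hn; apply near_imp; tauto).
  pose proof (constant_of_derive_zero U HU HUc x t0 Hx Ht0 Ex) as Cx.
  pose proof (constant_of_derive_zero U HU HUc y t0 Hy Ht0 Ey) as Cy.
  now rewrite (Cx t1 H1), (Cx t2 H2), (Cy t1 H1), (Cy t2 H2).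
Qed.

(** Along the curve xy, Delta and the leading coefficient are holomorphic and not identically 0 on a
    domain. So their product is not identically 0 either, and it has a nonzero in the open set
    [V]. *)
Lemma regular_point_on_curve (U V : C -> Prop) (x y e2 : C -> C) :
  univariate_specialization U x y ->
  ~ (forall t, U t -> x t * y t = 0) ->
  ~ (forall t, U t ->
       x t * x t + y t * y t + 1 = 2 * x t * y t + 2 * x t + 2 * y t) ->
  holomorphic_on U e2 -> not_identically_zero U e2 ->
  C_open V -> (exists t, V t) -> (forall t, V t -> U t) ->
  exists t, V t /\ near t (fun w => V w /\ regular (x w, y w) /\ e2 w <> 0).
Proof.
  intros [[HU [HUc _]] [Hx [Hy _]]] Hxy HD He2 Ne2 HV [v Hv] HVU.
  assert (Nxy : not_identically_zero U (fun t => x t * y t)).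
  { apply NNPP. intros Hn. apply Hxy. intros t Ht. apply NNPP. intros E. apply Hn. now exists t. }
  assert (ND : not_identically_zero U (fun t => Delta (x t, y t))).
  { apply NNPP. intros Hn. apply HD. intros t Ht. apply NNPP. intros E. apply Hn. exists t.
    split; auto. intros E'. apply E. unfold Delta in E'. simpl in E'.
    transitivity (x t * x t + y t * y t + 1 - 2 * x t * y t - 2 * x t - 2 * y t +
      (2 * x t * y t + 2 * x t + 2 * y t)); [ring|rewrite E'; ring]. }
  assert (HDh : holomorphic_on U (fun t => Delta (x t, y t))).
  { change (holomorphic_on U (fun t => x t * x t + y t * y t + 1 - 2 * x t * y t
      - 2 * x t - 2 * y t)). holo. }
  assert (Hxyh : holomorphic_on U (fun t => x t * y t)) by holo.
  pose proof (not_identically_zero_mult U HU HUc _ _ Hxyh HDh Nxy ND) as N1.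
  pose proof (holo_mult _ _ _ Hxyh HDh) as H1.
  pose proof (not_identically_zero_mult U HU HUc _ _ H1 He2 N1 Ne2) as N2.
  pose proof (holo_mult _ _ _ H1 He2) as H2. cbv beta in *.
  destruct (nonzero_near U HU HUc _ v V H2 N2 (HVU v Hv) (near_open V v HV Hv))
    as [t (Ht & HVt & HVn & Hnz)].
  exists t. split; auto.
  assert (Hn := ccont_neq0 _ t (cder_cont _ _ (H2 t Ht)) Hnz).
  generalize (near_and _ _ _ HVn Hn). apply near_imp. cbv beta. intros w [Hw Hnw].
  split; auto. unfold regular. simpl. repeat split; intros E; apply Hnw.
  - rewrite E. ring.
  - rewrite E. ring.
  - rewrite E. ring.
  - rewrite E. ring.
Qed.

Theorem theorem4p1 (a b c1 c2 : C) (U : C -> Prop) (x y : C -> C) (E : ode) :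
  univariate_specialization U x y ->
  ~ (forall t, U t -> x t * y t = 0) ->
  ~ (forall t, U t ->
       x t * x t + y t * y t + 1 = 2 * x t * y t + 2 * x t + 2 * y t) ->
  second_order_ode U E ->
  fully_implied U x y (F4_system a b c1 c2) E ->
  exists (c s : C) (tau : C -> C),
    holomorphic_on U tau /\
    (exists t1 t2, U t1 /\ U t2 /\ tau t1 <> tau t2) /\
    c1 = c /\ c2 = a + b - c + 1 /\
    (forall t, U t -> x t = s * tau t /\ y t = (1 - s) * (1 - tau t)) /\
    same_ode U E (ode_change_var tau (euler_ode a b c)) /\
    ((forall n : nat, c <> - RtoC (INR n)) ->
     forall (W : C -> Prop) (G : C -> C), hyp2F1_branch a b c W G ->
     forall t, U t -> W (tau t) ->
       ode_satisfied_at E (fun t' => G (tau t')) t).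
Proof.
  intros Hspec Hxy HD [He2 [He1 [He0 Ne2]]] [V [Om [P (HV & HVne & HVU & HOm & HVOm & HF & HP)]]].
  destruct (regular_point_on_curve U V x y (ode2 E) Hspec Hxy HD He2 Ne2 HV HVne HVU)
    as [t0 [Hvt0 Hreg]].
  pose proof (nonconstant_derivatives U x y t0 Hspec (HVU _ Hvt0)) as Hnc.
  pose proof Hspec as [[HU [HUc _]] [Hx [Hy [tA [tB [HtA [HtB HtAB]]]]]]].
  pose proof (holomorphic_derive U x HU Hx) as Hx1.
  pose proof (holomorphic_derive U y HU Hy) as Hy1.
  pose proof C2_neq0 as H2.
  assert (HE := fun t Ht Hr => implied_on_curve a b c1 c2 V Om P x y E t HOm HVOm HF HP Ht Hr).
  cbv zeta in HE.
  assert (HClairaut : forall t, V t -> regular (x t, y t) -> ode2 E t <> 0 ->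
     y t * (C_derive x t * C_derive x t) + (1 - x t - y t) * (C_derive x t * C_derive y t)
       + x t * (C_derive y t * C_derive y t) = 0).
  { intros t Ht Hr He. destruct (HE t Ht Hr) as (_ & _ & _ & Hq). destruct Hr as (_ & Hy0 & _).
    simpl in Hy0.
    match type of Hq with ?L = _ => transitivity (y t / ode2 E t * L); [field; auto|] end.
    rewrite Hq. ring. }
  (* Clairaut's equation needs the slope x' / y'. Where y' = 0 it reduces to y x'^2 = 0, so x' = 0
     as well, and if this held near [t0] the curve would be constant. *)
  assert (Ht1 : exists t1, near t1 (fun w => V w /\ regular (x w, y w) /\ ode2 E w <> 0 /\
    C_derive y w <> 0)).
  { apply NNPP. intros Hno. apply Hnc.
    generalize (near_near _ _ Hreg). apply near_imp. intros w Hw.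
    destruct (near_at _ _ Hw) as (HwV & Hr & He).
    assert (Ey : C_derive y w = 0).
    { apply NNPP. intros Hn. apply Hno. exists w.
      generalize (near_and _ _ _ Hw (ccont_neq0 _ _ (cder_cont _ _ (Hy1 w (HVU w HwV))) Hn)).
      apply near_imp. tauto. }
    split; auto. pose proof (HClairaut w HwV Hr He) as Hq. rewrite Ey in Hq.
    apply NNPP. intros Hn. destruct Hr as (_ & Hy0 & _). simpl in Hy0.
    apply (Cmult_neq_0 (y w) (C_derive x w * C_derive x w) Hy0 (Cmult_neq_0 _ _ Hn Hn)).
    rewrite <- Hq. ring. }
  destruct Ht1 as [t1 Ht1]. pose proof (near_at _ _ Ht1) as (HV1 & Hr1 & Hn1 & Hny1).
  pose proof (HVU t1 HV1) as HU1.
  (* [k] is the slope dx/dy and [s] the value of x at y = 0 on the line: x = s t, y = (1 - s) (1 -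
     t) meets y = 0 at t = 1, in the point (s, 0). *)
  set (k := C_derive x t1 / C_derive y t1).
  set (s := x t1 - k * y t1).
  assert (Hslope : near t1 (fun t => C_derive x t = k * C_derive y t)).
  { destruct Ht1 as [r [Hr0 Ht1]]. exists r. split; auto. intros t Ht.
    destruct (Ht1 t Ht) as (HVt & Hrt & Het & Hyt). unfold k.
    rewrite <- (clairaut_slope_constant x y t1 r) with (t := t); auto; [field; auto|].
    intros w Hw. destruct (Ht1 w Hw) as (HVw & Hrw & Hew & Hyw). pose proof (HVU w HVw).
    repeat split; auto; try apply Hrw; first [now apply Hx|now apply Hy|now apply Hx1|now apply Hy1]. }
  assert (Hline : forall t, U t -> x t = k * y t + s).
  { assert (Hc : forall t, U t -> x t - k * y t = x t1 - k * y t1).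
    { apply (constant_of_derive_zero U HU HUc (fun t => x t - k * y t)); auto; [holo|].
      generalize (near_and _ _ _ Hslope (near_open U t1 HU HU1)). apply near_imp.
      intros t [Et Ut]. apply cder_unique. eapply cder_val.
      - apply cder_minus; [now apply excder_C_derive, Hx|].
        apply cder_mult; [apply cder_const|now apply excder_C_derive, Hy].
      - simpl. rewrite Et. ring. }
    intros t Ht. unfold s. rewrite <- (Hc t Ht). ring. }
  assert (Hk0 : k <> 0).
  { intros Ek. pose proof (HClairaut t1 HV1 Hr1 Hn1) as Hq.
    rewrite (near_at _ _ Hslope), Ek in Hq. destruct Hr1 as (Hx0 & _). simpl in Hx0.
    apply (Cmult_neq_0 _ _ Hx0 (Cmult_neq_0 _ _ Hny1 Hny1)). rewrite <- Hq. ring. }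
  (* On x = k y + s all terms with y cancel in Clairaut's polynomial, and (1 - s) k + s is left. *)
  assert (Hks : (1 - s) * k + s = 0).
  { pose proof (HClairaut t1 HV1 Hr1 Hn1) as Hq. rewrite (near_at _ _ Hslope) in Hq.
    rewrite (Hline t1 HU1) in Hq.
    match type of Hq with ?L = _ =>
      transitivity (L / (C_derive y t1 * C_derive y t1)); [field; auto|] end.
    rewrite Hq. field. auto. }
  assert (Hs1 : 1 - s <> 0).
  { intros E1. rewrite E1 in Hks. assert (Es : s = 0) by (rewrite <- Hks; ring).
    rewrite Es in E1. apply (f_equal fst) in E1. simpl in E1. lra. }
  assert (Hs0 : s <> 0).
  { intros E0. rewrite E0 in Hks. apply Hk0. rewrite <- Hks. ring. }
  assert (Ek : k = - s / (1 - s)).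
  { transitivity (((1 - s) * k + s - s) / (1 - s)); [field; auto|]. rewrite Hks. field. auto. }
  set (tau := fun t => / s * x t).
  assert (Htau : holomorphic_on U tau) by (unfold tau; holo).
  assert (Hxy_tau : forall t, U t -> x t = s * tau t /\ y t = (1 - s) * (1 - tau t)).
  { intros t Ht. split; [unfold tau; field; auto|].
    transitivity ((k * y t + s - s) / k); [field; auto|].
    rewrite <- (Hline t Ht). unfold tau. rewrite Ek. field. auto. }
  pose proof (holomorphic_derive U tau HU Htau) as Htau1.
  pose proof (holomorphic_derive U _ HU Htau1) as Htau2.
  assert (Dx1 : forall t, U t -> C_derive x t = s * C_derive tau t).
  { intros t Ht. rewrite <- derive_scal by now apply Htau.
    apply C_derive_ext_near. generalize (near_open U t HU Ht). apply near_imp.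
    intros w Hw. now apply Hxy_tau. }
  assert (Dy1 : forall t, U t -> C_derive y t = - (1 - s) * C_derive tau t).
  { intros t Ht. rewrite (C_derive_ext_near y (fun w => (1 - s) * (1 - tau w))).
    - apply cder_unique. eapply cder_val.
      + apply cder_mult; [apply cder_const|].
        apply cder_minus; [apply cder_const|now apply excder_C_derive, Htau].
      + simpl. ring.
    - generalize (near_open U t HU Ht). apply near_imp. intros w Hw. now apply Hxy_tau. }
  assert (Dx2 : forall t, U t -> C_derive (C_derive x) t = s * C_derive (C_derive tau) t).
  { intros t Ht. rewrite <- derive_scal by now apply Htau1.
    apply C_derive_ext_near. generalize (near_open U t HU Ht). now apply near_imp. }
  assert (Dy2 : forall t, U t -> C_derive (C_derive y) t = - (1 - s) * C_derive (C_derive tau) t).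
  { intros t Ht. rewrite <- derive_scal by now apply Htau1.
    apply C_derive_ext_near. generalize (near_open U t HU Ht). now apply near_imp. }
  assert (Hrel : near t1 (fun t => U t /\ tau t * (1 - tau t) * C_derive tau t <> 0 /\
     c2 = a + b - c1 + 1 /\
     tau t * (1 - tau t) * C_derive tau t * ode1 E t =
       ode2 E t * ((c1 - (a + b + 1) * tau t) * (C_derive tau t * C_derive tau t)
         - tau t * (1 - tau t) * C_derive (C_derive tau) t) /\
     tau t * (1 - tau t) * C_derive tau t * ode0 E t =
       ode2 E t * (- (a * b) * (C_derive tau t * C_derive tau t * C_derive tau t)))).
  { revert Ht1. apply near_imp. intros t (HVt & Hrt & Het & Hyt). pose proof (HVU t HVt) as HUt.
    destruct (HE t HVt Hrt) as (EA & EB & EC & _). destruct Hrt as (Hx0 & Hy0 & _). simpl in Hx0, Hy0.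
    rewrite (Dx1 t HUt), (Dy1 t HUt) in EA. rewrite (Dx2 t HUt), (Dx1 t HUt), (Dy1 t HUt) in EB.
    rewrite (Dy2 t HUt), (Dx1 t HUt), (Dy1 t HUt) in EC.
    rewrite (Dy1 t HUt) in Hyt.
    destruct (Hxy_tau t HUt) as [Ext Eyt]. rewrite Ext in EA, EB, EC, Hx0.
    rewrite Eyt in EA, EB, EC, Hy0.
    assert (T0 : tau t <> 0) by (intros Q; apply Hx0; rewrite Q; ring).
    assert (T1 : 1 - tau t <> 0) by (intros Q; apply Hy0; rewrite Q; ring).
    assert (Td : C_derive tau t <> 0) by (intros Q; apply Hyt; rewrite Q; ring).
    split; auto. split; [exact (Cmult_neq_0 _ _ (Cmult_neq_0 _ _ T0 T1) Td)|].
    exact (pullback_relations a b c1 c2 s (tau t) (C_derive tau t) (C_derive (C_derive tau) t)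
      (ode0 E t) (ode1 E t) (ode2 E t) Hs0 Hs1 T0 T1 Td Het EA EB EC). }
  destruct (near_at _ _ Hrel) as (_ & Hu1 & Hc2 & _ & _).
  (* The leading coefficient of Euler's equation in the variable t. Multiplying [E] by [u] and
     Euler's equation by [ode2 E] makes the leading coefficients equal. *)
  set (u := fun t => tau t * (1 - tau t) * C_derive tau t) in *.
  assert (Hu : holomorphic_on U u) by (unfold u; holo).
  assert (R1 : forall t, U t -> u t * ode1 E t =
     ode2 E t * ((c1 - (a + b + 1) * tau t) * (C_derive tau t * C_derive tau t)
       - tau t * (1 - tau t) * C_derive (C_derive tau) t)).
  { apply (identity_eq U HU HUc (fun t => u t * ode1 E t)
      (fun t => ode2 E t * ((c1 - (a + b + 1) * tau t) * (C_derive tau t * C_derive tau t)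
       - tau t * (1 - tau t) * C_derive (C_derive tau) t)) t1); auto; try holo.
    revert Hrel. apply near_imp. intros t Ht. apply Ht. }
  assert (R0 : forall t, U t -> u t * ode0 E t =
     ode2 E t * (- (a * b) * (C_derive tau t * C_derive tau t * C_derive tau t))).
  { apply (identity_eq U HU HUc (fun t => u t * ode0 E t)
      (fun t => ode2 E t * (- (a * b) * (C_derive tau t * C_derive tau t * C_derive tau t))) t1);
      auto; try holo.
    revert Hrel. apply near_imp. intros t Ht. apply Ht. }
  exists c1, s, tau. split; [exact Htau|]. split.
  { exists tA, tB. split; auto. split; auto. intros Et. apply HtAB.
    destruct (Hxy_tau tA HtA) as [EA1 EA2]. destruct (Hxy_tau tB HtB) as [EB1 EB2].
    now rewrite EA1, EA2, EB1, EB2, Et. }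
  split; [reflexivity|]. split; [exact Hc2|]. split; [exact Hxy_tau|]. split.
  { exists u, (ode2 E). split; [exact Hu|]. split; [exact He2|].
    split; [exists t1; exact (conj HU1 Hu1)|]. split; [exact Ne2|].
    intros t Ht. split; [simpl; unfold u; ring|].
    split; [exact (R1 t Ht)|exact (R0 t Ht)]. }
  intros Hc W G HB t Ht HWt.
  destruct (hyp2F1_branch_euler a b c1 W G Hc HB) as (HW & HG & Heuler).
  pose proof (holomorphic_derive W G HW HG) as HG1.
  pose proof (holomorphic_derive W _ HW HG1) as HG2.
  assert (Hin : forall v, U v -> W (tau v) -> near v (fun w => U w /\ W (tau w))).
  { intros v Hv HWv. apply near_and; [now apply near_open|].
    destruct (near_open W _ HW HWv) as [d [Hd Hb]].
    generalize (cder_cont _ _ (Htau v Hv) d Hd). apply near_imp. intros w Hw. now apply Hb. }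
  assert (F1 : forall w, U w -> W (tau w) ->
    C_derive (fun t' => G (tau t')) w = C_derive G (tau w) * C_derive tau w).
  { intros w Hw HWw. apply cder_unique. apply (cder_comp G).
    - now apply excder_C_derive, HG.
    - now apply excder_C_derive, Htau. }
  assert (F2 : forall w, U w -> W (tau w) ->
    C_derive (C_derive (fun t' => G (tau t'))) w =
    C_derive (C_derive G) (tau w) * C_derive tau w * C_derive tau w +
    C_derive G (tau w) * C_derive (C_derive tau) w).
  { intros w Hw HWw.
    rewrite (C_derive_ext_near _ (fun v => C_derive G (tau v) * C_derive tau v)).
    - apply cder_unique.
      apply (cder_mult (fun v => C_derive G (tau v)));
        [apply (cder_comp (C_derive G))|].
      + now apply excder_C_derive, HG1.
      + now apply excder_C_derive, Htau.
      + now apply excder_C_derive, Htau1.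
    - generalize (Hin w Hw HWw). apply near_imp. intros v [Hv HWv]. now apply F1. }
  set (W' := fun w => U w /\ W (tau w)).
  set (S := fun w => ode2 E w * (C_derive (C_derive G) (tau w) * C_derive tau w * C_derive tau w +
      C_derive G (tau w) * C_derive (C_derive tau) w) +
    ode1 E w * (C_derive G (tau w) * C_derive tau w) + ode0 E w * G (tau w)).
  unfold ode_satisfied_at. rewrite F2, F1 by auto. change (S t = 0).
  (* Euler's equation gives u * S = 0, and [u] may vanish at [t]. If S t were not 0, then [S] would
     be nonzero near [t], where [u] has a nonzero too. [W'] need not be connected, so the identity
     theorem is applied to [u] on [U] and not to [S]. *)
  apply NNPP. intros HS.
  assert (HSc : ccont S t).
  { assert (Hcomp : forall g, holomorphic_on W g -> holomorphic_on W' (fun w => g (tau w))).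
    { intros g Hg w [Hw HWw]. destruct (Hg _ HWw) as [lg Hlg]. destruct (Htau w Hw) as [lt Hlt].
      eexists. apply cder_comp; eassumption. }
    assert (Hsub : forall g, holomorphic_on U g -> holomorphic_on W' g)
      by (intros g Hg w [Hw _]; now apply Hg).
    pose proof (Hcomp _ HG) as K0. pose proof (Hcomp _ HG1) as K1. pose proof (Hcomp _ HG2) as K2.
    pose proof (Hsub _ He0) as L0. pose proof (Hsub _ He1) as L1. pose proof (Hsub _ He2) as L2.
    pose proof (Hsub _ Htau1) as M1. pose proof (Hsub _ Htau2) as M2.
    assert (HSh : holomorphic_on W' S) by (unfold S; holo).
    apply cder_cont, HSh. now split. }
  assert (Hnear := near_and _ _ _ (Hin t Ht HWt) (ccont_neq0 S t HSc HS)).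
  destruct (nonzero_near U HU HUc u t _ Hu (ex_intro _ t1 (conj HU1 Hu1)) Ht Hnear)
    as [v (_ & [[Hv HWv] HSv] & _ & Huv)].
  apply (Cmult_neq_0 _ _ Huv HSv).
  pose proof (Heuler _ HWv) as Hev. unfold euler_expr in Hev.
  set (g0 := G (tau v)) in *. set (g1 := C_derive G (tau v)) in *.
  set (g2 := C_derive (C_derive G) (tau v)) in *.
  transitivity (u v * ode2 E v * (g2 * C_derive tau v * C_derive tau v + g1 * C_derive (C_derive tau) v)
    + (u v * ode1 E v) * (g1 * C_derive tau v) + (u v * ode0 E v) * g0).
  { unfold S. fold g0 g1 g2. ring. }
  rewrite (R1 v Hv), (R0 v Hv). unfold u.
  match type of Hev with ?L = _ =>
    transitivity (ode2 E v * (C_derive tau v * C_derive tau v * C_derive tau v) * L); [ring|] end.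
  rewrite Hev. ring.
Qed.
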